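(* Let $\Gamma$ be a compact quantum graph with $V$ vertices and $E$ edges. Let $H_K$ and $H_A$ be the Kirchhoff and anti-Kirchhoff Laplacians on $\Gamma$ (acting in $\Lambda^0(\Gamma)$ and $\Lambda^1(\Gamma)$ respectively), let $K_K$ and $K_A$ be the corresponding heat kernels, and let $d$ and $\delta=d^*$ be the exterior derivative operators (with the domains defined by the continuity conditions at each vertex for $d$, and by the sum of values being equal to zero at each vertex for $\delta$), so that $$H_K=\delta d\quad\text{and}\quad H_A=d\delta .$$ Then $$\operatorname{index}d=\operatorname{Tr}K_K-\operatorname{Tr}K_A=V-E,$$ the Euler characteristic of $\Gamma$.
   Context: A compact quantum graph $\Gamma$ is a metric graph (multiple edges and loops allowed) with finitely many vertices and edges, each edge being identified with an interval of finite positive length; every vertex has at least one edge attached. $d_v$ is the degree of $v$ (number of edge ends at $v$; a loop contributes two). $\Lambda^0(\Gamma)=L^2(\Gamma)$ is the space of square-integrable functions and $\Lambda^1(\Gamma)$ the space of square-integrable 1-forms $g(x)\,dx$ on the edges. At a vertex $v$, $f_1(v),\dots,f_{d_v}(v)$ denote the boundary values at $v$ along the $d_v$ incident edge ends (for a 1-form: the values of its coefficients relative to the arc-length coordinates outgoing from $v$), and $f_1'(v),\dots,f_{d_v}'(v)$ the corresponding derivatives in the directions outgoing from $v$. $H_K$ is $-d^2/dx^2$ on functions in $\bigoplus_eH^2(e)$ with Kirchhoff conditions at every vertex: $f_1(v)=\cdots=f_{d_v}(v)$ and $\sum_{e=1}^{d_v}f_e'(v)=0$. $H_A$ is $-d^2/dx^2$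 on (coefficients of) $H^2$ 1-forms with anti-Kirchhoff conditions at every vertex: $\sum_{e=1}^{d_v}f_e(v)=0$ and $f_1'(v)=\cdots=f_{d_v}'(v)$. The operator $d\colon\Lambda^0(\Gamma)\to\Lambda^1(\Gamma)$ is the exterior derivative with domain the functions in $\bigoplus_eH^1(e)$ continuous at every vertex; its adjoint $\delta\colon\Lambda^1(\Gamma)\to\Lambda^0(\Gamma)$ acts as $-d/dx$ with domain the $H^1$ 1-forms with $\sum_ef_e(v)=0$ at every vertex. $\operatorname{index}d=\dim\ker d-\operatorname{codim}\operatorname{ran}d=\dim\ker d-\dim\ker\delta$. $\operatorname{Tr}K_K=\operatorname{Tr}e^{-tH_K}$ and $\operatorname{Tr}K_A=\operatorname{Tr}e^{-tH_A}$ for $t>0$; the equality holds for every $t>0$. *)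

(* Defs.v *)
From HB Require Import structures.
From mathcomp Require Import all_boot all_order all_algebra.
From mathcomp Require Import complex.
From mathcomp Require Import all_classical all_reals all_analysis.

Set Implicit Arguments.
Unset Strict Implicit.
Unset Printing Implicit Defensive.
Import Order.TTheory GRing.Theory Num.Theory.
Import numFieldNormedType.Exports.

Local Open Scope classical_set_scope.
Local Open Scope ring_scope.
Local Open Scope complex_scope.

(* The edge e is the interval [0, edge_len e], running from edge_src e to
   edge_tgt e; loops and multiple edges are allowed. *)
Record quantum_graph (R : realType) := QuantumGraph {
  vertex : finType;
  edge : finType;
  edge_src : edge -> vertex;
  edge_tgt : edge -> vertex;
  edge_len : edge -> R;
  edge_len_gt0 : forall e, 0 < edge_len e;
  vertex_attached : forall v, exists e, edge_src e = v \/ edge_tgt e = v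
}.

Section Spaces.
Context {R : realType}.
Variable G : quantum_graph R.

(* Complex-valued functions on the edges. An element of this type represents a
   function on the graph, or the 1-form whose coefficient on the edge e is taken
   with respect to the coordinate of [0, edge_len e]. Only the values on
   [0, edge_len e] matter; elements of L^2 are taken up to [aeeq] below. *)
Definition field : Type := edge G -> R -> R[i]^o.
HB.instance Definition _ := GRing.Lmodule.on field.

Implicit Types (f g u w : field) (e : edge G) (t : R).

Definition dom e : set R := `[0, edge_len e].

Definition aeeq f g : Prop := forall e, ae_eq lebesgue_measure (dom e) (f e) (g e).

Definition null f : Prop := aeeq f 0.

Definition normsq (z : R[i]) : R := complex.Re z ^+ 2 + complex.Im z ^+ 2.

Definition L2 f : Prop := forall e,
  [/\ measurable_fun (dom e) (fun x => complex.Re (f e x)),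
      measurable_fun (dom e) (fun x => complex.Im (f e x)) &
      lebesgue_measure.-integrable (dom e) (fun x => (normsq (f e x))%:E)].

Definition Cintegral (D : set R) (h : R -> R[i]) : R[i] :=
  (\int[lebesgue_measure]_(x in D) complex.Re (h x)) +i*
  (\int[lebesgue_measure]_(x in D) complex.Im (h x)).

Definition inner f g : R[i] :=
  \sum_(e : edge G) Cintegral (dom e) (fun x => f e x * conjc (g e x)).

Definition L2norm f : R :=
  Num.sqrt (\sum_(e : edge G)
    \int[lebesgue_measure]_(x in dom e) normsq (f e x)).

(* f is, on each edge, absolutely continuous with square-integrable derivative
   f': it is the continuous representative of an H^1 function. *)
Definition H1 f f' : Prop := L2 f' /\
  forall e x, dom e x -> f e x = f e 0 + Cintegral `[0, x] (f' e).

(* An edge end is a pair (e, b): the end x = 0 of e if b = false, the end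
   x = edge_len e if b = true. *)
Definition end_vertex (p : edge G * bool) : vertex G :=
  if p.2 then edge_tgt p.1 else edge_src p.1.

Definition end_val f (p : edge G * bool) : R[i] :=
  if p.2 then f p.1 (edge_len p.1) else f p.1 0.

(* The outgoing coordinate at the end x = edge_len e is y = edge_len e - x.
   Hence [end_flux] is the boundary value of a 1-form relative to the outgoing
   coordinates, and [end_flux f'] is the outgoing derivative of a function f.
   For a 1-form with coefficient f the two changes of sign cancel, and its
   outgoing derivative is [end_val f']. *)
Definition end_flux f (p : edge G * bool) : R[i] :=
  if p.2 then - f p.1 (edge_len p.1) else f p.1 0.

Definition equal_at_vertices (a : edge G * bool -> R[i]) : Prop :=
  forall p q, end_vertex p = end_vertex q -> a p = a q.

Definition balanced_at_vertices (a : edge G * bool -> R[i]) : Prop :=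
  forall v, \sum_(p : edge G * bool | end_vertex p == v) a p = 0.

(* Unbounded operators on L^2 are given by their graphs: [A u w] means that u
   is in the domain of A and that A u = w. *)
Definition operator : Type := field -> field -> Prop.

Definition op_d : operator := fun u w =>
  [/\ L2 u, L2 w & exists f,
    [/\ aeeq u f, H1 f w & equal_at_vertices (end_val f)]].

Definition op_delta : operator := fun u w =>
  [/\ L2 u, L2 w & exists f,
    [/\ aeeq u f, H1 f (- w) & balanced_at_vertices (end_flux f)]].

Definition op_HK : operator := fun u w =>
  [/\ L2 u, L2 w & exists f f',
    [/\ aeeq u f, H1 f f', H1 f' (- w),
        equal_at_vertices (end_val f) &
        balanced_at_vertices (end_flux f')]].

Definition op_HA : operator := fun u w =>
  [/\ L2 u, L2 w & exists f f',
    [/\ aeeq u f, H1 f f', H1 f' (- w),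
        balanced_at_vertices (end_flux f) &
        equal_at_vertices (end_val f')]].

Definition op_comp (A B : operator) : operator := fun u w =>
  exists v, B u v /\ A v w.

Definition op_adjoint (A : operator) : operator := fun u w =>
  [/\ L2 u, L2 w & forall f g, A f g -> inner g u = inner f w].

Definition op_eq (A B : operator) : Prop := forall u w, A u w <-> B u w.

Definition op_ker (A : operator) : set field := [set u | A u 0].
Definition op_ran (A : operator) : set field := [set w | exists u, A u w].

(* The quotient vector space U / (U `&` W) has dimension n. *)
Definition dim_mod (U W : set field) (n : nat) : Prop :=
  exists b : 'I_n -> field,
    [/\ forall i, U (b i),
        forall c : 'I_n -> R[i], W (\sum_i c i *: b i) -> forall i, c i = 0 &
        forall u, U u -> exists c : 'I_n -> R[i], W (u - \sum_i c i *: b i)].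

Definition has_dim (U : set field) (n : nat) : Prop := dim_mod U null n.

Definition has_codim (W : set field) (n : nat) : Prop := dim_mod L2 W n.

Definition fredholm_index (A : operator) (k : int) : Prop :=
  exists m n, [/\ has_dim (op_ker A) m, has_codim (op_ran A) n &
                  k = m%:Z - n%:Z].

(* T t = e^{- t A}: T is the strongly continuous semigroup of bounded operators
   on L^2 with infinitesimal generator - A. *)
Record heat_semigroup (A : operator) (T : R -> field -> field) : Prop := {
  heat_L2 : forall t f, 0 <= t -> L2 f -> L2 (T t f);
  heat_linear : forall t (c : R[i]) f g, 0 <= t -> L2 f -> L2 g ->
    aeeq (T t (c *: f + g)) (c *: T t f + T t g);
  heat_bounded : forall t, 0 <= t -> exists M : R, forall f, L2 f ->
    L2norm (T t f) <= M * L2norm f;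
  heat_0 : forall f, L2 f -> aeeq (T 0 f) f;
  heat_D : forall s t f, 0 <= s -> 0 <= t -> L2 f ->
    aeeq (T (s + t) f) (T s (T t f));
  heat_continuous : forall t f, 0 <= t -> L2 f ->
    (fun s => L2norm (T s f - T t f)) @ within [set s | 0 <= s] (nbhs t)
      --> (0 : R);
  heat_generator : forall f g, L2 f -> L2 g ->
    (A f g <-> (fun t => L2norm ((t^-1)%:C *: (f - T t f) - g)) @ 0^'+
                 --> (0 : R))
}.

(* The family b is indexed by J, so that finite families are covered. *)
Definition orthonormal_basis (J : pred nat) (b : nat -> field) : Prop :=
  [/\ forall n, J n -> L2 (b n),
      forall m n, J m -> J n -> inner (b m) (b n) = (m == n)%:R &
      forall f, L2 f ->
        (fun N => L2norm (f - \sum_(n < N | J n) inner f (b n) *: b n))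
          @ \oo --> (0 : R)].

Definition cvgC (z : nat -> R[i]) (l : R[i]) : Prop :=
  (fun n => complex.Re (z n)) @ \oo --> complex.Re l /\
  (fun n => complex.Im (z n)) @ \oo --> complex.Im l.

(* The bounded operator B on L^2 is of trace class, with trace tau. Permutations
   of a basis are bases, so the convergence is unconditional. The existence of
   a basis is required so that the condition is not void. *)
Definition has_trace (B : field -> field) (tau : R[i]) : Prop :=
  (exists J b, orthonormal_basis J b) /\
  forall J b, orthonormal_basis J b ->
    cvgC (fun N => \sum_(n < N | J n) inner (B (b n)) (b n)) tau.

End Spaces.

Arguments op_d {R} G u w.
Arguments op_delta {R} G u w.
Arguments op_HK {R} G u w.
Arguments op_HA {R} G u w.

(* Main.v *)
(* By the one-dimensional Sobolev inequality, the graph norm of d embeds compactly in L^2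
   and the resolvent of delta d has finite trace. Minimizing the Rayleigh quotient |df|^2/|f|^2
   successively gives an orthonormal basis of eigenvectors b_k of delta d. If the eigenvalue
   l_k is positive, then d b_k / sqrt(l_k) is a normalized eigenvector of d delta for the same
   eigenvalue, and these vectors together with a basis of ker delta form a basis, because
   ran d is the orthogonal complement of ker delta. A heat semigroup multiplies an eigenvector
   by exp(-t l), so that Tr K_K - Tr K_A = dim ker d - dim ker delta. Both kernels consist of
   edgewise constants: they are the left kernels of the incidence matrix and of its
   transpose, and the ranks cancel in the difference of their dimensions. *)

Require Import Defs.
From HB Require Import structures.
From mathcomp Require Import all_boot all_order all_algebra.
From mathcomp Require Import complex ring lra.
From mathcomp Require Import all_classical all_reals all_analysis measurable_realfun.
Set Implicit Arguments.
Unset Strict Implicit.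
Unset Printing Implicit Defensive.
Import Order.TTheory GRing.Theory Num.Theory.
Import numFieldNormedType.Exports.
Local Open Scope classical_set_scope.
Local Open Scope ring_scope.
Local Open Scope complex_scope.

(** * Semi-inner products *)

(** The spaces L^2 are never divided by null functions: the abstract part works with a semi-definite
    form, and equality of vectors becomes [sq (u - v) = 0]. Operators are graphs, and each of [D]
    and [A] is the adjoint of the other; this alone supplies linearity and closedness, and it allows
    the roles of d and delta to be exchanged. The statement shapes two steps. A heat semigroup is
    arbitrary, known only through strong continuity and its generator, so its action on an
    eigenvector has to be derived, by a differential inequality for scalar functions. A trace has to
    come out the same in every orthonormal basis, so the sum of exp(-t l_k) is compared with the
    diagonal sum in another basis by exchanging a double sum of nonnegative terms. The resolvent
    trace bound serves twice: it forces the eigenvalues found by minimization to be unbounded if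
    they do not run out, which makes the eigenvectors total, and it makes the heat sums finite,
    through exp(-t s) <= (1 + 1/t) / (1 + s). *)

Local Notation Rep := complex.Re.
Local Notation Imp := complex.Im.

Section ComplexParts.
Context {R : realType}.
Implicit Types (x y z : R[i]) (r : R).

Lemma RepD x y : Rep (x + y) = Rep x + Rep y. Proof. by case: x y => [? ?] []. Qed.
Lemma ImpD x y : Imp (x + y) = Imp x + Imp y. Proof. by case: x y => [? ?] []. Qed.
Lemma RepN x : Rep (- x) = - Rep x. Proof. by case: x. Qed.
Lemma ImpN x : Imp (- x) = - Imp x. Proof. by case: x. Qed.
Lemma RepM x y : Rep (x * y) = Rep x * Rep y - Imp x * Imp y.
Proof. by case: x y => [? ?] []. Qed.
Lemma ImpM x y : Imp (x * y) = Rep x * Imp y + Imp x * Rep y.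
Proof. by case: x y => [? ?] []. Qed.
Lemma RepJ x : Rep (conjc x) = Rep x. Proof. by case: x. Qed.
Lemma ImpJ x : Imp (conjc x) = - Imp x. Proof. by case: x. Qed.
Lemma RepC r : Rep r%:C = r. Proof. by []. Qed.
Lemma ImpC r : Imp r%:C = 0. Proof. by []. Qed.
Lemma Rep_sum (I : Type) (s : seq I) (P : pred I) (F : I -> R[i]) :
  Rep (\sum_(i <- s | P i) F i) = \sum_(i <- s | P i) Rep (F i).
Proof. by elim/big_rec2: _ => // i x y _ <-; rewrite RepD. Qed.
Lemma Imp_sum (I : Type) (s : seq I) (P : pred I) (F : I -> R[i]) :
  Imp (\sum_(i <- s | P i) F i) = \sum_(i <- s | P i) Imp (F i).
Proof. by elim/big_rec2: _ => // i x y _ <-; rewrite ImpD. Qed.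
Lemma complex_ext x y : Rep x = Rep y -> Imp x = Imp y -> x = y.
Proof. by case: x y => [? ?] [? ?] /= -> ->. Qed.

Lemma normsq_ge0 z : 0 <= normsq z.
Proof. by rewrite addr_ge0 // sqr_ge0. Qed.
Lemma normsqM x y : normsq (x * y) = normsq x * normsq y.
Proof. by rewrite /normsq RepM ImpM; ring. Qed.
Lemma normsqN x : normsq (- x) = normsq x.
Proof. by rewrite /normsq RepN ImpN; ring. Qed.
Lemma normsqJ x : normsq (conjc x) = normsq x.
Proof. by rewrite /normsq RepJ ImpJ; ring. Qed.
Lemma normsqC r : normsq r%:C = r ^+ 2.
Proof. by rewrite /normsq RepC ImpC; ring. Qed.
Lemma normsq0 : normsq (0 : R[i]) = 0.
Proof. by rewrite /normsq /=; ring. Qed.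
Lemma normsq1 : normsq (1 : R[i]) = 1.
Proof. by rewrite /normsq /=; ring. Qed.
Lemma normsqD_le x y : normsq (x + y) <= 2 * normsq x + 2 * normsq y.
Proof.
rewrite /normsq RepD ImpD.
by have := sqr_ge0 (Rep x - Rep y); have := sqr_ge0 (Imp x - Imp y); nra.
Qed.
Lemma normsq_eq0 z : normsq z = 0 -> z = 0.
Proof.
move=> h; have h1 := sqr_ge0 (Rep z); have h2 := sqr_ge0 (Imp z).
by apply: complex_ext => /=; apply/eqP; rewrite -sqrf_eq0; apply/eqP; rewrite /normsq in h; lra.
Qed.
Lemma mulJ x : x * conjc x = (normsq x)%:C.
Proof. by apply: complex_ext; rewrite ?RepM ?ImpM RepJ ImpJ /= ?/normsq; ring. Qed.
Lemma normsq_Rep z : (Rep z) ^+ 2 <= normsq z.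
Proof. by rewrite lerDl sqr_ge0. Qed.
Lemma normsq_Imp z : (Imp z) ^+ 2 <= normsq z.
Proof. by rewrite lerDr sqr_ge0. Qed.
Lemma conjcC r : conjc r%:C = r%:C. Proof. exact: conjc_real. Qed.
Lemma conjcM x y : conjc (x * y) = conjc x * conjc y. Proof. exact: rmorphM. Qed.
Lemma conjcD x y : conjc (x + y) = conjc x + conjc y. Proof. exact: rmorphD. Qed.
Lemma conjcN x : conjc (- x) = - conjc x. Proof. exact: rmorphN. Qed.

End ComplexParts.

Record semiInner (R : realType) (V : lmodType R[i]) := SemiInner {
  ip :> V -> V -> R[i];
  ip_lin : forall c u v w, ip (c *: u + v) w = c * ip u w + ip v w;
  ip_conj : forall u v, ip u v = conjc (ip v u);
  ip_ge0 : forall u, 0 <= Rep (ip u u)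
}.

Section SemiInnerTheory.
Context {R : realType} {V : lmodType R[i]} (ip : semiInner V).
Implicit Types (u v w f g : V) (c : R[i]) (r : R).

Definition sq u : R := Rep (ip u u).

Lemma sq_ge0 u : 0 <= sq u. Proof. exact: ip_ge0. Qed.

Lemma ipDl u v w : ip (u + v) w = ip u w + ip v w.
Proof. by rewrite -[u in LHS]scale1r ip_lin mul1r. Qed.
Lemma ip0l w : ip 0 w = 0.
Proof. by apply: (addrI (ip 0 w)); rewrite -ipDl !addr0. Qed.
Lemma ipZl c u w : ip (c *: u) w = c * ip u w.
Proof. by rewrite -[c *: u]addr0 ip_lin ip0l addr0. Qed.
Lemma ipNl u w : ip (- u) w = - ip u w.
Proof. by rewrite -scaleN1r ipZl mulN1r. Qed.
Lemma ipBl u v w : ip (u - v) w = ip u w - ip v w.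
Proof. by rewrite ipDl ipNl. Qed.
Lemma ipDr u v w : ip w (u + v) = ip w u + ip w v.
Proof. by rewrite ip_conj ipDl rmorphD /= -!ip_conj. Qed.
Lemma ip0r w : ip w 0 = 0.
Proof. by rewrite ip_conj ip0l rmorph0. Qed.
Lemma ipZr c u w : ip w (c *: u) = conjc c * ip w u.
Proof. by rewrite ip_conj ipZl rmorphM /= -ip_conj. Qed.
Lemma ipNr u w : ip w (- u) = - ip w u.
Proof. by rewrite ip_conj ipNl rmorphN /= -ip_conj. Qed.
Lemma ipBr u v w : ip w (u - v) = ip w u - ip w v.
Proof. by rewrite ipDr ipNr. Qed.
Lemma ip_suml (I : Type) (s : seq I) (P : pred I) (F : I -> V) w :
  ip (\sum_(i <- s | P i) F i) w = \sum_(i <- s | P i) ip (F i) w.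
Proof. by elim/big_rec2: _ => [|i x y _ <-]; rewrite ?ip0l ?ipDl. Qed.
Lemma ip_sumr (I : Type) (s : seq I) (P : pred I) (F : I -> V) w :
  ip w (\sum_(i <- s | P i) F i) = \sum_(i <- s | P i) ip w (F i).
Proof. by elim/big_rec2: _ => [|i x y _ <-]; rewrite ?ip0r ?ipDr. Qed.

Lemma ipsq u : ip u u = (sq u)%:C.
Proof.
apply: complex_ext => //=.
by have := congr1 (@complex.Im R) (ip_conj ip u u); rewrite ImpJ; lra.
Qed.
Lemma sqD u v : sq (u + v) = sq u + sq v + 2 * Rep (ip u v).
Proof.
rewrite /sq !(ipDl, ipDr) !RepD.
have -> : Rep (ip v u) = Rep (ip u v) by rewrite ip_conj RepJ.
ring.
Qed.
Lemma sqZ c u : sq (c *: u) = normsq c * sq u.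
Proof. by rewrite /sq ipZl ipZr mulrA mulJ RepM /=; ring. Qed.
Lemma sqN u : sq (- u) = sq u.
Proof. by rewrite -scaleN1r sqZ normsqN normsq1 mul1r. Qed.
Lemma sqB u v : sq (u - v) = sq u + sq v - 2 * Rep (ip u v).
Proof. by rewrite sqD sqN ipNr RepN mulrN. Qed.
Lemma sq0 : sq 0 = 0. Proof. by rewrite /sq ip0l. Qed.
Lemma sqBC u v : sq (u - v) = sq (v - u).
Proof. by rewrite -sqN opprB. Qed.
Lemma sqD_le u v : sq (u + v) <= 2 * sq u + 2 * sq v.
Proof. by have := sq_ge0 (u - v); rewrite sqB sqD; lra. Qed.
Lemma sqB_le u v : sq (u - v) <= 2 * sq u + 2 * sq v.
Proof. by have := sqD_le u (- v); rewrite sqN. Qed.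

Lemma cauchy_schwarz u v : normsq (ip u v) <= sq u * sq v.
Proof.
set N := normsq _.
(* The factor [ip u v] in the subtracted multiple of [v] already has the right phase, so a real
   parameter [t] suffices. *)
have key t : 0 <= sq u - 2 * t * N + t ^+ 2 * N * sq v.
  have := sq_ge0 (u - (t%:C * ip u v) *: v).
  rewrite sqB sqZ ipZr normsqM normsqC conjcM conjcC.
  have -> : t%:C * conjc (ip u v) * ip u v = (t * N)%:C.
    by rewrite -mulrA [conjc _ * _]mulrC mulJ rmorphM.
  by rewrite RepC -/N; lra.
have N0 : 0 <= N := normsq_ge0 _.
have [s0|s0] := ltrP 0 (sq v).
  have := key (sq v)^-1.
  rewrite [X in _ + X](_ : _ = N / sq v); last by field; rewrite gt_eqF.
  move=> h; have h2 : N / sq v <= sq u by lra.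
  by rewrite ler_pdivrMr in h2.
have sv0 : sq v = 0 by apply/eqP; rewrite eq_le s0 sq_ge0.
rewrite sv0 mulr0 leNgt; apply/negP => Npos.
(* For a null [v] the bound [key] is affine in [t], and this [t] turns it into 0 <= -1. *)
have := key ((sq u + 1) / (2 * N)).
rewrite sv0 mulr0 addr0 (_ : 2 * _ * N = sq u + 1); first by lra.
by field; rewrite gt_eqF.
Qed.
Lemma ip_null_l u v : sq u = 0 -> ip u v = 0.
Proof.
move=> u0; apply: normsq_eq0; apply/eqP; rewrite eq_le normsq_ge0 andbT.
by have := cauchy_schwarz u v; rewrite u0 mul0r.
Qed.
Lemma ip_null_r u v : sq u = 0 -> ip v u = 0.
Proof. by move=> u0; rewrite ip_conj ip_null_l // rmorph0. Qed.
Lemma sq_eq_le0 u : sq u <= 0 -> sq u = 0.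
Proof. by move=> h; apply/eqP; rewrite eq_le h sq_ge0. Qed.
Lemma ip_eql u v w : sq (u - v) = 0 -> ip u w = ip v w.
Proof. by move=> h; apply/eqP; rewrite -subr_eq0 -ipBl ip_null_l. Qed.
Lemma ip_eqr u v w : sq (u - v) = 0 -> ip w u = ip w v.
Proof. by move=> h; apply/eqP; rewrite -subr_eq0 -ipBr ip_null_r. Qed.
Lemma sq_trans u v w : sq (u - v) = 0 -> sq (v - w) = 0 -> sq (u - w) = 0.
Proof.
move=> h1 h2; apply: sq_eq_le0.
have -> : u - w = (u - v) + (v - w) by rewrite addrA subrK.
by apply: le_trans (sqD_le _ _) _; rewrite h1 h2; lra.
Qed.

Definition cvgto (u : nat -> V) v := forall e, 0 < e ->
  exists N, forall n, (N <= n)%N -> sq (u n - v) < e.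

Lemma cvgto_ip (u : nat -> V) v w e : cvgto u v -> 0 < e ->
  exists N, forall n, (N <= n)%N -> normsq (ip (u n) w - ip v w) < e.
Proof.
move=> h e0; have s1 : 0 < sq w + 1 by rewrite ltr_wpDl // sq_ge0.
have [N hN] := h (e / (sq w + 1)) (divr_gt0 e0 s1).
exists N => n /hN hn; rewrite -ipBl; apply: le_lt_trans (cauchy_schwarz _ _) _.
apply: (@le_lt_trans _ _ (sq (u n - v) * (sq w + 1))).
  by rewrite ler_wpM2l ?sq_ge0 // lerDl.
by rewrite -ltr_pdivlMr.
Qed.

Lemma cvgto_ip_const (u : nat -> V) v w c :
  cvgto u v -> (exists N, forall n, (N <= n)%N -> ip (u n) w = c) -> ip v w = c.
Proof.
move=> h [N hN]; apply/eqP; rewrite -subr_eq0; apply/eqP/normsq_eq0.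
apply/eqP; rewrite eq_le normsq_ge0 andbT leNgt; apply/negP => hp.
have [M hM] := cvgto_ip w h hp.
have := hM (maxn M N) (leq_maxl _ _); rewrite hN ?leq_maxr //.
by rewrite -opprB normsqN ltxx.
Qed.

End SemiInnerTheory.

(** * Fourier series in a complete semi-inner product space *)

Section OrthonormalFamilies.
Context {R : realType} {V : lmodType R[i]} (ip : semiInner V).
Implicit Types (u v w f g : V) (b : nat -> V) (c : nat -> R[i]) (J : pred nat).
Local Notation sq := (sq ip).
Local Notation cvgto := (cvgto ip).

Definition seminorm_complete := forall u : nat -> V,
  (forall e, 0 < e ->
    exists N, forall m n, (N <= m)%N -> (N <= n)%N -> sq (u m - u n) < e) ->
  exists v, cvgto u v.

(* The vectors outside J are null, so that sums need not be restricted to J. *)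
Definition orthonormal_family b J := forall m n, ip (b m) (b n) = ((m == n) && J n)%:R.

Definition fourier_sum b N f := \sum_(0 <= k < N) ip f (b k) *: b k.

Definition spanning b := forall f, cvgto (fun N => fourier_sum b N f) f.

Lemma cvgto_trans v v' (s : nat -> V) : cvgto s v -> sq (v - v') = 0 ->
  cvgto s v'.
Proof.
move=> h h0 e e0; have [N hN] := h (e / 2) ltac:(lra).
exists N => n /hN hn; have -> : s n - v' = (s n - v) + (v - v').
  by rewrite addrA subrK.
by apply: le_lt_trans (sqD_le _ _ _) _; rewrite h0; lra.
Qed.

Lemma le_eps (x y : R) : (forall e, 0 < e -> x < y + e) -> x <= y.
Proof. by move=> h; apply/ler_addgt0Pr => e e0; apply/ltW/h. Qed.

Lemma cvgto_sq (s : nat -> V) v (r : R) : cvgto s v ->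
  (forall e, 0 < e -> exists N, forall n, (N <= n)%N -> sq (s n) < r + e) ->
  sq v <= r.
Proof.
move=> h hr; apply: le_eps => e e0.
have r0 : 0 <= r.
  apply: le_eps => d d0; have [N hN] := hr _ d0.
  by apply: le_lt_trans (sq_ge0 _ _) (hN _ (leqnn _)).
(* [sq v <= (1 + t) sq (s n) + (1 + 1/t) sq (v - s n)] *)
have key t w w' : 0 < t -> sq (w + w') <= (1 + t) * sq w + (1 + t^-1) * sq w'.
  move=> t0; have := sq_ge0 ip (t%:C *: w - w'); rewrite sqB sqZ normsqC ipZl.
  rewrite RepM RepC ImpC mul0r subr0 sqD => h1.
  suff : 2 * Rep (ip w w') <= t * sq w + t^-1 * sq w' by lra.
  have ti : 0 < t^-1 by rewrite invr_gt0.
  have h2 : t^-1 * (t ^+ 2 * sq w + sq w' - 2 * (t * Rep (ip w w'))) =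
    t * sq w + t^-1 * sq w' - 2 * Rep (ip w w') by field; rewrite gt_eqF.
  by have := mulr_ge0 (ltW ti) h1; rewrite h2; lra.
(* The weight [t] keeps the excess [t * sq (s n)] below [e / 2]; the large factor 1 + 1/t of the
   other term is then beaten by convergence, through the tolerance [d / t']. *)
set t := e / (2 * (r + e + 1)).
have t0 : 0 < t by rewrite divr_gt0 //; lra.
have te : t * (r + e) < e / 2.
  rewrite /t mulrAC ltr_pdivrMr; last lra.
  nra.
set d := e / 4.
have d0 : 0 < d by rewrite /d; lra.
have [N hN] := hr d d0.
set t' := (1 + t^-1).
have t'0 : 0 < t' by rewrite /t' ltr_pwDl // invr_ge0 ltW.
have [M hM] := h (d / t') (divr_gt0 d0 t'0).
have h1 := hN (maxn M N) (leq_maxr _ _); have h2 := hM (maxn M N) (leq_maxl _ _).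
rewrite ltr_pdivlMr // in h2.
have := key t (s (maxn M N)) (v - s (maxn M N)) t0.
rewrite addrC subrK (sqBC _ v) -/t'.
have s0 := sq_ge0 ip (s (maxn M N)).
have : t * sq (s (maxn M N)) <= t * (r + e).
  by rewrite ler_pM2l // /d in h1 *; lra.
by rewrite /d in h1 h2 *; lra.
Qed.

Lemma nonneg_sum_exists (a : nat -> R) (B : R) : (forall n, 0 <= a n) ->
  (forall N, \sum_(0 <= k < N) a k <= B) -> exists tau,
  (forall N, \sum_(0 <= k < N) a k <= tau) /\
  (forall e, 0 < e -> exists N, tau < \sum_(0 <= k < N) a k + e).
Proof.
move=> a0 aB.
pose S := [set \sum_(0 <= k < N) a k | N in [set: nat]].
have hS : has_sup S.
  by split; [exists (\sum_(0 <= k < 0) a k); exists 0%N | exists B => _ [N _ <-]].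
exists (sup S); split=> [N|e e0].
  by apply: ub_le_sup; [exact: hS.2 | exists N].
by have [_ [N _ <-] h] := sup_adherent e0 hS; exists N; lra.
Qed.

Section Family.
Context {b : nat -> V} {J : pred nat} (ob : orthonormal_family b J).

Lemma orthonormal_null n : ~~ J n -> sq (b n) = 0.
Proof. by move=> /negPf hJ; rewrite /sq ob eqxx hJ. Qed.

Lemma coef_notJ f n : ~~ J n -> ip f (b n) = 0.
Proof. by move/orthonormal_null/ip_null_r. Qed.

Lemma ip_comb c M N n :
  ip (\sum_(M <= k < N) c k *: b k) (b n) = if (M <= n < N)%N && J n then c n else 0.
Proof.
rewrite ip_suml.
under eq_bigr do rewrite ipZl ob.
have [hn|hn] := boolP (M <= n < N)%N; last first.
  rewrite big_nat big1 // => i hi; case: eqP => [e|]; last by rewrite mulr0.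
  by rewrite -e hi in hn.
rewrite (bigD1_seq n) ?mem_index_iota ?iota_uniq //= eqxx /=.
rewrite big1 ?addr0; first by case: (J n); rewrite ?mulr1 ?mulr0.
by move=> i /negPf ->; rewrite mulr0.
Qed.

Lemma sq_comb c M N :
  sq (\sum_(M <= k < N) c k *: b k) = \sum_(M <= k < N) (J k)%:R * normsq (c k).
Proof.
rewrite /sq ip_sumr Rep_sum big_nat [RHS]big_nat; apply: eq_bigr => k hk.
rewrite ipZr ip_comb hk /=; case: (J k) => /=; last by rewrite mulr0 mul0r.
by rewrite mulrC mulJ mul1r.
Qed.

Lemma sq_coef f k : (J k)%:R * normsq (ip f (b k)) = normsq (ip f (b k)).
Proof.
have [_|/(coef_notJ f) ->] := boolP (J k); first by rewrite mul1r.
by rewrite normsq0 mulr0.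
Qed.

Lemma ip_proj f N n : (n < N)%N -> ip (f - fourier_sum b N f) (b n) = 0.
Proof.
move=> h; rewrite ipBl ip_comb h /=; have [_|/(coef_notJ f) ->] := boolP (J n).
  by rewrite subrr.
by rewrite subr0.
Qed.

Lemma sq_projB f N :
  sq (f - fourier_sum b N f) = sq f - \sum_(0 <= k < N) normsq (ip f (b k)).
Proof.
rewrite sqB sq_comb ip_sumr Rep_sum.
have -> : \sum_(0 <= i < N) Rep (ip f (ip f (b i) *: b i)) =
          \sum_(0 <= k < N) normsq (ip f (b k)).
  by apply: eq_bigr => k _; rewrite ipZr mulrC mulJ RepC.
have -> : \sum_(0 <= k < N) (J k)%:R * normsq (ip f (b k)) =
          \sum_(0 <= k < N) normsq (ip f (b k)).
  by apply: eq_bigr => k _; rewrite sq_coef.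
by ring.
Qed.

Lemma bessel f N : \sum_(0 <= k < N) normsq (ip f (b k)) <= sq f.
Proof. by have := sq_ge0 ip (f - fourier_sum b N f); rewrite sq_projB; lra. Qed.

Lemma parseval f e : cvgto (fun N => fourier_sum b N f) f -> 0 < e ->
  exists N, forall n, (N <= n)%N ->
    sq f - \sum_(0 <= k < n) normsq (ip f (b k)) < e.
Proof.
move=> h e0; have [N hN] := h e e0.
by exists N => n /hN; rewrite sqBC sq_projB.
Qed.

Lemma spanning_null f : spanning b -> (forall n, ip f (b n) = 0) -> sq f = 0.
Proof.
move=> hb h; apply: sq_eq_le0; apply: le_eps => e e0.
have [N hN] := parseval (hb f) e0; have := hN N (leqnn _).
rewrite big1 ?subr0 ?add0r // => k _; by rewrite h normsq0.
Qed.

Lemma spanning_eq f g : spanning b -> (forall n, ip f (b n) = ip g (b n)) ->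
  sq (f - g) = 0.
Proof. by move=> hb h; apply: spanning_null => // n; rewrite ipBl h subrr. Qed.

Lemma bounded_sums_cauchy (a : nat -> R) (B : R) : (forall n, 0 <= a n) ->
  (forall N, \sum_(0 <= k < N) a k <= B) -> forall e, 0 < e ->
  exists N, forall M n, (N <= M)%N -> \sum_(M <= k < n) a k < e.
Proof.
move=> a0 aB e e0.
have [tau [ub lub]] := nonneg_sum_exists a0 aB; have [N hN] := lub e e0.
exists N => M n NM.
have [Mn|nM] := leqP M n; last by rewrite big_geq // ltnW.
have h1 := ub n.
have h2 : \sum_(0 <= k < N) a k <= \sum_(0 <= k < M) a k.
  rewrite (big_cat_nat (n := N) _ NM) //= lerDl.
  by apply: sumr_ge0.
rewrite (big_cat_nat (n := M) _ Mn) //= in h1.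
lra.
Qed.

(** The partial sums are Cauchy because the distance of two of them is a block of the convergent
    series of [normsq (c k)]. Coefficients off [J] have to vanish, as the null vectors [b n] there
    cannot return them. *)
Lemma riesz_fischer c (B : R) : seminorm_complete ->
  (forall n, ~~ J n -> c n = 0) ->
  (forall N, \sum_(0 <= k < N) normsq (c k) <= B) ->
  exists g, cvgto (fun N => \sum_(0 <= k < N) c k *: b k) g /\
            forall n, ip g (b n) = c n.
Proof.
move=> hc cJ cB.
have [|g hg] := hc (fun N => \sum_(0 <= k < N) c k *: b k).
  move=> e e0.
  have [N hN] := bounded_sums_cauchy (fun n => normsq_ge0 (c n)) cB e0.
  have key m n : (N <= m)%N -> (m <= n)%N ->
    sq (\sum_(0 <= k < n) c k *: b k - \sum_(0 <= k < m) c k *: b k) < e.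
    move=> Nm mn; rewrite (big_cat_nat (n := m) _ mn) //= [X in sq (X - _)]addrC addrK sq_comb.
    apply: le_lt_trans (hN m n Nm); apply: ler_sum => k _.
    by case: (J k); rewrite ?mul1r ?mul0r ?normsq_ge0.
  exists N => m n Nm Nn; have [mn|/ltnW nm] := leqP m n; last exact: key.
  by rewrite sqBC; exact: key.
exists g; split => // n; apply: cvgto_ip_const hg _.
exists n.+1 => m nm; rewrite ip_comb nm /=.
by case: (boolP (J n)) => // /cJ ->.
Qed.

(** By Bessel and completeness the Fourier series of [f] converges to some [g] with the same
    coefficients; totality, applied to the difference of [g] and [f], makes it null. *)
Lemma total_spanning : seminorm_complete ->
  (forall f, (forall n, ip f (b n) = 0) -> sq f = 0) -> spanning b.
Proof.
move=> hc ht f.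
have [||g [hg hgc]] := @riesz_fischer (fun n => ip f (b n)) (sq f) hc.
- exact: coef_notJ.
- exact: bessel.
refine (cvgto_trans hg _); apply: ht => n; by rewrite ipBl hgc subrr.
Qed.

End Family.
End OrthonormalFamilies.

(** * Spectral decomposition of an adjoint pair *)

Lemma invS_lt {R : realType} (e : R) : 0 < e ->
  exists N, forall n, (N <= n)%N -> n.+1%:R^-1 < e.
Proof.
move=> e0; have [N _ hN] := near_infty_natSinv_lt (PosNum e0).
by exists N => n /hN.
Qed.

Lemma sqr_lt {R : realType} (x y : R) : 0 < y -> x ^+ 2 < y ^+ 2 -> x < y.
Proof. by move=> y0 h; rewrite ltNge; apply/negP => h'; nra. Qed.

Section AdjointPairs.
Context {R : realType} {V : lmodType R[i]} (ip : semiInner V).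
Implicit Types (u v w f g : V) (b : nat -> V) (c : R[i]) (J : pred nat).
Implicit Types D A : V -> V -> Prop.
Local Notation sq := (sq ip).
Local Notation cvgto := (cvgto ip).
Local Notation orthonormal_family := (orthonormal_family ip).
Local Notation fourier_sum := (fourier_sum ip).
Local Notation spanning := (spanning ip).

(** An equivalence, so that [A] is the whole adjoint. Linearity, closedness and invariance under
    null vectors of [A] all follow from it; assumed in both directions, it gives them to [D] too. *)
Definition adjoint_of D A := forall u w,
  A u w <-> (forall f g, D f g -> ip g u = ip f w).

Section Adjoint.
Context {D A : V -> V -> Prop} (adj : adjoint_of D A).

Lemma adjointP f g u w : D f g -> A u w -> ip g u = ip f w.
Proof. by move=> h /adj; apply. Qed.

Lemma adjoint_lin c u w u' w' : A u w -> A u' w' -> A (c *: u + u') (c *: w + w').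
Proof.
move=> /adj h /adj h'; apply/adj => f g hfg.
by rewrite !ipDr !ipZr (h _ _ hfg) (h' _ _ hfg).
Qed.

Lemma adjoint0 : A 0 0.
Proof. by apply/adj => f g _; rewrite !ip0r. Qed.

Lemma adjointZ c u w : A u w -> A (c *: u) (c *: w).
Proof. by move=> h; have := adjoint_lin c h adjoint0; rewrite !addr0. Qed.

Lemma adjointD u w u' w' : A u w -> A u' w' -> A (u + u') (w + w').
Proof. by move=> h h'; have := adjoint_lin 1 h h'; rewrite !scale1r. Qed.

Lemma adjointB u w u' w' : A u w -> A u' w' -> A (u - u') (w - w').
Proof.
move=> h h'; apply: adjointD => //; by have := adjointZ (-1) h'; rewrite !scaleN1r.
Qed.

Lemma adjoint_comb (a : nat -> R[i]) (u w : nat -> V) M N :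
  (forall k, A (u k) (w k)) ->
  A (\sum_(M <= k < N) a k *: u k) (\sum_(M <= k < N) a k *: w k).
Proof.
move=> h; elim/big_rec2: _ => [|k x y _]; first exact: adjoint0.
exact: adjoint_lin (h k).
Qed.

Lemma adjoint_null u u' w w' : sq (u - u') = 0 -> sq (w - w') = 0 ->
  A u w -> A u' w'.
Proof.
move=> hu hw /adj h; apply/adj => f g hfg.
by rewrite -(ip_eqr _ hu) -(ip_eqr _ hw); apply: h.
Qed.

Lemma adjoint_closed (s t : nat -> V) u w : (forall n, A (s n) (t n)) ->
  cvgto s u -> cvgto t w -> A u w.
Proof.
move=> h hu hw; apply/adj => f g hfg.
rewrite (ip_conj ip g) (ip_conj ip f); congr conjc.
apply/eqP; rewrite -subr_eq0; apply/eqP/normsq_eq0/eqP.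
rewrite eq_le normsq_ge0 andbT; apply: le_eps => e e0; rewrite add0r.
have e4 : 0 < e / 4 by lra.
have [N hN] := cvgto_ip g hu e4; have [M hM] := cvgto_ip f hw e4.
have := hN (maxn N M) (leq_maxl _ _); have := hM (maxn N M) (leq_maxr _ _).
set n := maxn N M.
have -> : ip (s n) g = ip (t n) f.
  by rewrite ip_conj (adjointP hfg (h n)) -ip_conj.
set x := ip (t n) f => h1 h2.
have -> : ip u g - ip w f = (x - ip w f) + (- (x - ip u g)) by ring.
by apply: le_lt_trans (normsqD_le _ _) _; rewrite normsqN; lra.
Qed.

End Adjoint.

(* Balls of the graph norm are relatively compact in V: every ultrafilter on a ball is
   Cauchy for the seminorm of V. *)
Definition compact_embedding D := forall (U : set_system (V * V)) (M : R),
  UltraFilter U -> U [set p | D p.1 p.2 /\ sq p.1 + sq p.2 <= M] ->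
  forall e : R, 0 < e -> exists E : set (V * V),
    U E /\ forall p q, E p -> E q -> sq (p.1 - q.1) < e.

(* The trace of the inverse of [1 + D^* D] is at most [C]. *)
Definition resolvent_trace_bound D (C : R) :=
  forall (N : nat) (u w : nat -> V), (forall k, D (u k) (w k)) ->
    (forall i j, i != j -> ip (u i) (u j) = 0) ->
    (forall i j, i != j -> ip (w i) (w j) = 0) ->
    (forall k, sq (u k) <= 1) ->
  \sum_(0 <= k < N) sq (u k) / (1 + sq (w k)) <= C.

Section Minimizer.
Context {D A : V -> V -> Prop} (adjA : adjoint_of D A) (adjD : adjoint_of A D).
Hypothesis complete : seminorm_complete ip.
Hypothesis compactD : compact_embedding D.

Definition admissible (s : set V) f w := D f w /\ forall g, s g -> ip f g = 0.

Lemma admissible_lin s c f w f' w' : admissible s f w -> admissible s f' w' ->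
  admissible s (c *: f + f') (c *: w + w').
Proof.
move=> [h1 h2] [h1' h2']; split; first exact: adjoint_lin adjD _ _ _ _ _ h1 h1'.
by move=> g hg; rewrite ip_lin h2 ?h2' // mulr0 addr0.
Qed.

Definition minimizer (s : set V) f w :=
  [/\ admissible s f w, sq f = 1 &
      forall g v, admissible s g v -> sq w * sq g <= sq v].

(** In place of a minimizing sequence with a convergent subsequence, an ultrafilter finer than the
    sets of near-minimizers is used. The compact embedding makes it Cauchy in the first component;
    the parallelogram law carries this to the second. A sequence is then drawn from its sets, and
    completeness and closedness of [D] give the limit pair. *)
Lemma minimizer_exists s : (exists f w, admissible s f w /\ sq f <> 0) ->
  exists f w, minimizer s f w.
Proof.
move=> [f0 [w0 [h0 n0]]].
have normalize g v : admissible s g v -> sq g <> 0 -> exists r : R,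
    r ^+ 2 = (sq g)^-1 /\ admissible s (r%:C *: g) (r%:C *: v).
  move=> h hg; exists (Num.sqrt (sq g)^-1); split.
    by rewrite sqr_sqrtr // invr_ge0 sq_ge0.
  have a0 : admissible s 0 0.
    by split; [exact: adjoint0 adjD|move=> ? _; rewrite ip0l].
  by have := admissible_lin (Num.sqrt (sq g)^-1)%:C h a0; rewrite !addr0.
pose S := [set r | exists f w, [/\ admissible s f w, sq f = 1 & r = sq w]].
have S0 : S !=set0.
  have [r [hr ha]] := normalize _ _ h0 n0.
  exists (sq (r%:C *: w0)), (r%:C *: f0), (r%:C *: w0); split => //.
  by rewrite sqZ normsqC hr mulVf //; apply/eqP.
have Sinf : has_inf S by split => //; exists 0 => _ [f [w [_ _ ->]]]; exact: sq_ge0.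
set m := inf S.
have m0 : 0 <= m by apply: lb_le_inf => // _ [f [w [_ _ ->]]]; exact: sq_ge0.
have hm g v : admissible s g v -> m * sq g <= sq v.
  move=> h; have [-> |/eqP hg] := eqVneq (sq g) 0; first by rewrite mulr0 sq_ge0.
  have [r [hr ha]] := normalize _ _ h hg.
  have : m <= sq (r%:C *: v).
    apply: ge_inf; first exact: Sinf.2.
    exists (r%:C *: g), (r%:C *: v); split => //.
    by rewrite sqZ normsqC hr mulVf //; apply/eqP.
  rewrite sqZ normsqC hr mulrC ler_pdivlMr //.
  by rewrite lt_neqAle sq_ge0 andbT eq_sym; apply/eqP.
pose B (e : R) := [set p : V * V |
  [/\ admissible s p.1 p.2, sq p.1 = 1 & sq p.2 < m + e]].
have FB : ProperFilter (filter_from [set e : R | 0 < e] B).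
  apply: filter_from_proper.
    apply: filter_from_filter; first by exists 1; rewrite /= ltr01.
    move=> i j i0 j0; exists (Num.min i j); first by rewrite /= lt_min i0.
    move=> p [h1 h2 h3]; split; split => //; apply: (lt_le_trans h3);
      by rewrite lerD2l ge_min lexx ?orbT.
  move=> e e0; have [_ [f [w [h1 h2 ->]]] hw] := inf_adherent e0 Sinf.
  by exists (f, w).
have [U [UU sU]] := ultraFilterLemma FB.
have UB e : 0 < e -> U (B e) by move=> e0; apply: sU; exists e.
have cauchy e : 0 < e -> exists E : set (V * V), U E /\
    forall p q, E p -> E q -> sq (p.1 - q.1) < e /\ sq (p.2 - q.2) < e.
  move=> e0; pose d := e / (4 * (m + 1)).
  have d0 : 0 < d by rewrite /d divr_gt0 //; lra.
  have md : m * d < e / 4.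
    by rewrite /d mulrA ltr_pdivrMr; [nra|lra].
  have de : d <= e by rewrite /d ler_pdivrMr; [nra|lra].
  have [|E [UE hE]] := compactD (M := 1 + (m + 1)) UU _ d0.
    apply: filterS (UB 1 ltr01) => p [[h1 _] h2 h3]; split => //.
    by rewrite h2; lra.
  exists (E `&` B (e / 8)); split; first by apply: filterI => //; apply: UB; lra.
  move=> p q [Ep [ap p1 pm]] [Eq [aq q1 qm]].
  have hpq := hE _ _ Ep Eq; split; first exact: lt_le_trans hpq de.
  (* The sum of two near-minimizers is admissible, so [sq (p.2 + q.2)] is at least [m * sq (p.1 +
     q.1) = m * (4 - sq (p.1 - q.1))]. The parallelogram law then bounds [sq (p.2 - q.2)] by
     [4 * (e / 8) + m * d < e]. *)
  have := hm _ _ (admissible_lin 1 ap aq); rewrite !scale1r.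
  have parallelogram u v : sq (u + v) = 2 * sq u + 2 * sq v - sq (u - v).
    by rewrite sqD sqB; ring.
  rewrite (parallelogram p.1 q.1) (parallelogram p.2 q.2) p1 q1.
  have := ler_wpM2l m0 (ltW hpq); lra.
have inv0 (k : nat) : 0 < (k.+1%:R : R)^-1 by rewrite invr_gt0.
pose E k := projT1 (cid (cauchy _ (inv0 k))).
have EP k : U (E k) /\ forall p q, E k p -> E k q ->
    sq (p.1 - q.1) < k.+1%:R^-1 /\ sq (p.2 - q.2) < k.+1%:R^-1.
  exact: projT2 (cid (cauchy _ (inv0 k))).
(* Asking for membership in all earlier sets [E j] makes the sequence Cauchy: from index [N] on, all
   its terms lie in [E N]. *)
have hp k : exists p, B k.+1%:R^-1 p /\ forall j, (j <= k)%N -> E j p.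
  apply: (@filter_ex _ U); apply: filterI; first exact: UB.
  elim: k => [|k IH]; first by apply: filterS (EP 0%N).1 => p hp [].
  apply: filterS (filterI IH (EP k.+1).1) => p [h1 h2] j.
  by rewrite leq_eqVlt => /predU1P[->|/h1].
pose p k := projT1 (cid (hp k)).
have pB k : B k.+1%:R^-1 (p k) by have [] := projT2 (cid (hp k)).
have pE k j : (j <= k)%N -> E j (p k).
  by have [_] := projT2 (cid (hp k)); apply.
have [|f hf] := complete (u := fun k => (p k).1).
  move=> e e0; have [N hN] := invS_lt e0; exists N => i j Ni Nj.
  have [h _] := (EP N).2 _ _ (pE _ _ Ni) (pE _ _ Nj).
  exact: lt_trans h (hN _ (leqnn _)).
have [|w hw] := complete (u := fun k => (p k).2).
  move=> e e0; have [N hN] := invS_lt e0; exists N => i j Ni Nj.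
  have [_ h] := (EP N).2 _ _ (pE _ _ Ni) (pE _ _ Nj).
  exact: lt_trans h (hN _ (leqnn _)).
have af : admissible s f w.
  split; first by apply: (adjoint_closed adjD _ hf hw) => n; have [[]] := pB n.
  move=> g sg; apply: (cvgto_ip_const hf); exists 0%N => n _.
  by have [[_ ->]] := pB n.
have sf : sq f = 1.
  apply/eqP; rewrite eq_le; apply/andP; split.
    apply: (cvgto_sq hf) => e e0; exists 0%N => n _.
    by have [_ -> _] := pB n; lra.
  have h1 : cvgto (fun k => (p k).1 - f) 0.
    by move=> e /hf [N hN]; exists N => n /hN; rewrite subr0.
  apply: le_eps => e e0.
  have [e1 e1'] : 0 < e / 4 /\ 0 < (e / 4) ^+ 2 by split; nra.
  have e2 : 0 < Num.min (e / 4) ((e / 4) ^+ 2) by rewrite lt_min e1.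
  have [N hN] := cvgto_ip f hf e2.
  have [M hM] := hf (e / 4) e1.
  have := hN (maxn N M) (leq_maxl _ _); have := hM (maxn N M) (leq_maxr _ _).
  have [_ p1 _] := pB (maxn N M); rewrite -ipBl sqB p1 ipBl ipsq.
  set z := ip _ f => h2; rewrite lt_min => /andP[_ h3].
  have := le_lt_trans (normsq_Rep _) h3; rewrite RepD RepN RepC => h4.
  have h5 := sqr_lt e1 h4.
  lra.
exists f, w; split => // g v /hm; apply: le_trans.
apply: ler_wpM2r; first exact: sq_ge0.
apply: (cvgto_sq hw) => e e0; have [N hN] := invS_lt e0; exists N => n Nn.
have [_ _ h] := pB n; apply: (lt_trans h); by rewrite ltrD2l; apply: hN.
Qed.
End Minimizer.
End AdjointPairs.

Section Spectral.
Context {R : realType} {V : lmodType R[i]} (ip : semiInner V).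
Implicit Types (u v w f g : V) (b : nat -> V) (c : R[i]) (J : pred nat).
Local Notation sq := (sq ip).
Local Notation cvgto := (cvgto ip).
Local Notation orthonormal_family := (orthonormal_family ip).
Local Notation fourier_sum := (fourier_sum ip).
Local Notation spanning := (spanning ip).
Context {D A : V -> V -> Prop}.
Hypotheses (adjA : adjoint_of ip D A) (adjD : adjoint_of ip A D).
Local Notation minimizer := (@minimizer _ _ ip D).
Local Notation admissible := (@admissible _ _ ip D).

(* The Euler-Lagrange equation, tested against admissible variations. *)
Lemma minimizer_variation s f w g v : minimizer s f w -> admissible s g v ->
  ip v w = ip g ((sq w)%:C *: f).
Proof.
move=> [af sf hmin] ag; set l := sq w.
apply/eqP; rewrite -subr_eq0; apply/eqP/normsq_eq0.
set z := _ - _; set N := normsq z.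
have Q0 : 0 <= sq v - l * sq g by rewrite subr_ge0 hmin.
set Q := _ - _ in Q0.
(* Moving the minimizer by [- t * conjc z] times [g] changes the quadratic functional by
   [- 2 * t * N] to first order and by [t ^+ 2 * N * Q] to second order. Since [t * Q < 1],
   minimality fails unless [N = 0]. *)
pose t := (Q + 1)^-1.
have t0 : 0 < t by rewrite invr_gt0; lra.
have tQ : t * Q < 1 by rewrite mulrC ltr_pdivrMr; lra.
have := hmin _ _ (admissible_lin adjD (- (t%:C * conjc z)) ag af).
rewrite !sqD !sqZ !ipZl sf -/l normsqN normsqM normsqJ normsqC -/N => h.
have e : Rep (- (t%:C * conjc z) * ip v w) - l * Rep (- (t%:C * conjc z) * ip g f) =
         - (t * N).
  have -> : l * Rep (- (t%:C * conjc z) * ip g f) =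
            Rep (- (t%:C * conjc z) * ip g (l%:C *: f)).
    by rewrite ipZr conjcC mulrCA [RHS]RepM RepC ImpC mul0r subr0.
  rewrite -RepN -RepD -mulrBr -/z mulNr -mulrA [conjc z * z]mulrC mulJ.
  by rewrite RepN RepM !RepC !ImpC mulr0 subr0.
have N0 : 0 <= N := normsq_ge0 z.
have h2 : 2 * t * N <= t ^+ 2 * N * Q by rewrite /Q; lra.
have h3 : t * N * (2 - t * Q) <= 0 by lra.
apply/eqP; rewrite eq_le N0 andbT leNgt; apply/negP => Np.
have h4 : 0 < t * N * (2 - t * Q) by apply: mulr_gt0; [exact: mulr_gt0 | lra].
by rewrite ltNge h3 in h4.
Qed.

(** The orthogonality constraints leave no multipliers. An arbitrary [g] becomes admissible after
    subtraction of its Fourier sum, and the subtracted terms contribute nothing: [f] is orthogonal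
    to [b k], and [w] to [v k] because [A (v k)] is a multiple of [b k]. *)
Lemma minimizer_eigen b J (v : nat -> V) (l : nat -> R) n f w :
  orthonormal_family b J -> (forall k, D (b k) (v k)) ->
  (forall k, (k < n)%N -> A (v k) ((l k)%:C *: b k)) ->
  minimizer [set g | exists2 k, (k < n)%N & g = b k] f w ->
  A w ((sq w)%:C *: f).
Proof.
move=> ob Db Av hmin; have [[Dfw orth] sf _] := hmin.
apply/adjA => g u Dgu.
pose u0 := u - \sum_(0 <= k < n) ip g (b k) *: v k.
have a0 : admissible [set g | exists2 k, (k < n)%N & g = b k] (g - fourier_sum b n g) u0.
  split; last by move=> _ [k kn ->]; exact: ip_proj ob _ _ _ kn.
  by apply: (adjointB adjD) => //; exact: (adjoint_comb adjD).
have := minimizer_variation hmin a0; rewrite !ipBl !ip_suml.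
rewrite big_nat big1 ?subr0; last first.
  move=> k /andP[_ kn]; rewrite ipZl (ip_conj ip (v k)) (adjointP adjA Dfw (Av k kn)).
  by rewrite ipZr orth ?mulr0 ?rmorph0 ?mulr0 //; exists k.
rewrite big_nat big1 ?subr0 // => k /andP[_ kn].
by rewrite ipZl ipZr (ip_conj ip (b k)) orth ?rmorph0 ?mulr0 //; exists k.
Qed.

Hypothesis complete : seminorm_complete ip.
Hypothesis compactD : compact_embedding ip D.

(** Each choice depends on all earlier ones, so the recursion runs over the list of pairs chosen so
    far. When no minimizer is left the default [(0, 0)] is taken; the index is then outside [J],
    which covers spaces of finite dimension. *)
Lemma greedy_minimizers : exists p : nat -> V * V, forall n,
  let s := [set g | exists2 k, (k < n)%N & g = (p k).1] in
  minimizer s (p n).1 (p n).2 \/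
  p n = (0, 0) /\ ~ (exists f w, minimizer s f w).
Proof.
pose ran (s : seq (V * V)) := [set g | exists2 r, r \in s & g = r.1].
pose next s := xget (0, 0) [set p : V * V | minimizer (ran s) p.1 p.2].
pose build n := iter n (fun s => rcons s (next s)) [::].
pose p n := next (build n).
have mem n r : r \in build n <-> exists2 k, (k < n)%N & r = p k.
  elim: n r => [|n IH] r /=; first by split => // -[].
  rewrite mem_rcons in_cons; split.
    case/predU1P => [->|h]; first by exists n.
    by have [k kn ->] := (IH _).1 h; exists k => //; exact: ltnW.
  move=> [k]; rewrite ltnS leq_eqVlt => /predU1P[->|kn] ->; rewrite ?eqxx //.
  apply/orP; right; apply/(IH _).2; by exists k.
exists p => n s.
have -> : s = ran (build n).
  apply/seteqP; split => [g [k kn ->]|g [r /mem[k kn ->] ->]].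
    by exists (p k) => //; apply/mem; exists k.
  by exists k.
have [[q hq]|h] := pselect (exists q : V * V, minimizer (ran (build n)) q.1 q.2).
  by left; exact: (xgetPex (0, 0) (P := [set p : V * V | minimizer (ran (build n)) p.1 p.2]) (ex_intro _ q hq)).
right; split; last by move=> [f [w hw]]; apply: h; exists (f, w).
by rewrite /p /next xgetPN // => q hq; apply: h; exists q.
Qed.

(** Density of the domain of [D] in disguise: a vector orthogonal to that domain is related to 0 by
    [A]. *)
Hypothesis injA : forall w, A 0 w -> sq w = 0.
Context {C : R} (traceD : resolvent_trace_bound ip D C).

(** The eigenvalue is [sq (v k)], since it is the Rayleigh quotient of the unit vector [b k] whose
    image under [D] is [v k]. *)
Record eigenbasis b J (v : nat -> V) := Eigenbasis {
  eigen_orthonormal : orthonormal_family b J;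
  eigen_D : forall k, D (b k) (v k);
  eigen_A : forall k, A (v k) ((sq (v k))%:C *: b k);
  eigen_spanning : spanning b
}.

Lemma eigen_orthogonal b J (v : nat -> V) : orthonormal_family b J ->
  (forall k, D (b k) (v k)) -> (forall k, A (v k) ((sq (v k))%:C *: b k)) ->
  forall f g, D f g -> forall k, ip g (v k) = (sq (v k))%:C * ip f (b k).
Proof.
by move=> ob Db Ab f g Dfg k; rewrite (adjointP adjA Dfg (Ab k)) ipZr conjcC.
Qed.

(** Totality: the remainder of a Fourier sum of [g] in the domain of [D] is admissible for the next
    minimization, so its square is at most [sq u] divided by the next eigenvalue. As eigenvalues are
    unbounded, a vector orthogonal to all [b n] is orthogonal to the domain, hence null by
    [injA]. *)
Theorem eigenbasis_exists : exists b J (v : nat -> V), eigenbasis b J v.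
Proof.
have [p hp] := greedy_minimizers.
pose b n := (p n).1; pose v n := (p n).2; pose J n := sq (b n) != 0.
have Db n : D (b n) (v n).
  have [[[]] //|[e _]] := hp n; by rewrite /b /v e; exact: adjoint0 adjD.
have orth k n : (k < n)%N -> ip (b n) (b k) = 0.
  move=> kn; have [[[_ h] _ _]|[e _]] := hp n; first by apply: h; exists k.
  by rewrite /b e ip0l.
have sqb n : sq (b n) = (J n)%:R.
  rewrite /J; have [[_ e _]|[e _]] := hp n; rewrite /b e /= ?oner_eq0 //.
  by rewrite sq0 eqxx.
have ob : orthonormal_family b J.
  move=> m n; have [<-|] := eqVneq m n; first by rewrite ipsq sqb /=; case: (J m).
  rewrite neq_ltn => /orP[mn|nm] /=; last exact: orth.
  by rewrite ip_conj orth // rmorph0.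
have Ab n : A (v n) ((sq (v n))%:C *: b n).
  elim/ltn_ind: n => n IH; have [h|[e _]] := hp n.
    exact: (minimizer_eigen (l := fun k => sq (v k)) ob Db IH h).
  by rewrite /b /v e /= sq0 scaler0; exact: adjoint0 adjA.
have hmin n g u : D g u -> (forall k, (k < n)%N -> ip g (b k) = 0) ->
    J n /\ sq (v n) * sq g <= sq u \/ sq g = 0.
  move=> Dgu hg.
  have ag : admissible [set g | exists2 k, (k < n)%N & g = (p k).1] g u.
    by split => // _ [k kn ->]; exact: hg.
  have [h|[_ h]] := hp n.
    by left; have [_ e hm] := h; split; [rewrite /J /b e oner_eq0 | exact: hm ag].
  right; apply: contra_notP h => h; apply: minimizer_exists => //.
  by exists g, u.
have orthv := eigen_orthogonal ob Db Ab.
(* If the choices run out, an index outside [J] satisfies the implication, and [hmin] then says that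
   the remainder is null. Otherwise, were all eigenvalues below [r], the first [N] of them would
   contribute at least N / (1 + r) to the trace, which exceeds [C] for large [N]. *)
have large r : 0 < r -> exists n, J n -> r <= sq (v n).
  move=> r0; apply: contrapT => h.
  have hJ n : J n /\ sq (v n) < r.
    split; first by apply: contrapT => hJ; apply: h; exists n => /hJ.
    by rewrite ltNge; apply/negP => hr; apply: h; exists n.
  pose N := (Num.truncn (C * (1 + r))).+1.
  have o1 i j : i != j -> ip (b i) (b j) = 0 by move=> /negPf ij; rewrite ob ij.
  have o2 i j : i != j -> ip (v i) (v j) = 0.
    by move=> /negPf ij; rewrite (orthv _ _ (Db i)) ob ij mulr0.
  have o3 k : sq (b k) <= 1 by rewrite sqb; case: (J k).
  have h1 : N%:R * (1 + r)^-1 <= \sum_(0 <= k < N) sq (b k) / (1 + sq (v k)).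
    rewrite mulr_natl -[X in _ *+ X]subn0 -sumr_const_nat; apply: ler_sum => k _.
    rewrite sqb (hJ k).1 mul1r lef_pV2 ?posrE; last 2 first.
    - by have := sq_ge0 ip (v k); lra.
    - by have := sq_ge0 ip (v k); lra.
    by rewrite lerD2l ltW // (hJ k).2.
  have := le_trans h1 (traceD N Db o1 o2 o3).
  rewrite ler_pdivrMr; last lra.
  by rewrite leNgt truncnS_gt.
have dense g u : D g u -> forall e, 0 < e -> exists n, sq (g - fourier_sum b n g) < e.
  move=> Dgu e e0.
  have ue : 0 <= sq u / e by rewrite divr_ge0 ?sq_ge0 ?ltW.
  have [n hn] := large (sq u / e + 1) ltac:(lra).
  exists n; pose u' := u - \sum_(0 <= k < n) ip g (b k) *: v k.
  have D' : D (g - fourier_sum b n g) u'.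
    by apply: (adjointB adjD) => //; exact: (adjoint_comb adjD).
  have [k kn|[Jn h]|->//] := hmin n _ _ D'; first exact: ip_proj ob _ _ _ kn.
  have hu : sq u' <= sq u.
    have o : ip u' (\sum_(0 <= k < n) ip g (b k) *: v k) = 0.
      rewrite ip_sumr big_nat big1 // => k /andP[_ kn].
      by rewrite ipZr (orthv _ _ D') (ip_proj ob) // !mulr0.
    have -> : u = u' + \sum_(0 <= k < n) ip g (b k) *: v k by rewrite subrK.
    by rewrite sqD o /= mulr0 addr0 lerDl sq_ge0.
  have h3 := ler_wpM2r (sq_ge0 ip (g - fourier_sum b n g)) (hn Jn).
  have h4 : (sq u / e + 1) * sq (g - fourier_sum b n g) <= sq u by lra.
  have u0 := sq_ge0 ip u; have q0 := sq_ge0 ip (g - fourier_sum b n g).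
  rewrite ltNge; apply/negP => he.
  have : (sq u / e + 1) * e <= (sq u / e + 1) * sq (g - fourier_sum b n g).
    by rewrite ler_wpM2l // addr_ge0.
  rewrite mulrDl divfK ?gt_eqF //; lra.
exists b, J, v; split => //.
apply: (total_spanning ob complete) => f hf.
apply: injA; apply/adjA => g u Dgu; rewrite ip0r; apply/esym/normsq_eq0/eqP.
rewrite eq_le normsq_ge0 andbT; apply: le_eps => e e0; rewrite add0r.
have s0 : 0 < sq f + 1 by rewrite ltr_wpDl ?sq_ge0.
have [n hn] := dense _ _ Dgu _ (divr_gt0 e0 s0).
have -> : ip g f = ip (g - fourier_sum b n g) f.
  rewrite ipBl ip_suml big1 ?subr0 // => k _.
  by rewrite ipZl (ip_conj ip (b k)) hf rmorph0 mulr0.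
apply: le_lt_trans (cauchy_schwarz _ _ _) _.
rewrite ltr_pdivlMr // in hn; apply: le_lt_trans hn.
by rewrite ler_wpM2l ?sq_ge0 // lerDl.
Qed.

End Spectral.

Section NullSums.
Context {R : realType} {V : lmodType R[i]} (ip : semiInner V).

Lemma null_sum (I : eqType) (s : seq I) (F : I -> V) :
  (forall i, i \in s -> sq ip (F i) = 0) -> sq ip (\sum_(i <- s) F i) = 0.
Proof.
move=> h; elim: s h => [|i s IH] h; first by rewrite big_nil sq0.
rewrite big_cons; apply: sq_eq_le0; apply: le_trans (sqD_le _ _ _) _.
rewrite h ?mem_head // IH; first lra.
by move=> j js; apply: h; rewrite in_cons js orbT.
Qed.

Lemma orthonormal_sq b J n : orthonormal_family ip b J -> sq ip (b n) = (J n)%:R.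
Proof. by move=> ob; rewrite /sq ob eqxx /=; case: (J n). Qed.

End NullSums.

(** * The domain of the composition A D in Fourier coefficients *)

Section EigenDomain.
Context {R : realType} {V : lmodType R[i]} (ip : semiInner V).
Context {D A : V -> V -> Prop}.
Hypotheses (adjA : adjoint_of ip D A) (adjD : adjoint_of ip A D).
Hypothesis complete : seminorm_complete ip.
Local Notation sq := (sq ip).

Record eigensystem (b : nat -> V) (J : pred nat) (v : nat -> V) (l : nat -> R) := {
  es_orthonormal : orthonormal_family ip b J;
  es_D : forall k, D (b k) (v k);
  es_A : forall k, A (v k) ((l k)%:C *: b k);
  es_ge0 : forall k, 0 <= l k;
  es_spanning : spanning ip b
}.

(** In the converse the image of [f] is built by Riesz-Fischer on the normalized [v k], with
    coefficients sqrt(l_k) (f, b_k). They are square-summable because l <= 1 + l^2 bounds their sum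
    by [sq f + sq g]. Closedness of [D] and then of [A] carries the relations from the partial sums
    to the limits. *)
Theorem eigen_domain b J v l : eigensystem b J v l -> forall f g,
  (exists x, D f x /\ A x g) <-> forall k, ip g (b k) = (l k)%:C * ip f (b k).
Proof.
case=> ob Db Av l0 hb f g.
have ipv i j : ip (v i) (v j) = (l j)%:C * ip (b i) (b j).
  by rewrite (adjointP adjA (Db i) (Av j)) ipZr conjcC.
split.
  move=> [x [Dx Ax]] k; rewrite -[RHS]conjcK conjcM conjcC -ip_conj.
  rewrite ip_conj -(adjointP adjA (Db k) Ax) ip_conj conjcK.
  by rewrite (adjointP adjA Dx (Av k)) ipZr conjcC conjcM conjcC -ip_conj.
move=> hk.
pose r k := Num.sqrt (l k).
have r2 k : r k * r k = l k by rewrite -expr2 sqr_sqrtr.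
have rinv k : l k != 0 -> r k != 0.
  by move=> lk; rewrite sqrtr_eq0 -ltNge lt_neqAle eq_sym lk l0.
pose e k := (r k)^-1%:C *: v k.
pose JJ k := J k && (l k != 0).
have oe : orthonormal_family ip e JJ.
  move=> i j; rewrite ipZl ipZr ipv ob conjcC /JJ.
  have [<-|] := eqVneq i j; last by rewrite !mulr0.
  case: (J i); last by rewrite !mulr0.
  have [li|li] := eqVneq (l i) 0; first by rewrite li mul0r !mulr0.
  rewrite /= mulr1 -!rmorphM /= -r2; congr (_%:C).
  by field; exact: rinv.
pose c k := (r k)%:C * ip f (b k).
have [||x [hx _]] := riesz_fischer oe (c := c) (B := sq f + sq g) complete.
- move=> k; rewrite negb_and negbK => /orP[/(coef_notJ ob f)|/eqP lk].
    by rewrite /c => ->; rewrite mulr0.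
  by rewrite /c /r lk sqrtr0 mul0r.
- move=> N; apply: le_trans (lerD (bessel ob f N) (bessel ob g N)).
  rewrite -big_split; apply: ler_sum => k _ /=.
  rewrite hk !normsqM !normsqC expr2 r2.
  have := normsq_ge0 (ip f (b k)); have := l0 k; set a := normsq _.
  move=> l0k a0; have := mulr_ge0 a0 (sqr_ge0 (l k - 1)).
  by have := mulr_ge0 l0k a0; nra.
have Dfx : D f x.
  apply: (adjoint_closed adjD _ (hb f) hx) => N.
  apply: (adjoint_null adjD (u := fourier_sum ip b N f)
    (w := \sum_(0 <= k < N) ip f (b k) *: v k)).
  - by rewrite subrr sq0.
  - rewrite -sumrB; apply: null_sum => k _; rewrite /c /e scalerA -scalerBl sqZ.
    have [lk|lk] := eqVneq (l k) 0.
      by rewrite /sq ipv lk mul0r mulr0.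
    rewrite mulrAC -rmorphM /= divff ?rinv // mul1r subrr normsq0 mul0r //.
  - exact: (adjoint_comb adjD).
exists x; split => //.
pose t N := \sum_(0 <= k < N) ip f (b k) *: v k.
have ht : cvgto ip t x.
  move=> d d0; have [N hN] := hx (d / 2) ltac:(lra).
  exists N => n /hN; have -> : t n - x = (t n - \sum_(0 <= k < n) c k *: e k) +
    (\sum_(0 <= k < n) c k *: e k - x) by rewrite addrA subrK.
  move=> h; apply: le_lt_trans (sqD_le _ _ _) _.
  rewrite -sumrB null_sum; first lra.
  move=> k _; rewrite /c /e scalerA -scalerBl sqZ.
  have [lk|lk] := eqVneq (l k) 0.
    by rewrite /sq ipv lk mul0r mulr0.
  rewrite mulrAC -rmorphM /= divff ?rinv // mul1r subrr normsq0 mul0r //.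
apply: (adjoint_closed adjA (t := fun N => fourier_sum ip b N g) _ ht (hb g)) => N.
have -> : fourier_sum ip b N g = \sum_(0 <= k < N) ip f (b k) *: ((l k)%:C *: b k).
  by apply: eq_bigr => k _; rewrite hk scalerA mulrC.
exact: (adjoint_comb adjA).
Qed.

End EigenDomain.

(** * Separating the kernels from the positive spectrum *)

Section KernelBases.
Context {R : realType} {V : lmodType R[i]} (ip : semiInner V).
Local Notation sq := (sq ip).

Record kernel_basis (D : V -> V -> Prop) (m : nat) (x : nat -> V) := {
  kb_ker : forall i, (i < m)%N -> D (x i) 0;
  kb_orth : forall i j, (i < m)%N -> (j < m)%N -> ip (x i) (x j) = (i == j)%:R;
  kb_total : forall f, D f 0 -> (forall i, (i < m)%N -> ip f (x i) = 0) -> sq f = 0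
}.

Lemma orthonormal_coef m (x : nat -> V) (c : nat -> R[i]) :
  (forall i j, (i < m)%N -> (j < m)%N -> ip (x i) (x j) = (i == j)%:R) ->
  forall i, (i < m)%N -> ip (\sum_(0 <= j < m) c j *: x j) (x i) = c i.
Proof.
move=> ox i im; rewrite ip_suml (bigD1_seq i) ?mem_index_iota ?iota_uniq //=.
rewrite ipZl ox // eqxx mulr1 big_nat_cond big1 ?addr0 //.
by move=> j /andP[/andP[_ jm] /negPf ji]; rewrite ipZl ox // ji mulr0.
Qed.

Lemma orthonormal_remainder m (x : nat -> V) g :
  (forall i j, (i < m)%N -> (j < m)%N -> ip (x i) (x j) = (i == j)%:R) ->
  forall i, (i < m)%N -> ip (g - \sum_(0 <= j < m) ip g (x j) *: x j) (x i) = 0.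
Proof. by move=> ox i im; rewrite ipBl orthonormal_coef ?subrr. Qed.

Lemma kernel_basis_expand (D A : V -> V -> Prop) m x g : adjoint_of ip A D ->
  kernel_basis D m x -> D g 0 -> sq (g - \sum_(0 <= i < m) ip g (x i) *: x i) = 0.
Proof.
move=> adjD [kx ox tx] Dg; apply: tx; last exact: orthonormal_remainder.
suff Dx : D (\sum_(0 <= i < m) ip g (x i) *: x i) 0.
  by have := adjointB adjD Dg Dx; rewrite subrr.
rewrite big_nat; elim/big_rec: _ => [|i y /andP[_ im] hy]; first exact: adjoint0 adjD.
by have := adjoint_lin adjD (ip g (x i)) (kx i im) hy; rewrite scaler0 addr0.
Qed.

Lemma kernel_basis_orth (D A : V -> V -> Prop) m x f g : adjoint_of ip A D ->
  kernel_basis D m x -> (forall i, (i < m)%N -> ip f (x i) = 0) -> D g 0 ->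
  ip f g = 0.
Proof.
move=> adjD kx fx Dg; rewrite (ip_eqr _ (kernel_basis_expand adjD kx Dg)).
by rewrite ip_sumr big_nat big1 // => i /andP[_ im]; rewrite ipZr fx // mulr0.
Qed.

Definition catfam T (m : nat) (x y : nat -> T) n := if (n < m)%N then x n else y (n - m)%N.

Lemma catfam_orthonormal m (x b : nat -> V) J :
  (forall i j, (i < m)%N -> (j < m)%N -> ip (x i) (x j) = (i == j)%:R) ->
  orthonormal_family ip b J -> (forall i k, (i < m)%N -> ip (x i) (b k) = 0) ->
  orthonormal_family ip (catfam m x b) (catfam m xpredT J).
Proof.
move=> ox ob oxb i j; rewrite /catfam.
case: ifP => im; case: ifP => jm.
- by rewrite ox // andbT.
- by rewrite oxb //; case: eqP => // e; rewrite -e im in jm.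
- by rewrite ip_conj oxb // rmorph0; case: eqP => // e; rewrite e jm in im.
rewrite ob; congr (_ && _)%:R; apply/eqP/eqP => [|-> //].
by move: im jm; rewrite !ltnNge => /negbFE im /negbFE jm; rewrite -{2}(subnK im) -{2}(subnK jm) => ->.
Qed.

Context {D A : V -> V -> Prop}.
Hypotheses (adjA : adjoint_of ip D A) (adjD : adjoint_of ip A D).
Hypothesis complete : seminorm_complete ip.
Hypothesis injD : forall w, D 0 w -> sq w = 0.
Hypothesis rangeD : forall w, (forall f, A f 0 -> ip w f = 0) -> exists u, D u w.
Context {b : nat -> V} {J : pred nat} {v : nat -> V}.
Hypothesis eb : eigenbasis ip (D := D) (A := A) b J v.

Definition positive_part k := J k && (sq (v k) != 0).

(** The eigenvectors for the eigenvalue 0 found by minimization are multiplied by 0 and so drop out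
    of the index set; a kernel basis of known size is put in front instead. The rest is indexed by
    [positive_part], exactly as in [eigensystem_ran], so the two heat traces share this part term by
    term. *)
Lemma eigensystem_ker m x : kernel_basis D m x ->
  eigensystem ip (D := D) (A := A)
    (catfam m x (fun k => (sq (v k) != 0)%:R *: b k)) (catfam m xpredT positive_part)
    (catfam m (fun=> 0) (fun k => (sq (v k) != 0)%:R *: v k))
    (catfam m (fun=> 0) (fun k => sq (v k))).
Proof.
move=> kx; have [ob Db Av hb] := eb; have [kerx ox tx] := kx.
have obv := eigen_orthogonal adjA ob Db Av.
have oc : orthonormal_family ip
    (catfam m x (fun k => (sq (v k) != 0)%:R *: b k)) (catfam m xpredT positive_part).
  apply: catfam_orthonormal => //.
    move=> i j; rewrite ipZl ipZr ob /positive_part conjc_nat.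
    have [<-|] := eqVneq i j; last by rewrite !mulr0.
    by case: (sq (v i) != 0); case: (J i) => /=; ring.
  move=> i k im; rewrite ipZr.
  have [e|e] := eqVneq (sq (v k)) 0; first by rewrite conjc0 mul0r.
  have := obv _ _ (kerx i im) k; rewrite ip0l => /esym/eqP; rewrite mulf_eq0.
  by rewrite eq_complex /= eqxx andbT (negPf e) => /eqP ->; rewrite mulr0.
split => //.
- move=> n; rewrite /catfam; case: ifP => [/kerx //|_].
  exact: (adjointZ adjD).
- move=> n; rewrite /catfam; case: ifP => _; first by rewrite scale0r; exact: adjoint0 adjA.
  by rewrite scalerA mulrC -scalerA; exact: (adjointZ adjA).
- by move=> n; rewrite /catfam; case: ifP => // _; exact: sq_ge0.
apply: (total_spanning oc complete) => f hf; apply: (spanning_null ob) => // k.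
have fx i : (i < m)%N -> ip f (x i) = 0 by move=> im; have := hf i; rewrite /catfam im.
have [e|e] := eqVneq (sq (v k)) 0.
  apply: (kernel_basis_orth adjD kx fx); apply: (adjoint_null adjD) (Db k).
    by rewrite subrr sq0.
  by rewrite subr0.
have := hf (m + k)%N; rewrite /catfam ltnNge leq_addr /= addKn e ipZr conjc1 mul1r.
by [].
Qed.

(** Totality uses [rangeD]: a vector orthogonal to the kernel of [A] is some [D u]. If it is also
    orthogonal to the [v k] of positive eigenvalue, then [u] has coefficients only for the
    eigenvalue 0, so [eigen_domain] gives A D u = 0, and [D u] is null. As the inverse of 0 is 0,
    the normalization sends null [v k] to 0. *)
Lemma eigensystem_ran m x : kernel_basis A m x ->
  eigensystem ip (D := A) (A := D)
    (catfam m x (fun k => (Num.sqrt (sq (v k)))^-1%:C *: v k))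
    (catfam m xpredT positive_part)
    (catfam m (fun=> 0) (fun k => (Num.sqrt (sq (v k)))%:C *: b k))
    (catfam m (fun=> 0) (fun k => sq (v k))).
Proof.
move=> kx; have [ob Db Av hb] := eb; have [kerx ox tx] := kx.
have obv := eigen_orthogonal adjA ob Db Av.
have sv0 k := sq_ge0 ip (v k).
have sv k : sq (v k) != 0 -> Num.sqrt (sq (v k)) != 0.
  by move=> e; rewrite sqrtr_eq0 -ltNge lt_neqAle eq_sym e sv0.
have oc : orthonormal_family ip
    (catfam m x (fun k => (Num.sqrt (sq (v k)))^-1%:C *: v k)) (catfam m xpredT positive_part).
  apply: catfam_orthonormal => //.
    move=> i j; rewrite ipZl ipZr (obv _ _ (Db i)) ob conjcC /positive_part.
    have [<-|] := eqVneq i j; last by rewrite !mulr0.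
    case: (J i) => /=; last by rewrite !mulr0.
    have [e|e] := eqVneq (sq (v i)) 0; first by rewrite e mul0r !mulr0.
    rewrite mulr1 -!rmorphM /= -{3}(sqr_sqrtr (sv0 i)); congr (_%:C).
    by field; exact: sv.
  move=> i k im; rewrite ipZr (ip_conj ip (x i)) (adjointP adjA (Db k) (kerx i im)).
  by rewrite ip0r rmorph0 mulr0.
split => //.
- move=> n; rewrite /catfam; case: ifP => [/kerx //|_].
  have := adjointZ adjA (Num.sqrt (sq (v (n - m))))^-1%:C (Av (n - m)%N).
  rewrite scalerA -rmorphM /=; congr (A _ (_%:C *: _)).
  have [->|e] := eqVneq (sq (v (n - m)%N)) 0; first by rewrite sqrtr0 mulr0.
  by rewrite -{2}(sqr_sqrtr (sv0 (n - m)%N)) expr2 mulKf // sv.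
- move=> n; rewrite /catfam; case: ifP => _; first by rewrite scale0r; exact: adjoint0 adjD.
  have := adjointZ adjD (Num.sqrt (sq (v (n - m))))%:C (Db (n - m)%N).
  rewrite scalerA -rmorphM /=; congr (D _ (_%:C *: _)).
  have [->|e] := eqVneq (sq (v (n - m)%N)) 0; first by rewrite sqrtr0 mul0r.
  by rewrite -{2}(sqr_sqrtr (sv0 (n - m)%N)) expr2 mulfK // sv.
- by move=> n; rewrite /catfam; case: ifP => // _; exact: sv0.
apply: (total_spanning oc complete) => f hf.
have fx i : (i < m)%N -> ip f (x i) = 0 by move=> im; have := hf i; rewrite /catfam im.
have [u Du] := rangeD (fun g Ag => kernel_basis_orth adjA kx fx Ag).
have [|y [Dy Ay]] := (eigen_domain adjA adjD complete (l := fun k => sq (v k))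
    (Build_eigensystem ob Db Av sv0 hb) u 0).2.
  move=> k; rewrite ip0l -(obv _ _ Du).
  have [e|e] := eqVneq (sq (v k)) 0; first by rewrite ip_null_r.
  have := hf (m + k)%N; rewrite /catfam ltnNge leq_addr /= addKn ipZr conjcC.
  move/eqP; rewrite mulf_eq0 eq_complex /= eqxx andbT invr_eq0 (negPf (sv k e)).
  by move/eqP.
have y0 : sq y = 0 by rewrite /sq (adjointP adjA Dy Ay) ip0r.
have fy : sq (f - y) = 0.
  by apply: injD; have := adjointB adjD Du Dy; rewrite subrr.
by have := sq_trans fy (_ : sq (y - 0) = 0); rewrite !subr0 => ->.
Qed.

End KernelBases.

(** * Heat semigroups of diagonal operators *)

Section ExpBounds.
Context {R : realType}.
Implicit Types x y h l : R.

Lemma expRN_le1 x : 0 <= x -> expR (- x) <= 1.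
Proof. by move=> x0; rewrite -expR0 ler_expR; lra. Qed.

Lemma expRN_ge x : 1 - x <= expR (- x).
Proof. by have := expR_ge1Dx (- x). Qed.

Lemma expRN_le_quad x : 0 <= x -> expR (- x) <= 1 - x + x ^+ 2.
Proof.
move=> x0; rewrite expRN.
have h := expR_ge1Dx x; have x1 : 0 < 1 + x by lra.
have p : 0 < expR x by lra.
rewrite -(ler_pM2r p) mulVf ?gt_eqF //.
apply: (@le_trans _ _ ((1 - x + x ^+ 2) * (1 + x))).
  have -> : (1 - x + x ^+ 2) * (1 + x) = 1 + x ^+ 3 by ring.
  by rewrite lerDl exprn_ge0.
apply: ler_wpM2l h.
have := sqr_ge0 (x - 1); lra.
Qed.

Lemma sqr_le_bound x y : - y <= x -> x <= y -> x ^+ 2 <= y ^+ 2.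
Proof.
move=> h1 h2; have h : 0 <= (y - x) * (y + x) by apply: mulr_ge0; lra.
lra.
Qed.

(** The bound by 1 is uniform in [l] and controls the tail of a Fourier series; the other one is
    small for [s] near [t] and controls finitely many terms. The pair in [expR_quotient_bounds] has
    the same purpose. *)
Lemma expR_diff_bounds l s t : 0 <= l -> 0 <= s -> 0 <= t ->
  (expR (- (s * l)) - expR (- (t * l))) ^+ 2 <= 1 /\
  (expR (- (s * l)) - expR (- (t * l))) ^+ 2 <= (s - t) ^+ 2 * l ^+ 2.
Proof.
move=> l0; wlog st : s t / s <= t.
  move=> H s0 t0; have [st|/ltW ts] := leP s t; first exact: H.
  have E (a b : R) : (a - b) ^+ 2 = (b - a) ^+ 2 by ring.
  by rewrite (E (expR (- (s * l)))) (E s); exact: H.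
move=> s0 t0.
have e1 := expRN_le1 (mulr_ge0 s0 l0); have e2 := expRN_le1 (mulr_ge0 t0 l0).
have p1 := expR_gt0 (- (s * l)); have p2 := expR_gt0 (- (t * l)).
have le0 : expR (- (t * l)) <= expR (- (s * l)).
  by rewrite ler_expR lerN2 ler_wpM2r.
split; first by rewrite -[leRHS](expr1n R 2); apply: sqr_le_bound; lra.
rewrite -exprMn -[X in _ <= X]sqrrN; apply: sqr_le_bound; last first.
  have -> : expR (- (t * l)) = expR (- (s * l)) * expR (- ((t - s) * l)).
    by rewrite -expRD; congr expR; ring.
  have := expRN_ge ((t - s) * l).
  have tl : 0 <= (t - s) * l by rewrite mulr_ge0 // subr_ge0.
  by nra.
have tl : 0 <= (t - s) * l by rewrite mulr_ge0 // subr_ge0.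
by lra.
Qed.

Lemma expR_quotient_bounds l h : 0 <= l -> 0 < h ->
  (h^-1 * (1 - expR (- (h * l))) - l) ^+ 2 <= l ^+ 2 /\
  (h^-1 * (1 - expR (- (h * l))) - l) ^+ 2 <= h ^+ 2 * l ^+ 4.
Proof.
move=> l0 h0; have hl : 0 <= h * l by rewrite mulr_ge0 // ltW.
have e1 := expRN_le1 hl; have e2 := expRN_ge (h * l); have e3 := expRN_le_quad hl.
have hi : 0 < h^-1 by rewrite invr_gt0.
set q := h^-1 * _.
have q0 : 0 <= q by apply: mulr_ge0; [exact: ltW | lra].
have qh : h * q = 1 - expR (- (h * l)) by rewrite /q mulVKf // gt_eqF.
have q1 : q <= l by rewrite -(ler_pM2l h0) qh; lra.
have q2 : l - h * l ^+ 2 <= q by rewrite -(ler_pM2l h0) qh; lra.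
split; first by apply: sqr_le_bound; lra.
rewrite (_ : h ^+ 2 * l ^+ 4 = (h * l ^+ 2) ^+ 2); last by ring.
by apply: sqr_le_bound; [lra | have := mulr_ge0 (ltW h0) (sqr_ge0 l); lra].
Qed.

(** For fixed [e > 0], let [m] be the supremum of the [s <= t] with phi r <= e r on [0, s].
    Continuity gives the bound at [m] itself, and the Dini condition prolongs it beyond [m] if
    [m < t]; finally [e] tends to 0. *)
Lemma dini_le0 (phi : R -> R) : phi 0 <= 0 ->
  (forall t e, 0 <= t -> 0 < e -> exists d, 0 < d /\
     forall s, 0 <= s -> `|s - t| < d -> `|phi s - phi t| < e) ->
  (forall t e, 0 <= t -> 0 < e -> exists d, 0 < d /\
     forall h, 0 < h -> h < d -> phi (t + h) <= phi t + e * h) ->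
  forall t, 0 <= t -> phi t <= 0.
Proof.
move=> phi0 cont dini t t0.
suff key e : 0 < e -> phi t <= e * t.
  apply/ler_addgt0Pr => e e0; rewrite add0r.
  have t1 : 0 < t + 1 by lra.
  apply: le_trans (key _ (divr_gt0 e0 t1)) _.
  by rewrite mulrAC ler_pdivrMr // ler_pM2l //; lra.
move=> e0.
pose S := [set s | [/\ 0 <= s, s <= t & forall r, 0 <= r -> r <= s -> phi r <= e * r]].
have S0 : S 0.
  split => // r r0 r0'; have -> : r = 0 by apply/eqP; rewrite eq_le r0 r0'.
  by rewrite mulr0.
have hS : has_sup S by split; [exists 0 | exists t => s []].
set m := sup S.
have m0 : 0 <= m by apply: ub_le_sup => //; exact: hS.2.
have mt : m <= t by apply: ge_sup; [exists 0 | move=> s []].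
have below r : 0 <= r -> r < m -> phi r <= e * r.
  move=> r0 rm; have mr : 0 < m - r by rewrite subr_gt0.
  have [s [s0 st hs] hsr] := sup_adherent mr hS.
  by apply: hs => //; rewrite -/m in hsr; lra.
have at_m : phi m <= e * m.
  have [m00|mpos] := leP m 0.
    have -> : m = 0 by apply/eqP; rewrite eq_le m00 m0.
    by rewrite mulr0.
  apply/ler_addgt0Pr => d d0.
  have [x [x0 hx]] := cont m d m0 d0.
  pose r := m - Num.min (x / 2) m.
  have h1 : 0 < Num.min (x / 2) m by rewrite lt_min mpos andbT; lra.
  have h2 : Num.min (x / 2) m <= m by rewrite ge_min lexx orbT.
  have h3 : Num.min (x / 2) m <= x / 2 by rewrite ge_min lexx.
  have r0 : 0 <= r by rewrite /r; lra.
  have rm : `|r - m| < x.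
    by rewrite /r addrAC subrr add0r normrN ger0_norm ?ltW //; lra.
  have := hx r r0 rm; rewrite ltr_norml => /andP[h4 _].
  have h5 : phi r <= e * r by apply: below => //; rewrite /r; lra.
  have h6 : e * r <= e * m by rewrite ler_pM2l // /r; lra.
  by lra.
have [mt'|tm] := ltP m t; last first.
  have -> : t = m by apply/eqP; rewrite eq_le tm mt.
  exact: at_m.
have [d [d0 hd]] := dini m e m0 e0.
pose x := Num.min (d / 2) (t - m).
have x0 : 0 < x by rewrite /x lt_min subr_gt0 mt' andbT; lra.
have xd : x <= d / 2 by rewrite /x ge_min lexx.
have xt : x <= t - m by rewrite /x ge_min lexx orbT.
have : S (m + x).
  split; [lra|lra|] => r r0 rm.
  have [rm'|mr] := ltP r m; first exact: below.
  have [->|rm2] := eqVneq r m; first exact: at_m.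
  have mr' : m < r by rewrite lt_neqAle eq_sym rm2 mr.
  have := hd (r - m) ltac:(lra) ltac:(lra); rewrite addrC subrK; lra.
by move=> /(ub_le_sup hS.2); rewrite -/m; lra.
Qed.

End ExpBounds.

Section Semigroups.
Context {R : realType} {V : lmodType R[i]} (ip : semiInner V).
Local Notation sq := (sq ip).

(** The abstract counterpart of [heat_semigroup]: almost everywhere equality becomes a null
    difference, and norms are squared, so [M] bounds the square of the operator norm. *)
Record semigroup_of (H : V -> V -> Prop) (T : R -> V -> V) := {
  sg_lin : forall t c f g, 0 <= t -> sq (T t (c *: f + g) - (c *: T t f + T t g)) = 0;
  sg_bounded : forall t, 0 <= t -> exists M, forall f, sq (T t f) <= M * sq f;
  sg_0 : forall f, sq (T 0 f - f) = 0;
  sg_D : forall s t f, 0 <= s -> 0 <= t -> sq (T (s + t) f - T s (T t f)) = 0;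
  sg_cont : forall t f e, 0 <= t -> 0 < e -> exists d, 0 < d /\
    forall s, 0 <= s -> `|s - t| < d -> sq (T s f - T t f) < e;
  sg_gen : forall f g, H f g <-> forall e, 0 < e -> exists d, 0 < d /\
    forall t, 0 < t -> t < d -> sq (t^-1%:C *: (f - T t f) - g) < e
}.

Section Existence.
Context {H : V -> V -> Prop} {b : nat -> V} {J : pred nat} {l : nat -> R}.
Hypothesis complete : seminorm_complete ip.
Hypotheses (ob : orthonormal_family ip b J) (hb : spanning ip b).
Hypothesis l0 : forall k, 0 <= l k.
Hypothesis domH : forall f g, H f g <-> forall k, ip g (b k) = (l k)%:C * ip f (b k).

(** Dominated convergence for Fourier series: beyond some [N] the coefficients of [r h] are
    dominated by the tail of [g], uniformly in [h], and the first [N] of them tend to 0 with [h]. *)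
Lemma dominated_coefficients (P : R -> Prop) (r : R -> V) (g : V) (K : nat -> R) :
  (forall k, 0 <= K k) ->
  (forall h k, P h -> normsq (ip (r h) (b k)) <= normsq (ip g (b k))) ->
  (forall h k, P h -> normsq (ip (r h) (b k)) <= h ^+ 2 * K k) ->
  forall e, 0 < e -> exists d, 0 < d /\ forall h, P h -> `|h| < d -> sq (r h) < e.
Proof.
move=> K0 hg hK e e0; have e4 : 0 < e / 4 by lra.
have [N hN] := parseval ob (hb g) e4.
pose S := \sum_(0 <= k < N) K k.
have S0 : 0 <= S by apply: sumr_ge0.
exists (Num.min 1 (e / 4 / (S + 1))); split.
  by rewrite lt_min ltr01 divr_gt0 //; lra.
move=> h Ph; rewrite lt_min => /andP[h1 h2].
have S1 : 0 < S + 1 by lra.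
rewrite ltr_pdivlMr // in h2.
have hS : h ^+ 2 * S < e / 4.
  have n0 := normr_ge0 h; rewrite -real_normK ?num_real //.
  apply: le_lt_trans h2; rewrite expr2 -mulrA; apply: ler_wpM2l => //.
  by apply: (@le_trans _ _ (1 * S)); [apply: ler_wpM2r => //; exact: ltW | lra].
have [M hM] := parseval ob (hb (r h)) e4.
have := hM (maxn N M) (leq_maxr _ _).
have := bessel ob g (maxn N M).
have := hN N (leqnn _).
have cat (a : nat -> R) : \sum_(0 <= k < maxn N M) a k =
    \sum_(0 <= k < N) a k + \sum_(N <= k < maxn N M) a k.
  by rewrite (big_cat_nat (n := N) _ (leq_maxl N M)).
rewrite (cat (fun k => normsq (ip g (b k)))) (cat (fun k => normsq (ip (r h) (b k)))).
have t1 : \sum_(N <= i < maxn N M) normsq (ip (r h) (b i)) <=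
          \sum_(N <= i < maxn N M) normsq (ip g (b i)).
  by apply: ler_sum => k _; exact: hg.
have t2 : \sum_(0 <= i < N) normsq (ip (r h) (b i)) <= h ^+ 2 * S.
  by rewrite mulr_sumr; apply: ler_sum => k _; exact: hK.
lra.
Qed.

Let G_spec (t : R) (f : V) (g : V) :=
  forall k, ip g (b k) = (expR (- (t * l k)))%:C * ip f (b k).

Let G_exists t f : 0 <= t -> exists g, G_spec t f g.
Proof.
move=> t0.
have [||g [_ hg]] := riesz_fischer ob
  (c := fun k => (expR (- (t * l k)))%:C * ip f (b k)) (B := sq f) complete.
- by move=> k /(coef_notJ ob f) ->; rewrite mulr0.
- move=> N; apply: le_trans (bessel ob f N); apply: ler_sum => k _.
  rewrite normsqM normsqC -[leRHS]mul1r; apply: ler_wpM2r; first exact: normsq_ge0.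
  by rewrite expr_le1 ?expR_ge0 // expRN_le1 // mulr_ge0.
by exists g.
Qed.

(** [T t f] is any vector with coefficients exp(-t l_k) (f, b_k). It is determined only up to null
    vectors, which is all that the algebraic laws need; they are checked coefficientwise. *)
Theorem semigroup_exists : exists T, semigroup_of H T.
Proof.
pose T t f := xget 0 [set g | G_spec t f g].
have hT t f k : 0 <= t -> ip (T t f) (b k) = (expR (- (t * l k)))%:C * ip f (b k).
  by move=> t0; have [g hg] := G_exists f t0; exact: (xgetPex 0 (ex_intro _ g hg)).
exists T; split.
- move=> t c f g t0; apply: (spanning_eq ob hb) => k.
  by rewrite hT // !ip_lin !hT //; ring.
- move=> t t0; exists 1 => f; rewrite mul1r; apply: le_eps => e e0.
  have [N hN] := parseval ob (hb (T t f)) e0; have := hN N (leqnn _).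
  have := bessel ob f N.
  have : \sum_(0 <= k < N) normsq (ip (T t f) (b k)) <=
         \sum_(0 <= k < N) normsq (ip f (b k)).
    apply: ler_sum => k _; rewrite hT // normsqM normsqC -[leRHS]mul1r.
    apply: ler_wpM2r; first exact: normsq_ge0.
    by rewrite expr_le1 ?expR_ge0 // expRN_le1 // mulr_ge0.
  lra.
- move=> f; apply: (spanning_eq ob hb) => k.
  by rewrite hT // mul0r oppr0 expR0 mul1r.
- move=> s t f s0 t0; apply: (spanning_eq ob hb) => k.
  rewrite !hT ?addr_ge0 // mulrA -rmorphM /= -expRD; congr ((expR _)%:C * _).
  by ring.
- move=> t f e t0 e0.
  have hr h k : 0 <= t + h -> ip (T (t + h) f - T t f) (b k) =
      (expR (- ((t + h) * l k)) - expR (- (t * l k)))%:C * ip f (b k).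
    by move=> th0; rewrite ipBl !hT // rmorphB mulrBl.
  have [|||d [d0 hd]] := dominated_coefficients (P := fun h => 0 <= t + h)
    (r := fun h => T (t + h) f - T t f) (g := f)
    (K := fun k => (l k) ^+ 2 * normsq (ip f (b k))) _ _ _ e0.
  + by move=> k; rewrite mulr_ge0 ?sqr_ge0 ?normsq_ge0.
  + move=> h k th0; rewrite hr // normsqM normsqC -[leRHS]mul1r.
    apply: ler_wpM2r; first exact: normsq_ge0.
    exact: (expR_diff_bounds (l0 k) th0 t0).1.
  + move=> h k th0; rewrite hr // normsqM normsqC mulrA.
    apply: ler_wpM2r; first exact: normsq_ge0.
    by have := (expR_diff_bounds (l0 k) th0 t0).2; rewrite addrAC subrr add0r.
  exists d; split => // s s0 sd; have := hd (s - t); rewrite addrCA subrr addr0.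
  exact.
have hr f h k : 0 < h -> ip (h^-1%:C *: (f - T h f)) (b k) =
    (h^-1 * (1 - expR (- (h * l k))))%:C * ip f (b k).
  move=> h0; rewrite ipZl ipBl hT ?ltW // rmorphM rmorphB rmorph1; ring.
move=> f g; split => [/domH hg|hlim].
  have hr' h k : 0 < h -> ip (h^-1%:C *: (f - T h f) - g) (b k) =
      (h^-1 * (1 - expR (- (h * l k))) - l k)%:C * ip f (b k).
    by move=> h0; rewrite ipBl hr // hg rmorphB mulrBl.
  move=> e e0; have [|||d [d0 hd]] := dominated_coefficients (P := fun h => 0 < h)
    (r := fun h => h^-1%:C *: (f - T h f) - g) (g := g)
    (K := fun k => (l k) ^+ 4 * normsq (ip f (b k))) _ _ _ e0.
  + by move=> k; rewrite mulr_ge0 ?normsq_ge0 // exprn_even_ge0.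
  + move=> h k h0; rewrite hr' // hg !normsqM !normsqC.
    apply: ler_wpM2r; first exact: normsq_ge0.
    exact: (expR_quotient_bounds (l0 k) h0).1.
  + move=> h k h0; rewrite hr' // normsqM normsqC mulrA.
    apply: ler_wpM2r; first exact: normsq_ge0.
    exact: (expR_quotient_bounds (l0 k) h0).2.
  exists d; split => // t t0 td; apply: hd => //; by rewrite gtr0_norm.
(* Conversely, the k-th coefficient of the difference quotient tends to that of [g] by
   Cauchy-Schwarz and to [l k] times that of [f] by the scalar bound; one [h] small enough for both
   estimates compares the two limits. *)
apply/domH => k; apply/eqP; rewrite -subr_eq0; apply/eqP/normsq_eq0/eqP.
rewrite eq_le normsq_ge0 andbT; apply: le_eps => e e0; rewrite add0r.
have e4 : 0 < e / 4 by lra.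
have [d [d0 hd]] := hlim _ e4.
set K := (l k) ^+ 4 * normsq (ip f (b k)).
have K0 : 0 <= K by rewrite mulr_ge0 ?normsq_ge0 // exprn_even_ge0.
pose h := Num.min (d / 2) (Num.min 1 (e / 4 / (K + 1))).
have eK : 0 < e / 4 / (K + 1) by apply: divr_gt0; lra.
have h0 : 0 < h by rewrite !lt_min ltr01 eK !andbT; lra.
have h1 : h <= 1 by rewrite !ge_min lexx ?orbT.
have hdd : h < d by apply: (@le_lt_trans _ _ (d / 2)); [rewrite ge_min lexx | lra].
have hK : h * (K + 1) <= e / 4.
  by rewrite -ler_pdivlMr; [rewrite !ge_min lexx ?orbT | lra].
have := hd h h0 hdd; set u := _ - g => hu.
have n1 : normsq (ip u (b k)) < e / 4.
  apply: le_lt_trans hu; apply: le_trans (cauchy_schwarz _ _ _) _.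
  rewrite (orthonormal_sq _ ob); case: (J k); rewrite ?mulr1 ?mulr0 //.
  exact: sq_ge0.
have -> : ip g (b k) - (l k)%:C * ip f (b k) =
    (h^-1 * (1 - expR (- (h * l k))) - l k)%:C * ip f (b k) + - ip u (b k).
  by rewrite /u ipBl hr // rmorphB; ring.
apply: le_lt_trans (normsqD_le _ _) _; rewrite normsqN normsqM normsqC.
have n2 : (h^-1 * (1 - expR (- (h * l k))) - l k) ^+ 2 * normsq (ip f (b k)) <= h ^+ 2 * K.
  rewrite /K mulrA; apply: ler_wpM2r; first exact: normsq_ge0.
  exact: (expR_quotient_bounds (l0 k) h0).2.
have n3 : h ^+ 2 * K <= h * (K + 1).
  rewrite expr2 -mulrA ler_pM2l //.
  by apply: (@le_trans _ _ (1 * K)); [exact: ler_wpM2r | lra].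
lra.
Qed.

End Existence.

Section Uniqueness.
Context {H : V -> V -> Prop} {T : R -> V -> V} (sgT : semigroup_of H T).

Lemma semigroupB t f g : 0 <= t -> sq (T t (f - g) - (T t f - T t g)) = 0.
Proof.
move=> t0; have := sg_lin sgT (-1) g f t0.
by rewrite !scaleN1r [- g + f]addrC [- T t g + _]addrC.
Qed.

Lemma semigroupZ t c f : 0 <= t -> sq (T t (c *: f) - c *: T t f) = 0.
Proof.
move=> t0.
have T0 : sq (T t 0 - 0) = 0.
  rewrite subr0; apply: sq_eq_le0; have [M hM] := sg_bounded sgT t0.
  by apply: le_trans (hM 0) _; rewrite sq0 mulr0.
have := sg_lin sgT c f 0 t0; rewrite addr0 => h.
apply: sq_trans h _; by rewrite addrAC subrr add0r -[T t 0]subr0.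
Qed.

(* With [u t = T t b - e^{-tl} b], the generator gives [|u h| = o(h)], and
   [u (t + h) = T t (u h) + e^{-hl} u t]; hence the upper right Dini derivative of
   [|Re (u t, psi)|] is at most 0 for every [psi]. *)
Lemma semigroup_eigen b (l : R) : 0 <= l -> H b (l%:C *: b) ->
  forall t, 0 <= t -> sq (T t b - (expR (- (t * l)))%:C *: b) = 0.
Proof.
move=> l0 Hb.
have [L [L0 hL]] : exists L : R, 0 <= L /\ L = sq b by exists (sq b); rewrite sq_ge0.
pose q t := expR (- (t * l)).
have q_le1 t : 0 <= t -> q t <= 1 by move=> t0; rewrite expRN_le1 // mulr_ge0.
pose u t := T t b - (q t)%:C *: b.
have step e : 0 < e -> exists d, 0 < d /\ forall h, 0 < h -> h < d ->
    sq (u h) <= e * h ^+ 2.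
  move=> e0; have e4 : 0 < e / 4 by lra.
  have [d [d0 hd]] := (sg_gen sgT b (l%:C *: b)).1 Hb _ e4.
  pose K := l ^+ 4 * L.
  have K0 : 0 <= K by rewrite mulr_ge0 // exprn_even_ge0.
  pose d' := Num.min d (Num.min 1 (e / 4 / (K + 1))).
  exists d'; split; first by rewrite !lt_min d0 ltr01 divr_gt0 //=; lra.
  move=> h h0; rewrite !lt_min => /and3P[hdd h1 h2].
  rewrite ltr_pdivlMr in h2; last lra.
  set w := h^-1%:C *: (b - T h b) - l%:C *: b.
  have hw : sq w < e / 4 := hd h h0 hdd.
  pose z := (h^-1 * (1 - q h) - l) : R.
  (* [w] is the error of the generator quotient at [b], small by hypothesis, and [z] is the same
     error for the scalar exponential. *)
  have -> : u h = h%:C *: (z%:C *: b - w).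
    have e1 : h%:C *: w = b - T h b - (h * l)%:C *: b.
      rewrite /w scalerBr !scalerA -!rmorphM /= mulfV ?gt_eqF // rmorph1 scale1r //.
    have e2 : h * z = 1 - q h - h * l by rewrite /z mulrBr mulVKf ?gt_eqF.
    rewrite scalerBr scalerA -rmorphM /= e2 e1 !rmorphB /= rmorph1 !scalerBl scale1r /u.
    rewrite opprB addrA subrK opprB [b - _]addrC addrACA subrr addr0.
    by rewrite addrC.
  rewrite sqZ normsqC [leRHS]mulrC ler_wpM2l ?sqr_ge0 //.
  apply: le_trans (sqB_le _ _ _) _; rewrite sqZ normsqC -hL.
  have h3 : z ^+ 2 * L <= h ^+ 2 * K.
    by rewrite /K mulrA; apply: ler_wpM2r => //; exact: (expR_quotient_bounds l0 h0).2.
  have h4 : h ^+ 2 * K <= h * (K + 1).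
    rewrite expr2 -mulrA ler_pM2l //.
    by apply: (@le_trans _ _ (1 * K)); [apply: ler_wpM2r => //; exact: ltW | lra].
  lra.
have u0 : sq (u 0) = 0.
  by rewrite /u /q mul0r oppr0 expR0 scale1r; exact: sg_0 sgT b.
have ucont t e : 0 <= t -> 0 < e -> exists d, 0 < d /\
    forall s, 0 <= s -> `|s - t| < d -> sq (u s - u t) < e.
  move=> t0 e0; have e4 : 0 < e / 4 by lra.
  have [d [d0 hd]] := sg_cont sgT b t0 e4.
  have K0 : 0 <= l ^+ 2 * L by rewrite mulr_ge0 // sqr_ge0.
  exists (Num.min d (Num.min 1 (e / 4 / (l ^+ 2 * L + 1)))); split.
    by rewrite !lt_min d0 ltr01 divr_gt0 //=; lra.
  move=> s s0; rewrite !lt_min => /and3P[h1 h2 h3].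
  rewrite ltr_pdivlMr in h3; last lra.
  have -> : u s - u t = (T s b - T t b) - (q s - q t)%:C *: b.
    by rewrite /u rmorphB scalerBl !opprB [LHS]addrACA [RHS]addrACA; congr (_ + _); rewrite addrC.
  apply: le_lt_trans (sqB_le _ _ _) _; rewrite sqZ normsqC -hL.
  have h4 := hd s s0 h1.
  have h5 : (q s - q t) ^+ 2 * L <= (s - t) ^+ 2 * (l ^+ 2 * L).
    by rewrite mulrA; apply: ler_wpM2r => //; exact: (expR_diff_bounds l0 s0 t0).2.
  have h6 : (s - t) ^+ 2 * (l ^+ 2 * L) <= `|s - t| * (l ^+ 2 * L + 1).
    rewrite -real_normK ?num_real // expr2 -mulrA; apply: ler_wpM2l => //.
    by apply: (@le_trans _ _ (1 * (l ^+ 2 * L))); [apply: ler_wpM2r => //; exact: ltW | lra].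
  lra.
have shift h t psi : 0 <= t -> 0 <= h ->
    ip (u (t + h)) psi = ip (T t (u h)) psi + (q h)%:C * ip (u t) psi.
  move=> t0 h0.
  rewrite /u !ipBl (ip_eql _ (sg_D sgT b t0 h0)) (ip_eql _ (semigroupB _ _ t0)) ipBl.
  rewrite (ip_eql _ (semigroupZ _ _ t0)) !ipZl.
  have -> : q (t + h) = q t * q h by rewrite /q -expRD; congr expR; ring.
  by rewrite rmorphM; ring.
(* Testing against the vector itself suffices, as the pairing is then [sq (u t)]; [psi] stays fixed
   while time varies. *)
move=> t t0; set psi := u t.
suff h : `|Rep (ip (u t) psi)| <= 0 by apply/eqP; rewrite -normr_le0.
have norm_lt (x e : R) : 0 < e -> x ^+ 2 < e ^+ 2 -> `|x| < e.
  by move=> e0 h; apply: sqr_lt => //; rewrite real_normK // num_real.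
have P1 : 0 < sq psi + 1 by have := sq_ge0 ip psi; lra.
apply: (dini_le0 (phi := fun s => `|Rep (ip (u s) psi)|)) t0.
- by rewrite ip_null_l // normr0.
- move=> s e s0 e0.
  have [d [d0 hd]] := ucont s (e ^+ 2 / (sq psi + 1)) s0 ltac:(by rewrite divr_gt0 // exprn_gt0).
  exists d; split => // r r0 rs.
  apply: le_lt_trans (ler_dist_dist _ _) _.
  rewrite -RepN -RepD -ipBl; apply: norm_lt => //.
  apply: le_lt_trans (normsq_Rep _) _; apply: le_lt_trans (cauchy_schwarz _ _ _) _.
  have := hd r r0 rs; rewrite ltr_pdivlMr //; apply: le_lt_trans.
  by apply: ler_wpM2l; [exact: sq_ge0 | lra].
- move=> s e s0 e0; have [M hM] := sg_bounded sgT s0.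
  have K0 : 0 < `|M| * (sq psi + 1) + 1.
    by have := mulr_ge0 (normr_ge0 M) (ltW P1); lra.
  have e1 : 0 < e ^+ 2 by rewrite exprn_gt0.
  have [d [d0 hd]] := step _ (divr_gt0 e1 K0).
  exists d; split => // h h0 hdd.
  rewrite (shift _ _ _ s0 (ltW h0)) RepD.
  apply: le_trans (ler_normD _ _) _; rewrite addrC; apply: lerD.
    rewrite RepM RepC ImpC mul0r subr0 normrM ger0_norm ?expR_ge0 //.
    by rewrite -[leRHS]mul1r; apply: ler_wpM2r => //; apply: q_le1; exact: ltW.
  apply: ltW; apply: norm_lt; first exact: mulr_gt0.
  apply: le_lt_trans (normsq_Rep _) _; apply: le_lt_trans (cauchy_schwarz _ _ _) _.
  have := hd h h0 hdd.
  rewrite mulrAC ler_pdivlMr // exprMn => h1.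
  (* [norm_lt] needs a strict inequality, which the factor [sq (u h)] preserves only when it is
     positive. *)
  have [uh|uh] := eqVneq (sq (u h)) 0.
    have -> : sq (T s (u h)) = 0.
      by apply: sq_eq_le0; apply: le_trans (hM _) _; rewrite uh mulr0.
    by rewrite mul0r mulr_gt0 // exprn_gt0.
  have uh0 : 0 < sq (u h) by rewrite lt_neqAle eq_sym uh sq_ge0.
  apply: lt_le_trans h1.
  apply: (@le_lt_trans _ _ (sq (u h) * (`|M| * (sq psi + 1)))).
    rewrite mulrA; apply: ler_pM; rewrite ?sq_ge0 //; last lra.
    by apply: le_trans (hM _) _; rewrite mulrC ler_wpM2l ?sq_ge0 // ler_norm.
  by rewrite ltr_pM2l // ltrDl.
Qed.

End Uniqueness.
End Semigroups.

(** * Independence of the trace from the basis *)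

Section Trace.
Context {R : realType} {V : lmodType R[i]} (ip : semiInner V).
Local Notation sq := (sq ip).
Context {H : V -> V -> Prop} {T : R -> V -> V} (sgT : semigroup_of ip H T).
Context {b : nat -> V} {J : pred nat} {l : nat -> R}.
Hypotheses (ob : orthonormal_family ip b J) (hb : spanning ip b).
Hypothesis l0 : forall k, 0 <= l k.
Hypothesis Hb : forall k, H (b k) ((l k)%:C *: b k).
Context {t : R} (t0 : 0 <= t).
Let q k := expR (- (t * l k)).

Let q0 k : 0 <= q k. Proof. exact: expR_ge0. Qed.
Let q1 k : q k <= 1. Proof. by rewrite expRN_le1 // mulr_ge0. Qed.

(** The action on eigenvectors extends to Fourier sums by linearity up to null vectors, and to [f]
    because [T t] is bounded. *)
Lemma semigroup_fourier f :
  cvgto ip (fun N => \sum_(0 <= k < N) ((q k)%:C * ip f (b k)) *: b k) (T t f).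
Proof.
have Tproj N : sq (T t (fourier_sum ip b N f) -
    \sum_(0 <= k < N) ((q k)%:C * ip f (b k)) *: b k) = 0.
  elim: N => [|N IH].
    rewrite /fourier_sum !big_geq // subr0; apply: sq_eq_le0.
    have [M hM] := sg_bounded sgT t0; apply: le_trans (hM 0) _.
    by rewrite sq0 mulr0.
  rewrite /fourier_sum !big_nat_recr //= -/(fourier_sum ip b N f).
  rewrite ![_ + _ *: b N]addrC.
  apply: sq_trans (sg_lin sgT _ _ _ t0) _; rewrite opprD addrACA.
  apply: sq_eq_le0; apply: le_trans (sqD_le _ _ _) _; rewrite IH mulr0 addr0.
  rewrite [_%:C * _]mulrC -scalerA -scalerBr sqZ (semigroup_eigen sgT (l0 N) (Hb N) t0).
  by rewrite !mulr0.
have [M hM] := sg_bounded sgT t0.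
have M1 : 0 < `|M| + 1 by have := normr_ge0 M; lra.
move=> e e0; have [N hN] := hb f (divr_gt0 e0 M1).
exists N => n /hN hn; set S := \sum_(_ <= _ < _) _.
have h1 : sq (S - T t f - (T t (fourier_sum ip b n f - f))) = 0.
  have h2 := semigroupB sgT (fourier_sum ip b n f) f t0.
  rewrite sqBC; apply: sq_trans h2 _; rewrite opprB addrA subrK; exact: Tproj.
have -> : sq (S - T t f) = sq (T t (fourier_sum ip b n f - f)).
  by apply: (congr1 (@complex.Re R)); rewrite (ip_eql _ h1) (ip_eqr _ h1).
apply: le_lt_trans (hM _) _.
rewrite ltr_pdivlMr // mulrC in hn; apply: le_lt_trans hn.
by apply: ler_wpM2r; [exact: sq_ge0 | have := ler_norm M; lra].
Qed.

Let X f N := \sum_(0 <= k < N) q k * normsq (ip f (b k)).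

Let X_mono f M N : (M <= N)%N -> X f M <= X f N.
Proof.
move=> MN; rewrite /X (big_cat_nat (n := M) _ MN) //= lerDl.
by apply: sumr_ge0 => k _; rewrite mulr_ge0 // normsq_ge0.
Qed.

Let X_cvg f e : 0 < e -> exists N, forall n, (N <= n)%N ->
  normsq ((X f n)%:C - ip (T t f) f) < e.
Proof.
move=> e0; have [N hN] := cvgto_ip f (semigroup_fourier f) e0.
exists N => n /hN; rewrite ip_suml; congr (normsq (_ - _) < e).
rewrite rmorph_sum; apply: eq_bigr => k _.
by rewrite ipZl (ip_conj ip (b k)) -mulrA mulJ rmorphM.
Qed.

Lemma semigroup_diag_Im f : Imp (ip (T t f) f) = 0.
Proof.
apply/eqP; rewrite -sqrf_eq0 eq_le sqr_ge0 andbT; apply: le_eps => e e0.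
have [N hN] := X_cvg f e0; have := le_lt_trans (normsq_Imp _) (hN N (leqnn _)).
by rewrite ImpD ImpN ImpC !add0r sqrrN.
Qed.

Let X_dist f e : 0 < e -> exists N, forall n, (N <= n)%N ->
  `|X f n - Rep (ip (T t f) f)| < e.
Proof.
move=> e0; have [N hN] := X_cvg f (exprn_gt0 2 e0); exists N => n /hN h.
have := le_lt_trans (normsq_Rep _) h; rewrite RepD RepN RepC => h1.
by apply: sqr_lt => //; rewrite real_normK // num_real.
Qed.

Let X_le f N : X f N <= Rep (ip (T t f) f).
Proof.
apply: le_eps => e e0; have [M hM] := X_dist f e0.
have := hM (maxn N M) (leq_maxr _ _); have := X_mono f (leq_maxl N M).
by rewrite ltr_norml => h1 /andP[_ h2]; lra.
Qed.

Let X_lt f e : 0 < e -> exists N, Rep (ip (T t f) f) < X f N + e.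
Proof.
move=> e0; have [M hM] := X_dist f e0; exists M; have := hM M (leqnn _).
by rewrite ltr_norml => /andP[h _]; lra.
Qed.

Context {tau : R}.
Hypothesis tau_ub : forall N, \sum_(0 <= k < N) (J k)%:R * q k <= tau.
Hypothesis tau_lub : forall e, 0 < e ->
  exists N, tau < \sum_(0 <= k < N) (J k)%:R * q k + e.

(* Both traces are the sum of [e^{-t l_k} |(b_k, c_m)|^2] over k and m. *)
Theorem semigroup_trace c Jc : orthonormal_family ip c Jc -> spanning ip c ->
  forall e, 0 < e -> exists N, forall n, (N <= n)%N ->
    `|\sum_(0 <= m < n) Rep (ip (T t (c m)) (c m)) - tau| < e.
Proof.
move=> oc hc.
have Xsum N M : \sum_(0 <= m < M) X (c m) N =
    \sum_(0 <= k < N) q k * \sum_(0 <= m < M) normsq (ip (b k) (c m)).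
  rewrite exchange_big /=; apply: eq_bigr => k _; rewrite mulr_sumr.
  by apply: eq_bigr => m _; rewrite ip_conj normsqJ.
(* Finitely many diagonal terms are approximated by one truncation in [k]; after the exchange of
   finite sums, Bessel for [c] bounds the k-th row by [q k * sq (b k)]. *)
have upper M : \sum_(0 <= m < M) Rep (ip (T t (c m)) (c m)) <= tau.
  have key e : 0 < e -> exists N, \sum_(0 <= m < M) Rep (ip (T t (c m)) (c m)) <
      \sum_(0 <= m < M) X (c m) N + e.
    elim: M e => [|M IH] e e0; first by exists 0%N; rewrite !big_geq // add0r.
    have e2 : 0 < e / 2 by lra.
    have [N1 h1] := IH _ e2; have [N2 h2] := X_lt (c M) e2.
    exists (maxn N1 N2); rewrite !big_nat_recr //=.
    have h3 := X_mono (c M) (leq_maxr N1 N2).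
    have h4 : \sum_(0 <= m < M) X (c m) N1 <= \sum_(0 <= m < M) X (c m) (maxn N1 N2).
      by apply: ler_sum => m _; apply: X_mono; exact: leq_maxl.
    lra.
  apply: le_eps => e e0; have [N hN] := key _ e0.
  apply: lt_le_trans hN _; rewrite lerD2r; apply: le_trans (tau_ub N).
  rewrite Xsum; apply: ler_sum => k _; rewrite mulrC; apply: ler_wpM2r => //.
  by rewrite -(orthonormal_sq k ob); exact: bessel oc _ _.
(* Parseval in [c] for the first [K] vectors [b k]; the factor [q k <= 1] does not enlarge the
   error. *)
have lower K e : 0 < e -> exists M0, forall M, (M0 <= M)%N ->
    \sum_(0 <= k < K) (J k)%:R * q k <
    \sum_(0 <= k < K) q k * \sum_(0 <= m < M) normsq (ip (b k) (c m)) + e.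
  elim: K e => [|K IH] e e0.
    by exists 0%N => M _; rewrite !big_geq // add0r.
  have e2 : 0 < e / 2 by lra.
  have [M1 h1] := IH _ e2; have [M2 h2] := parseval oc (hc (b K)) e2.
  exists (maxn M1 M2) => M; rewrite geq_max => /andP[/h1 {}h1 /h2 {}h2].
  rewrite !big_nat_recr //= -(orthonormal_sq K ob).
  set S := \sum_(_ <= _ < M) _ in h2 *.
  have h3 : q K * (sq (b K) - S) <= 1 * (sq (b K) - S).
    by apply: ler_wpM2r => //; rewrite subr_ge0; exact: bessel oc _ _.
  lra.
move=> e e0; have e2 : 0 < e / 2 by lra.
have [K hK] := tau_lub e2; have [M0 hM0] := lower K _ e2.
exists M0 => n /hM0; rewrite -Xsum => h1.
have h2 : \sum_(0 <= m < n) X (c m) K <= \sum_(0 <= m < n) Rep (ip (T t (c m)) (c m)).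
  by apply: ler_sum => m _; exact: X_le.
have h3 := upper n; rewrite ltr_norml; apply/andP; split; lra.
Qed.

End Trace.

(** * Bases of finite-dimensional kernels *)

Section GramSchmidt.
Context {R : realType} {V : lmodType R[i]} (ip : semiInner V).
Local Notation sq := (sq ip).

Definition in_span (n : nat) (b : nat -> V) u :=
  exists c : nat -> R[i], u = \sum_(0 <= k < n) c k *: b k.

Lemma in_span_lin n b c u v : in_span n b u -> in_span n b v -> in_span n b (c *: u + v).
Proof.
move=> [a ->] [a' ->]; exists (fun k => c * a k + a' k).
by rewrite scaler_sumr -big_split; apply: eq_bigr => k _; rewrite /= scalerDl scalerA.
Qed.

Lemma in_span0 n b : in_span n b 0.
Proof. by exists (fun=> 0); rewrite big1 // => k _; rewrite scale0r. Qed.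

Lemma in_spanS n b u : in_span n b u -> in_span n.+1 b u.
Proof.
move=> [a ->]; exists (fun k => if (k < n)%N then a k else 0).
rewrite big_nat_recr //= ltnn scale0r addr0 big_nat [RHS]big_nat.
by apply: eq_bigr => k /andP[_ ->].
Qed.

Definition independent n b := forall c : nat -> R[i],
  sq (\sum_(0 <= k < n) c k *: b k) = 0 -> forall k, (k < n)%N -> c k = 0.

(** The last clause is the form in which [kernel_basis_exists] uses equality of the spans: it avoids
    expressing the [b i] through the [x i]. *)
Lemma gram_schmidt n b : independent n b -> exists x : nat -> V,
  [/\ forall i j, (i < n)%N -> (j < n)%N -> ip (x i) (x j) = (i == j)%:R,
      forall i, (i < n)%N -> in_span n b (x i) &
      forall f, (forall i, (i < n)%N -> ip f (x i) = 0) ->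
        forall i, (i < n)%N -> ip f (b i) = 0].
Proof.
elim: n => [|n IH] ind; first by exists b; split.
have [|x [ox sx bx]] := IH.
  move=> c hc k kn.
  have := ind (fun k => if (k < n)%N then c k else 0) _ k (leqW kn); rewrite kn; apply.
  rewrite big_nat_recr //= ltnn scale0r addr0 -[RHS]hc; congr sq.
  by rewrite big_nat [RHS]big_nat; apply: eq_bigr => j /andP[_ ->].
pose y := b n - \sum_(0 <= i < n) ip (b n) (x i) *: x i.
have [a ha] : in_span n b (\sum_(0 <= i < n) ip (b n) (x i) *: x i).
  rewrite big_nat; elim/big_rec: _ => [|i z /andP[_ iN] hz]; first exact: in_span0.
  exact: in_span_lin (sx i iN) hz.
have y0 : sq y != 0.
  apply/eqP => hy.
  have := ind (fun k => if (k < n)%N then - a k else 1) _ n (ltnSn n).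
  rewrite ltnn => h; suff /h /eqP : sq (\sum_(0 <= k < n.+1)
      (if (k < n)%N then - a k else 1) *: b k) = 0 by rewrite oner_eq0.
  rewrite big_nat_recr //= ltnn scale1r -[RHS]hy /y ha addrC -sumrN; congr sq.
  congr (_ + _); rewrite big_nat [RHS]big_nat.
  by apply: eq_bigr => k /andP[_ ->]; rewrite scaleNr.
have oy i : (i < n)%N -> ip y (x i) = 0 by exact: orthonormal_remainder.
pose r := Num.sqrt (sq y).
have r2 : r * r = sq y by rewrite -expr2 sqr_sqrtr // sq_ge0.
have r0 : r != 0 by rewrite sqrtr_eq0 -ltNge lt_neqAle eq_sym y0 sq_ge0.
pose x' k := if k == n then r^-1%:C *: y else x k.
exists x'; split.
- move=> i j; rewrite (ltnS i) (ltnS j) (leq_eqVlt i) (leq_eqVlt j) /x'.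
  have [->|ni] := eqVneq i n; have [->|nj] := eqVneq j n => //=.
  + move=> _ _; rewrite ipZl ipZr conjcC ipsq mulrA -!rmorphM /= -r2 -[RHS](rmorph1 (real_complex R)); congr (_%:C).
    by field.
  + by move=> _ jn; rewrite ipZl oy // mulr0.
  + move=> iN _; rewrite ipZr (ip_conj ip (x i)) oy //. by rewrite conjc0 mulr0 (negPf ni).
  + exact: ox.
- move=> i; rewrite ltnS leq_eqVlt /x'.
  have [_ _|ni] := eqVneq i n => /=; last by move=> /sx /in_spanS.
  rewrite -[_ *: y]addr0; apply: in_span_lin (in_span0 _ _).
  rewrite /y -[b n - _]addrC -scaleN1r; apply: in_span_lin.
    by rewrite ha; apply: in_spanS; exists a.
  exists (fun k => (k == n)%:R); rewrite big_nat_recr //= eqxx scale1r.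
  rewrite big_nat big1 ?add0r // => k /andP[_ kn].
  by rewrite (ltn_eqF kn) scale0r.
- move=> f hf i; rewrite ltnS leq_eqVlt => /predU1P[->|iN]; last first.
    apply: bx iN => j jn; have := hf j (leqW jn); rewrite /x' ifN //.
    by rewrite neq_ltn jn.
  have hx j : (j < n)%N -> ip f (x j) = 0.
    by move=> jn; have := hf j (leqW jn); rewrite /x' ifN // neq_ltn jn.
  have := hf n (ltnSn n); rewrite /x' eqxx ipZr conjcC => /eqP.
  rewrite mulf_eq0 eq_complex /= eqxx andbT invr_eq0 (negPf r0) /= => /eqP.
  rewrite /y ipBr ip_sumr big_nat big1 ?subr0 // => j /andP[_ jn].
  by rewrite ipZr hx // mulr0.
Qed.

Lemma kernel_basis_exists (D A : V -> V -> Prop) n b : adjoint_of ip A D ->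
  (forall i, (i < n)%N -> D (b i) 0) -> independent n b ->
  (forall f, D f 0 -> exists c : nat -> R[i], sq (f - \sum_(0 <= k < n) c k *: b k) = 0) ->
  exists x, kernel_basis ip D n x.
Proof.
move=> adjD kb ind sp; have [x [ox sx bx]] := gram_schmidt ind.
exists x; split => //.
  move=> i /sx [c ->]; rewrite big_nat; elim/big_rec: _ => [|k y /andP[_ kn] hy].
    exact: adjoint0 adjD.
  by have := adjoint_lin adjD (c k) (kb k kn) hy; rewrite scaler0 addr0.
move=> f Df fx; have [c hc] := sp f Df; have fb := bx f fx.
have -> : sq f = Rep (ip f (\sum_(0 <= k < n) c k *: b k)) by rewrite -(ip_eqr f hc).
by rewrite ip_sumr big_nat big1 // => k /andP[_ kn]; rewrite ipZr fb // mulr0.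
Qed.

End GramSchmidt.

Section HeatSums.
Context {R : realType}.

(** The [m] vectors in front have eigenvalue 0 and contribute exp 0 = 1 each, for every [t]. In the
    traces [m] is the dimension of a kernel. *)
Lemma catfam_sum (m : nat) (J : pred nat) (l : nat -> R) (t tau : R) :
  (forall N, \sum_(0 <= k < N) (J k)%:R * expR (- (t * l k)) <= tau) ->
  (forall e, 0 < e -> exists N, tau < \sum_(0 <= k < N) (J k)%:R * expR (- (t * l k)) + e) ->
  let J' := catfam m xpredT J in let l' := catfam m (fun=> 0) l in
  (forall N, \sum_(0 <= k < N) (J' k)%:R * expR (- (t * l' k)) <= m%:R + tau) /\
  (forall e, 0 < e -> exists N,
     m%:R + tau < \sum_(0 <= k < N) (J' k)%:R * expR (- (t * l' k)) + e).
Proof.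
move=> ub lub J' l'; set F := fun k => (J' k)%:R * expR (- (t * l' k)).
have F0 k : 0 <= F k by rewrite mulr_ge0 ?expR_ge0.
have split N : \sum_(0 <= k < m + N) F k =
    m%:R + \sum_(0 <= k < N) (J k)%:R * expR (- (t * l k)).
  rewrite (big_cat_nat (n := m)) ?leq_addr //=; congr (_ + _).
    rewrite big_nat (eq_bigr (fun=> 1)); last first.
      by move=> k /andP[_ km]; rewrite /F /J' /l' /catfam km mulr0 oppr0 expR0 mul1r.
    by rewrite -big_nat sumr_const_nat subn0.
  rewrite -{1}[m]add0n big_addn addKn; apply: eq_bigr => k _.
  by rewrite /F /J' /l' /catfam ltnNge leq_addl /= addnK.
split=> [N|e e0].
  apply: (@le_trans _ _ (\sum_(0 <= k < m + N) F k)); last by rewrite split lerD2l.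
  rewrite [leRHS](big_cat_nat (n := N)) ?leq_addl //= lerDl.
  by apply: sumr_ge0.
by have [N hN] := lub e e0; exists (m + N)%N; rewrite split; lra.
Qed.

(** By exp(t s) >= 1 + t s, it is enough that (1 + 1/t) (1 + t s) = 1 + t s + 1/t + s is at least 1
    + s. This turns the resolvent bound into a bound on heat sums. *)
Lemma exp_resolvent_bound (t s : R) : 0 < t -> 0 <= s ->
  expR (- (t * s)) <= (1 + t^-1) / (1 + s).
Proof.
move=> t0 s0; have ti : 0 < t^-1 by rewrite invr_gt0.
have ts : 0 <= t * s by rewrite mulr_ge0 // ltW.
rewrite ler_pdivlMr; last lra.
have h := expR_ge1Dx (t * s); rewrite expRN mulrC ler_pdivrMr ?expR_gt0 //.
apply: (@le_trans _ _ ((1 + t^-1) * (1 + t * s))); last by apply: ler_wpM2l => //; lra.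
have -> : (1 + t^-1) * (1 + t * s) = 1 + t * s + t^-1 + s by field; rewrite gt_eqF.
lra.
Qed.

End HeatSums.

(** * Square-integrable functions *)

Section SquareIntegrable.
Context {R : realType} {D : set (measurableTypeR R)}.
Hypothesis mD : measurable D.
Local Notation mu := (@lebesgue_measure R).
Implicit Types f g : measurableTypeR R -> R.

Definition sqint (D : set (measurableTypeR R)) f :=
  measurable_fun D f /\ mu.-integrable D (EFin \o (fun x => f x ^+ 2)).

Lemma sqintM f g : sqint D f -> sqint D g ->
  mu.-integrable D (EFin \o (fun x => f x * g x)).
Proof.
move=> [mf if2] [mg ig2].
apply: (@le_integrable _ _ _ mu _ mD _ (EFin \o (fun x => f x ^+ 2 + g x ^+ 2))).
- by apply/measurable_EFinP; exact: measurable_funM.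
- move=> x _ /=; rewrite lee_fin; rewrite [leRHS]ger0_norm ?addr_ge0 ?sqr_ge0 //.
  rewrite ler_norml; apply/andP; split.
    by have := sqr_ge0 (f x + g x); have := sqr_ge0 (f x); have := sqr_ge0 (g x); lra.
  by have := sqr_ge0 (f x - g x); have := sqr_ge0 (f x); have := sqr_ge0 (g x); lra.
- by apply: (eq_integrable mD _ _ _ (integrableD mD if2 ig2)) => // x _ /=; rewrite EFinD.
Qed.

Lemma integrable_lin (a : R) f g : mu.-integrable D (EFin \o f) ->
  mu.-integrable D (EFin \o g) -> mu.-integrable D (EFin \o (fun x => a * f x + g x)).
Proof.
by move=> hf hg; apply: (eq_integrable mD _ _ _ (integrableD mD (integrableZl mD a hf) hg)).
Qed.

Lemma Rintegral_lin (a : R) f g : mu.-integrable D (EFin \o f) ->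
  mu.-integrable D (EFin \o g) ->
  \int[mu]_(x in D) (a * f x + g x) = a * \int[mu]_(x in D) f x + \int[mu]_(x in D) g x.
Proof.
move=> hf hg; rewrite RintegralD ?RintegralZl //.
by apply: (eq_integrable mD _ _ _ (integrableZl mD a hf)) => // x _ /=; rewrite EFinM.
Qed.

Lemma eq_integrable_fin f g : (forall x, D x -> f x = g x) ->
  mu.-integrable D (EFin \o f) -> mu.-integrable D (EFin \o g).
Proof. by move=> h; apply: eq_integrable => // x /set_mem /h /= ->. Qed.

Lemma sqint_lin (a : R) f g : sqint D f -> sqint D g ->
  sqint D (fun x => a * f x + g x).
Proof.
move=> hf hg; have [mf if2] := hf; have [mg ig2] := hg; split.
  by apply: measurable_funD => //; exact: measurable_funM.
have h := integrable_lin (a ^+ 2) if2 (integrable_lin (2 * a) (sqintM hf hg) ig2).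
by apply: eq_integrable_fin h => x _ /=; ring.
Qed.

Hypothesis fD : (mu D < +oo)%E.

Lemma integrable_cst_fin (c : R) : mu.-integrable D (EFin \o (fun=> c)).
Proof. exact: (measurable_bounded_integrable mD fD (measurable_cst c) (bounded_cst c D)). Qed.

Lemma sqint_cst (c : R) : sqint D (fun=> c).
Proof. by split; [exact: measurable_cst | exact: integrable_cst_fin]. Qed.

Lemma sqint_integrable f : sqint D f -> mu.-integrable D (EFin \o f).
Proof.
move=> hf; apply: eq_integrable_fin (sqintM hf (sqint_cst 1)) => x _ /=.
by rewrite mulr1.
Qed.

Lemma Rintegral_cs f : sqint D f ->
  (\int[mu]_(x in D) f x) ^+ 2 <= fine (mu D) * \int[mu]_(x in D) (f x ^+ 2).
Proof.
move=> hf; have [_ if2] := hf; have if1 := sqint_integrable hf.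
set I := Rintegral _ _ _; set Q := Rintegral _ _ _; set m := fine _.
have Q0 : 0 <= Q by apply: Rintegral_ge0 => x _; exact: sqr_ge0.
have m0 : 0 <= m by rewrite fine_ge0.
have key c : 0 <= Q - 2 * c * I + c ^+ 2 * m.
  have : 0 <= \int[mu]_(x in D) ((f x - c) ^+ 2).
    by apply: Rintegral_ge0 => x _; exact: sqr_ge0.
  have -> : \int[mu]_(x in D) ((f x - c) ^+ 2) =
      \int[mu]_(x in D) (- (2 * c) * f x + (c ^+ 2 * 1 + f x ^+ 2)).
    by apply: eq_Rintegral => x _; ring.
  have i1 : mu.-integrable D (EFin \o (fun=> 1 : R)) by exact: integrable_cst_fin.
  rewrite Rintegral_lin //; last exact: integrable_lin.
  by rewrite Rintegral_lin // Rintegral_cst // mul1r -/I -/Q -/m; lra.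
have [mp|mle] := ltP 0 m.
  have := key (I / m).
  have -> : Q - 2 * (I / m) * I + (I / m) ^+ 2 * m = Q - I ^+ 2 / m.
    by field; rewrite gt_eqF.
  by rewrite subr_ge0 ler_pdivrMr // mulrC.
have m00 : m = 0 by apply/eqP; rewrite eq_le mle m0.
have [->|I0] := eqVneq I 0; first by rewrite expr0n m00 mul0r.
(* On a null set [key] is affine in [c]; a nonzero integral [I] would allow this choice and give 0
   <= -1. *)
have := key ((Q + 1) / (2 * I)).
have -> : 2 * ((Q + 1) / (2 * I)) * I = Q + 1 by field.
by rewrite m00; lra.
Qed.

End SquareIntegrable.

Lemma ae_sub {R : realType} (P Q : measurableTypeR R -> Prop) :
  (forall x, P x -> Q x) -> {ae lebesgue_measure, forall x, P x} ->
  {ae lebesgue_measure, forall x, Q x}.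
Proof. by move=> h [N [mN N0 sub]]; exists N; split=> // x hx; apply: sub => /h. Qed.

Section ComplexIntegral.
Context {R : realType} {D : set (measurableTypeR R)}.
Hypothesis mD : measurable D.
Local Notation mu := (@lebesgue_measure R).
Implicit Types h k : measurableTypeR R -> R[i].

Definition cintegrable (D : set (measurableTypeR R)) h :=
  mu.-integrable D (EFin \o (fun x => Rep (h x))) /\
  mu.-integrable D (EFin \o (fun x => Imp (h x))).

Lemma eq_Cintegral h k : (forall x, D x -> h x = k x) ->
  Cintegral D h = Cintegral D k.
Proof.
by move=> e; congr Complex; apply: eq_Rintegral => x /set_mem Dx; rewrite e.
Qed.

Lemma Cintegral_lin (c : R[i]) h k : cintegrable D h -> cintegrable D k ->
  Cintegral D (fun x => c * h x + k x) = c * Cintegral D h + Cintegral D k.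
Proof.
move=> [h1 h2] [k1 k2]; apply: complex_ext; rewrite ?(RepD, ImpD, RepM, ImpM) /=.
  rewrite (@eq_Rintegral _ _ _ mu D (fun x => Rep c * Rep (h x) + (- Imp c * Imp (h x) + Rep (k x)))).
    rewrite !Rintegral_lin //; first by ring.
    exact: integrable_lin.
  by move=> x _; rewrite RepD RepM; ring.
rewrite (@eq_Rintegral _ _ _ mu D (fun x => Rep c * Imp (h x) + (Imp c * Rep (h x) + Imp (k x)))).
  rewrite !Rintegral_lin //; first by ring.
  exact: integrable_lin.
by move=> x _; rewrite ImpD ImpM; ring.
Qed.

Lemma Cintegral0 : Cintegral D (fun=> 0) = 0.
Proof.
by apply: complex_ext; rewrite /= Rintegral_cst //= mul0r.
Qed.

Lemma cintegrable0 : cintegrable D (fun=> 0).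
Proof. by split; exact: integrable0. Qed.

Lemma CintegralZ (c : R[i]) h : cintegrable D h ->
  Cintegral D (fun x => c * h x) = c * Cintegral D h.
Proof.
move=> hh; have := Cintegral_lin c hh cintegrable0; rewrite Cintegral0 addr0 => <-.
by apply: eq_Cintegral => x _; rewrite addr0.
Qed.

Lemma CintegralJ h : cintegrable D h ->
  Cintegral D (fun x => conjc (h x)) = conjc (Cintegral D h).
Proof.
move=> [h1 h2]; apply: complex_ext; rewrite ?RepJ ?ImpJ /=.
  by apply: eq_Rintegral => x _; rewrite RepJ.
rewrite -mulN1r -RintegralZl //; apply: eq_Rintegral => x _; by rewrite ImpJ mulN1r.
Qed.

Lemma Cintegral_ae h k : cintegrable D h -> cintegrable D k ->
  ae_eq mu D h k -> Cintegral D h = Cintegral D k.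
Proof.
move=> [h1 h2] [k1 k2] e; congr Complex; congr fine.
  apply: ae_eq_integral => //; [exact: measurable_int h1|exact: measurable_int k1|].
  by apply: ae_sub e => x hx Dx; rewrite /= hx.
apply: ae_eq_integral => //; [exact: measurable_int h2|exact: measurable_int k2|].
by apply: ae_sub e => x hx Dx; rewrite /= hx.
Qed.

Definition csqint (D : set (measurableTypeR R)) h :=
  sqint D (fun x => Rep (h x)) /\ sqint D (fun x => Imp (h x)).

Lemma csqint_lin (c : R[i]) h k : csqint D h -> csqint D k ->
  csqint D (fun x => c * h x + k x).
Proof.
move=> [h1 h2] [k1 k2]; split.
  rewrite (_ : (fun x => _) = (fun x => Rep c * Rep (h x) + (- Imp c * Imp (h x) + Rep (k x)))).
    by apply: sqint_lin => //; exact: sqint_lin.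
  by apply/funext => x; rewrite RepD RepM; ring.
rewrite (_ : (fun x => _) = (fun x => Rep c * Imp (h x) + (Imp c * Rep (h x) + Imp (k x)))).
  by apply: sqint_lin => //; exact: sqint_lin.
by apply/funext => x; rewrite ImpD ImpM; ring.
Qed.

Lemma csqintMJ h k : csqint D h -> csqint D k ->
  cintegrable D (fun x => h x * conjc (k x)).
Proof.
move=> [h1 h2] [k1 k2]; split.
  apply: eq_integrable_fin (integrable_lin mD 1 (sqintM mD h1 k1) (sqintM mD h2 k2)) => // x _ /=.
  by rewrite RepM RepJ ImpJ; ring.
apply: eq_integrable_fin (integrable_lin mD (-1) (sqintM mD h1 k2) (sqintM mD h2 k1)) => // x _ /=.
by rewrite ImpM RepJ ImpJ; ring.
Qed.

Lemma csqint_normsq h : csqint D h ->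
  mu.-integrable D (EFin \o (fun x => normsq (h x))).
Proof.
move=> [[_ h1] [_ h2]].
by apply: eq_integrable_fin (integrable_lin mD 1 h1 h2) => // x _ /=; rewrite mul1r.
Qed.

Lemma csqintP h : csqint D h <->
  [/\ measurable_fun D (fun x => Rep (h x)), measurable_fun D (fun x => Imp (h x)) &
      mu.-integrable D (EFin \o (fun x => normsq (h x)))].
Proof.
split=> [hh|[m1 m2 i]]; first by split; [exact: hh.1.1|exact: hh.2.1|exact: csqint_normsq].
split; split => //; apply: (le_integrable mD _ _ i) => //.
- by apply/measurable_EFinP; exact: measurable_funX.
- move=> x _ /=; rewrite lee_fin !ger0_norm ?sqr_ge0 ?normsq_ge0 //.
  exact: normsq_Rep.
- by apply/measurable_EFinP; exact: measurable_funX.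
- move=> x _ /=; rewrite lee_fin !ger0_norm ?sqr_ge0 ?normsq_ge0 //.
  exact: normsq_Imp.
Qed.

Lemma Cintegral_normsq h : csqint D h ->
  Cintegral D (fun x => h x * conjc (h x)) = (\int[mu]_(x in D) normsq (h x))%:C.
Proof.
move=> hh; apply: complex_ext => /=.
  by apply: eq_Rintegral => x _; rewrite mulJ.
rewrite (@eq_Rintegral _ _ _ mu D (fun=> 0)) ?Rintegral_cst ?mul0r // => x _.
by rewrite mulJ.
Qed.

Lemma normsq_ae0 h : csqint D h -> \int[mu]_(x in D) normsq (h x) = 0 ->
  ae_eq mu D h (fun=> 0).
Proof.
move=> hh h0; have ih := csqint_normsq hh.
have i0 : (\int[mu]_(x in D) (EFin \o (fun x => normsq (h x))) x = 0)%E.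
  by rewrite -[LHS]fineK ?(integrable_fin_num mD ih) //; congr EFin.
have := @ae_eq_integral_abs _ _ _ mu D mD (EFin \o (fun x => normsq (h x)))
  (measurable_int mu ih).
move=> [+ _]; rewrite (eq_integral (EFin \o (fun x => normsq (h x)))); last first.
  by move=> x _ /=; rewrite ger0_norm // normsq_ge0.
move=> /(_ i0); apply: ae_sub => x hx Dx; apply: normsq_eq0.
by have := hx Dx; case.
Qed.

Lemma ae0_normsq h : csqint D h -> ae_eq mu D h (fun=> 0) ->
  \int[mu]_(x in D) normsq (h x) = 0.
Proof.
move=> hh e; rewrite /Rintegral (@ae_eq_integral _ _ _ mu D (cst 0%E)) ?integral0 //.
- exact: measurable_int (csqint_normsq hh).
- by apply: ae_sub e => x hx Dx; rewrite /= hx // normsq0.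
Qed.

Hypothesis fD : (mu D < +oo)%E.

Lemma csqint_integrable h : csqint D h -> cintegrable D h.
Proof. by move=> [h1 h2]; split; exact: sqint_integrable. Qed.

End ComplexIntegral.

(** * Completeness of the real L^2 space of a set of finite measure *)

Section RieszFischer.
Context {R : realType} {D : set (measurableTypeR R)}.
Hypothesis mD : measurable D.
Local Notation mu := (@lebesgue_measure R).
Hypothesis fD : (mu D < +oo)%E.
Implicit Types f : measurableTypeR R -> R.

Lemma sqintB f1 f2 : sqint D f1 -> sqint D f2 -> sqint D (fun x => f1 x - f2 x).
Proof.
move=> h1 h2; rewrite (_ : (fun x => _) = (fun x => -1 * f2 x + f1 x)).
  exact: sqint_lin.
by apply/funext => x; rewrite mulN1r addrC.
Qed.

Lemma limn_einf_le (u : (\bar R)^nat) (l : \bar R) :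
  (forall n, (u n <= l)%E) -> (limn_einf u <= l)%E.
Proof.
move=> ul; rewrite limn_einf_lim; apply: lime_le; first exact: is_cvg_einfs.
apply: nearW => n; apply: le_trans (ul n); apply: ereal_inf_lbound.
by exists n => //=.
Qed.

(** A subsequence [G] with steps of norm below 2^-k is taken. The sum of its absolute steps has
    finite integral, so [G] converges almost everywhere, and Fatou's lemma bounds the distance of
    [g n] to the limit. *)
Lemma sqint_complete (g : nat -> measurableTypeR R -> R) : (forall n, sqint D (g n)) ->
  (forall e, 0 < e -> exists N, forall m n, (N <= m)%N -> (N <= n)%N ->
     \int[mu]_(x in D) ((g m x - g n x) ^+ 2) < e) ->
  exists h, sqint D h /\ forall e, 0 < e -> exists N, forall n, (N <= n)%N ->
     \int[mu]_(x in D) ((g n x - h x) ^+ 2) <= e.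
Proof.
move=> hg cauchy.
pose q : R := 2^-1.
have qk0 k : 0 < q ^+ k by rewrite exprn_gt0 // invr_gt0.
have [Nk hN] : exists Nk : nat -> nat, forall k m n, (Nk k <= m)%N -> (Nk k <= n)%N ->
    \int[mu]_(x in D) ((g m x - g n x) ^+ 2) < (q ^+ k) ^+ 2.
  have h k := cid (cauchy _ (exprn_gt0 2 (qk0 k))).
  by exists (fun k => projT1 (h k)) => k; exact: projT2 (h k).
pose phi := fix phi k := if k is k'.+1 then maxn (phi k') (Nk k) else Nk 0%N.
have phi_ge k : (Nk k <= phi k)%N by case: k => //= k; exact: leq_maxr.
have phi_mono k m : (k <= m)%N -> (phi k <= phi m)%N.
  move=> /subnK <-; elim: (m - k)%N => // n IH.
  by apply: leq_trans IH _; rewrite addSn /=; exact: leq_maxl.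
pose G k := g (phi k).
have hG k m n : (k <= m)%N -> (k <= n)%N ->
    \int[mu]_(x in D) ((G m x - G n x) ^+ 2) < (q ^+ k) ^+ 2.
  by move=> km kn; apply: hN; apply: leq_trans (phi_ge k) (phi_mono _ _ _).
set M := fine (mu D); have M0 : 0 <= M by rewrite fine_ge0.
pose d k x := `|G k.+1 x - G k x|.
have sqd k : sqint D (d k).
  have [m1 i1] := sqintB (hg (phi k.+1)) (hg (phi k)); split.
    by apply: measurableT_comp => //; exact: measurable_normr.
  by apply: eq_integrable_fin i1 => // x _ /=; rewrite /d real_normK // num_real.
have id k : mu.-integrable D (EFin \o d k) by exact: sqint_integrable.
(* Cauchy-Schwarz gives the factor sqrt M; [M + 1] dominates it and avoids the root. *)
have intd k : \int[mu]_(x in D) d k x <= (M + 1) * q ^+ k.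
  have := Rintegral_cs mD fD (sqd k); rewrite -/M.
  have -> : \int[mu]_(x in D) (d k x ^+ 2) =
      \int[mu]_(x in D) ((G k.+1 x - G k x) ^+ 2).
    by apply: eq_Rintegral => x _; rewrite real_normK // num_real.
  have := hG k k.+1 k (leqnSn _) (leqnn _).
  set I := Rintegral _ _ _; set Q := Rintegral _ _ _ => h1 h2.
  have Q0 : 0 <= Q by apply: Rintegral_ge0 => x _; exact: normr_ge0.
  rewrite leNgt; apply/negP => h3.
  have qk := qk0 k.
  have h4 : ((M + 1) * q ^+ k) ^+ 2 < Q ^+ 2.
    by rewrite ltr_pXn2r ?nnegrE // mulr_ge0 // ?ltW //; lra.
  have h5 : M * I <= M * (q ^+ k) ^+ 2 by apply: ler_wpM2l => //; exact: ltW.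
  rewrite exprMn in h4.
  have h6 : M * (q ^+ k) ^+ 2 <= (M + 1) ^+ 2 * (q ^+ k) ^+ 2.
    by apply: ler_wpM2r; [exact: sqr_ge0 | have := sqr_ge0 M; lra].
  lra.
pose F k x := (d k x)%:E.
have F0 k x : (0 <= F k x)%E by rewrite lee_fin normr_ge0.
have mF k : measurable_fun D (F k) by exact: measurable_int (id k).
pose S x := (\sum_(k <oo) F k x)%E.
have intS : (\int[mu]_(x in D) S x <= (2 * (M + 1))%:E)%E.
  rewrite (integral_nneseries mu mD) //; apply: lime_le.
    by apply: is_cvg_nneseries => n _ _; apply: integral_ge0.
  apply: nearW => n.
  have -> : (\sum_(0 <= i < n) \int[mu]_(x in D) F i x)%E =
      (\sum_(0 <= i < n) \int[mu]_(x in D) d i x)%:E.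
    rewrite -sumEFin; apply: eq_bigr => k _; rewrite fineK //.
    exact: integrable_fin_num (id k).
  rewrite lee_fin.
  have sumq : \sum_(0 <= i < n) (M + 1) * q ^+ i = (M + 1) * (2 - 2 * q ^+ n).
    elim: n => [|n IH]; first by rewrite big_geq // expr0; ring.
    by rewrite big_nat_recr //= IH exprS /q; field.
  apply: (@le_trans _ _ (\sum_(0 <= i < n) (M + 1) * q ^+ i)).
    by apply: ler_sum => k _; exact: intd.
  rewrite sumq mulrC; apply: ler_wpM2r; [lra | have := qk0 n; lra].
have iS : mu.-integrable D S.
  apply/integrableP; split; first by apply: ge0_emeasurable_sum => //.
  rewrite (eq_integral S); first exact: le_lt_trans intS (ltry _).
  by move=> x _; rewrite gee0_abs // nneseries_ge0.
have good : {ae mu, forall x, D x -> cvgn (fun k => G k x)}.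
  apply: ae_sub (integrable_ae mD iS) => x h Dx; have {h} := h Dx => Sfin.
  have cs : cvgn (series (fun k => G k.+1 x - G k x)).
    apply: normed_cvg; change (cvgn (series (fun k => d k x))).
    apply: nondecreasing_is_cvgn.
      by apply/nondecreasing_seqP => n; rewrite !seriesEnat /= big_nat_recr //= lerDl normr_ge0.
    exists (fine (S x)) => _ [n _ <-].
    rewrite seriesEnat /= -lee_fin fineK // -sumEFin.
    by rewrite /S; apply: nneseries_lim_ge => k _ _; exact: F0.
  have -> : (fun k => G k x) = (fun k => G 0%N x + series (fun k => G k.+1 x - G k x) k).
    apply/funext => k; rewrite seriesEnat /= telescope_sumr //.
    by rewrite addrC subrK.
  by apply: is_cvgD => //; exact: is_cvg_cst.
(* An upper limit is measurable on all of [D], while the limit itself is known to exist only almost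
   everywhere. *)
pose h x := fine (limn_esup (fun k => (G k x)%:E)).
have mh : measurable_fun D h.
  apply: (@measurableT_comp _ _ _ _ _ _ fine); first exact: fine_measurable.
  apply: measurable_fun_limn_esup => k; apply/measurable_EFinP; exact: (hg _).1.
have hlim x : cvgn (fun k => G k x) -> (fun k => G k x) @ \oo --> h x.
  move=> /cvg_ex [l hl].
  have /cvg_limn_einf_sup [_ e] : (fun k => (G k x)%:E) @ \oo --> l%:E.
    by apply: cvg_EFin => //; exact: nearW.
  by rewrite /h e.
(* The integral is taken in the extended reals, since integrability of the square of [g n - h] is
   only deduced from this bound. *)
have fatou_bound n k e : (forall m, \int[mu]_(x in D) ((g n x - G (m + k)%N x) ^+ 2) <= e) ->
    (\int[mu]_(x in D) ((g n x - h x) ^+ 2)%:E <= e%:E)%E.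
  move=> hb.
  have mB m : measurable_fun D (fun x => ((g n x - G (m + k)%N x) ^+ 2)%:E).
    by apply/measurable_EFinP; exact: measurable_funX (sqintB (hg n) (hg (phi (m + k)))).1.
  have mBh : measurable_fun D (fun x => ((g n x - h x) ^+ 2)%:E).
    apply/measurable_EFinP; apply: measurable_funX; apply: measurable_funB => //.
    exact: (hg n).1.
  have B0 m x : D x -> (0 <= ((g n x - G (m + k)%N x) ^+ 2)%:E)%E by rewrite lee_fin sqr_ge0.
  have mlim : measurable_fun D (fun x => limn_einf (fun m => ((g n x - G (m + k)%N x) ^+ 2)%:E)).
    rewrite /limn_einf; apply: measurableT_comp => //.
    by apply: measurable_fun_limn_esup => m; exact: measurableT_comp.
  rewrite (@ge0_ae_eq_integral _ _ _ mu D _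
    (fun x => limn_einf (fun m => ((g n x - G (m + k)%N x) ^+ 2)%:E))) //.
  - apply: le_trans (fatou mu mD mB B0) _; apply: limn_einf_le => m.
    have ib := (sqintB (hg n) (hg (phi (m + k)))).2.
    by rewrite -[leLHS]fineK ?lee_fin ?hb //; exact: integrable_fin_num ib.
  - by move=> x _; rewrite lee_fin sqr_ge0.
  - move=> x _; rewrite limn_einf_lim; apply: lime_ge; first exact: is_cvg_einfs.
    by apply: nearW => i; apply: le_ereal_inf_tmp => _ [m _ <-]; rewrite lee_fin sqr_ge0.
  - apply: ae_sub good => x hx Dx; have {}hx := hlim x (hx Dx).
    rewrite -(cvg_shiftn k) in hx.
    have /cvg_limn_einf_sup [-> _] // : (fun m => ((g n x - G (m + k)%N x) ^+ 2)%:E) @ \oo -->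
        ((g n x - h x) ^+ 2)%:E.
    apply: cvg_EFin; first exact: nearW.
    rewrite /comp /= !expr2; apply: cvgM; apply: cvgB => //; exact: cvg_cst.
have bound k n : (phi k <= n)%N ->
    (\int[mu]_(x in D) ((g n x - h x) ^+ 2)%:E <= ((q ^+ k) ^+ 2)%:E)%E.
  move=> kn.
  apply: (fatou_bound n k) => m; apply/ltW/hN; first exact: leq_trans (phi_ge k) kn.
  by apply: leq_trans (phi_ge k) (phi_mono _ _ _); exact: leq_addl.
have sqB n k : (phi k <= n)%N -> sqint D (fun x => g n x - h x).
  move=> kn; split; first by apply: measurable_funB => //; exact: (hg n).1.
  apply/integrableP; split.
    apply/measurable_EFinP; apply: measurable_funX; apply: measurable_funB => //.
    exact: (hg n).1.
  rewrite (eq_integral (fun x => ((g n x - h x) ^+ 2)%:E)).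
    exact: le_lt_trans (bound k n kn) (ltry _).
  by move=> x _ /=; rewrite ger0_norm ?sqr_ge0.
exists h; split.
  rewrite (_ : h = (fun x => g (phi 0%N) x - (g (phi 0%N) x - h x))).
    by apply: sqintB => //; exact: (sqB _ 0%N).
  by apply/funext => x; rewrite opprB addrC subrK.
move=> e e0; have [k hk] : exists k, (q ^+ k) ^+ 2 <= e.
  have [N hN'] := invS_lt e0; exists N; apply: le_trans (ltW (hN' N (leqnn _))).
  have qN : q ^+ N <= N.+1%:R^-1.
    rewrite /q exprVn lef_pV2 ?posrE ?exprn_gt0 // -natrX ler_nat.
    exact: ltn_expl.
  apply: le_trans qN; rewrite expr2 -[leRHS]mul1r; apply: ler_wpM2r; first exact: ltW.
  by rewrite /q exprn_ile1 // ?invr_ge0 // invf_le1 // ler1n.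
exists (phi k) => n kn; apply: le_trans hk.
rewrite -lee_fin fineK; first exact: bound.
exact: integrable_fin_num (sqB n k kn).2.
Qed.

End RieszFischer.

(** * The space L^2 of the graph *)

Section L2Space.
Context {R : realType} {G : quantum_graph R}.
Local Notation mu := (@lebesgue_measure R).
Implicit Types (f g u w : field G) (e : edge G).

(** The same set, retyped so that the measurable structure of the line is found. *)
Definition mdom e : set (measurableTypeR R) := dom e.

Lemma measurable_mdom e : measurable (mdom e).
Proof. exact: measurable_itv. Qed.

Lemma mdom_measure e : mu (mdom e) = (edge_len e)%:E.
Proof.
by rewrite /mdom /dom lebesgue_measure_itv /= lte_fin edge_len_gt0 oppr0 adde0.
Qed.

Lemma mdom_finite e : (mu (mdom e) < +oo)%E.
Proof. by rewrite mdom_measure ltry. Qed.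

Lemma L2P f : L2 f <-> forall e, csqint (mdom e) (f e).
Proof.
split=> h e; first by apply/(csqintP (measurable_mdom e)); exact: h.
by apply/(csqintP (measurable_mdom e)).
Qed.

Lemma L2_lin (c : R[i]) f g : L2 f -> L2 g -> L2 (c *: f + g).
Proof.
move=> /L2P hf /L2P hg; apply/L2P => e.
exact: (csqint_lin (measurable_mdom e) c (hf e) (hg e)).
Qed.

Lemma L2_0 : L2 (0 : field G).
Proof.
apply/L2P => e; split; exact: (sqint_cst (measurable_mdom e) (mdom_finite e) 0).
Qed.

Definition L2pred : {pred field G} := fun f => `[< L2 f >].

Lemma L2pred_submod : submod_closed L2pred.
Proof.
split; first by apply/asboolP; exact: L2_0.
by move=> c f g /asboolP hf /asboolP hg; apply/asboolP; exact: L2_lin.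
Qed.

HB.instance Definition _ := GRing.isSubmodClosed.Build R[i] (field G) L2pred L2pred_submod.

Record L2space := L2Space { L2val :> field G; L2valP : L2val \in L2pred }.

HB.instance Definition _ := [isSub for L2val].
HB.instance Definition _ := [Choice of L2space by <:].
HB.instance Definition _ := [SubChoice_isSubLmodule of L2space by <:].

Definition toL2 f (hf : L2 f) : L2space := L2Space (asboolT hf).

Lemma L2spaceP (u : L2space) : L2 u.
Proof. exact/asboolP/L2valP. Qed.

Lemma inner_edge_int f g e : L2 f -> L2 g ->
  cintegrable (mdom e) (fun x => f e x * conjc (g e x)).
Proof.
by move=> /L2P hf /L2P hg; apply: csqintMJ (measurable_mdom e) _ _ (hf e) (hg e).
Qed.

Lemma inner_lin c f g h : L2 f -> L2 g -> L2 h ->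
  inner (c *: f + g) h = c * inner f h + inner g h.
Proof.
move=> hf hg hh; rewrite /inner mulr_sumr -big_split; apply: eq_bigr => e _ /=.
rewrite -[RHS](Cintegral_lin (measurable_mdom e)); try exact: inner_edge_int.
by apply: eq_Cintegral => x _; rewrite mulrDl mulrA.
Qed.

Lemma inner_conj f g : L2 f -> L2 g -> inner f g = conjc (inner g f).
Proof.
move=> hf hg; rewrite /inner rmorph_sum; apply: eq_bigr => e _ /=.
rewrite -[RHS](CintegralJ (measurable_mdom e)); last exact: inner_edge_int.
by apply: eq_Cintegral => x _; rewrite conjcM conjcK mulrC.
Qed.

Lemma inner_self f : L2 f ->
  inner f f = (\sum_e \int[mu]_(x in dom e) normsq (f e x))%:C.
Proof.
move=> /L2P hf; rewrite /inner rmorph_sum; apply: eq_bigr => e _ /=.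
exact: (Cintegral_normsq (measurable_mdom e) (hf e)).
Qed.

Definition L2inner (u v : L2space) : R[i] := inner u v.

Lemma L2val_lin c (u v : L2space) : L2val (c *: u + v) = c *: L2val u + L2val v.
Proof. by []. Qed.

Lemma L2inner_lin c (u v w : L2space) : L2inner (c *: u + v) w = c * L2inner u w + L2inner v w.
Proof.
rewrite /L2inner L2val_lin.
exact: (inner_lin c (L2spaceP u) (L2spaceP v) (L2spaceP w)).
Qed.

Lemma L2inner_conj (u v : L2space) : L2inner u v = conjc (L2inner v u).
Proof. exact: (inner_conj (L2spaceP u) (L2spaceP v)). Qed.

Lemma L2inner_ge0 (u : L2space) : 0 <= Rep (L2inner u u).
Proof.
rewrite /L2inner (inner_self (L2spaceP u)) RepC; apply: sumr_ge0 => e _.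
by apply: Rintegral_ge0 => x _; exact: normsq_ge0.
Qed.

Definition ipL2 : semiInner L2space :=
  SemiInner L2inner_lin L2inner_conj L2inner_ge0.

Lemma sq_ipL2 (u : L2space) : sq ipL2 u = \sum_e \int[mu]_(x in dom e) normsq (L2val u e x).
Proof. by rewrite /sq /= /L2inner (inner_self (L2spaceP u)). Qed.

Lemma L2norm_sq (u : L2space) : L2norm u = Num.sqrt (sq ipL2 u).
Proof. by rewrite sq_ipL2. Qed.

Lemma null_sq (u : L2space) : null u <-> sq ipL2 u = 0.
Proof.
have hu := (L2P _).1 (L2spaceP u).
rewrite sq_ipL2; split => [h|h e].
  apply: big1 => e _; exact: (ae0_normsq (measurable_mdom e) (hu e) (h e)).
apply: (normsq_ae0 (measurable_mdom e) (hu e)).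
have /eqP := h; rewrite psumr_eq0; last first.
  by move=> e' _; apply: Rintegral_ge0 => x _; exact: normsq_ge0.
by move=> /allP /(_ e); rewrite mem_index_enum => /(_ isT) /eqP.
Qed.

Lemma aeeq_null f g : aeeq f g <-> null (f - g).
Proof.
split=> h e; apply: ae_sub (h e) => x hx Dx.
  by rewrite /= !fctE hx // subrr.
by apply/eqP; rewrite -subr_eq0; apply/eqP; exact: hx.
Qed.

Lemma aeeq_sq (u v : L2space) : aeeq u v <-> sq ipL2 (u - v) = 0.
Proof. by rewrite aeeq_null; exact: (null_sq (u - v)). Qed.

Lemma aeeq_refl f : aeeq f f.
Proof. by apply/aeeq_null => e; rewrite subrr; apply: aeW. Qed.

Theorem L2_complete : seminorm_complete ipL2.
Proof.
move=> u cauchy.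
have hu n := (L2P _).1 (L2spaceP (u n)).
have le_sq (w : L2space) e : \int[mu]_(x in dom e) normsq (L2val w e x) <= sq ipL2 w.
  rewrite sq_ipL2 (bigD1 e) //= lerDl; apply: sumr_ge0 => e' _.
  by apply: Rintegral_ge0 => x _; exact: normsq_ge0.
have part (p : R[i] -> R) (pB : forall x y, p (x - y) = p x - p y)
    (ple : forall z, p z ^+ 2 <= normsq z)
    (psq : forall n e, sqint (mdom e) (fun x => p (L2val (u n) e x))) e :
    exists h, sqint (mdom e) h /\ forall d, 0 < d -> exists N, forall n, (N <= n)%N ->
      \int[mu]_(x in mdom e) ((p (L2val (u n) e x) - h x) ^+ 2) <= d.
  apply: (sqint_complete (measurable_mdom e) (mdom_finite e)) => // d d0.
  have [N hN] := cauchy d d0; exists N => m n Nm Nn.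
  apply: le_lt_trans (hN m n Nm Nn); apply: le_trans (le_sq _ e).
  have sB := sqintB (measurable_mdom e) (psq m e) (psq n e).
  apply: (le_Rintegral (measurable_mdom e) sB.2).
    exact: (csqint_normsq (measurable_mdom e) ((L2P _).1 (L2spaceP (u m - u n)) e)).
  by move=> x _ /=; rewrite -pB; exact: ple.
have RepB (x y : R[i]) : Rep (x - y) = Rep x - Rep y by rewrite RepD RepN.
have ImpB (x y : R[i]) : Imp (x - y) = Imp x - Imp y by rewrite ImpD ImpN.
have hre := fun e => cid (part _ RepB (@normsq_Rep R) (fun n e => (hu n e).1) e).
have him := fun e => cid (part _ ImpB (@normsq_Imp R) (fun n e => (hu n e).2) e).
pose f : field G := fun e x => projT1 (hre e) x +i* projT1 (him e) x.
have Lf : L2 f.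
  by apply/L2P => e; split; [exact: (projT2 (hre e)).1 | exact: (projT2 (him e)).1].
exists (toL2 Lf) => d d0.
(* The total error is the number of edges times d / (2 c); the [+ 1] keeps [c] positive on a graph
   without edges. *)
pose c : R := (#|edge G|%:R + 1).
have c0 : 0 < c by rewrite ltr_wpDl.
have d4 : 0 < d / (4 * c) by rewrite divr_gt0 // mulr_gt0.
have [N hN] : exists N, forall e n, (N <= n)%N ->
    \int[mu]_(x in dom e) normsq (L2val (u n - toL2 Lf) e x) <= d / (2 * c).
  have h e := (projT2 (hre e)).2 _ d4; have h' e := (projT2 (him e)).2 _ d4.
  exists (\max_e maxn (projT1 (cid (h e))) (projT1 (cid (h' e)))) => e n.
  move=> /(leq_trans (leq_bigmax (F := fun e => maxn _ _) e)).
  rewrite geq_max => /andP[/(projT2 (cid (h e))) h1 /(projT2 (cid (h' e))) h2].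
  have s1 := sqintB (measurable_mdom e) (hu n e).1 (projT2 (hre e)).1.
  have s2 := sqintB (measurable_mdom e) (hu n e).2 (projT2 (him e)).1.
  have -> : \int[mu]_(x in dom e) normsq (L2val (u n - toL2 Lf) e x) =
     \int[mu]_(x in mdom e) ((Rep (L2val (u n) e x) - projT1 (hre e) x) ^+ 2 +
                             (Imp (L2val (u n) e x) - projT1 (him e) x) ^+ 2).
    by apply: eq_Rintegral => x _; rewrite /normsq RepB ImpB.
  rewrite RintegralD; [|exact: measurable_mdom|exact: s1.2|exact: s2.2].
  have -> : d / (2 * c) = d / (4 * c) + d / (4 * c) by field; rewrite gt_eqF.
  exact: lerD.
exists N => n Nn; rewrite sq_ipL2.
apply: (@le_lt_trans _ _ (\sum_(e : edge G) d / (2 * c))).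
  by apply: ler_sum => e _; exact: hN.
rewrite sumr_const -[_ *+ _]mulr_natl.
have -> : #|edge G|%:R * (d / (2 * c)) = (#|edge G|%:R * d) / (2 * c) by rewrite mulrA.
rewrite ltr_pdivrMr; last by rewrite mulr_gt0.
have n0 : 0 <= (#|edge G|%:R : R) by [].
rewrite /c; nra.
Qed.

End L2Space.

(** * Absolutely continuous functions *)

(* [lra] fails on integrals that are not generalized to variables. *)
Ltac real_lra :=
  repeat match goal with
  | H : context [@integrable.body] |- _ => clear H
  | H : context [@measurable_fun] |- _ => clear H
  | H : sqint _ _ |- _ => clear H
  end;
  repeat match goal with
  | H : context [@Rintegral] |- _ => revert H
  end;
  repeat (let I := fresh "I" in move: (Rintegral _ _ _) => I);
  intros; lra.

Section AbsolutelyContinuous.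
Context {R : realType}.
Local Notation mu := (@lebesgue_measure R).
Implicit Types u v w : measurableTypeR R -> R.
Implicit Types a b l x y : R.

Definition cint a b : set (measurableTypeR R) := `[a, b]%classic.

Lemma measurable_cint a b : measurable (cint a b).
Proof. exact: measurable_itv. Qed.

Lemma cint_measure a b : a <= b -> fine (mu (cint a b)) = b - a.
Proof.
rewrite le_eqVlt => /predU1P[->|ab]; rewrite /cint lebesgue_measure_itv /= lte_fin.
  by rewrite ltxx /= subrr.
by rewrite ab.
Qed.

Lemma cint_finite a b : (mu (cint a b) < +oo)%E.
Proof.
by rewrite /cint lebesgue_measure_itv /=; case: ifP => _; rewrite -?EFinB ltry.
Qed.

Lemma cint_sub a b x y : a <= x -> y <= b -> cint x y `<=` cint a b.
Proof.
move=> ax yb t; rewrite /cint /= !in_itv /= => /andP[xt ty].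
by rewrite (le_trans ax xt) (le_trans ty yb).
Qed.

Lemma integrable_cintS a b x y u : a <= x -> y <= b ->
  mu.-integrable (cint a b) (EFin \o u) -> mu.-integrable (cint x y) (EFin \o u).
Proof.
move=> ax yb; apply: integrableS; [exact: measurable_cint|exact: measurable_cint|].
exact: cint_sub.
Qed.

Lemma sqint_cintS a b x y u : a <= x -> y <= b ->
  sqint (cint a b) u -> sqint (cint x y) u.
Proof.
move=> ax yb [mf i]; split; last exact: integrable_cintS i.
exact: (measurable_funS (measurable_cint a b) (cint_sub ax yb) mf).
Qed.

Lemma sqint_cint_integrable a b u : sqint (cint a b) u ->
  mu.-integrable (cint a b) (EFin \o u).
Proof. exact: (sqint_integrable (measurable_cint a b) (cint_finite a b)). Qed.

Lemma cint_chasles a x y u : a <= x -> x <= y ->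
  mu.-integrable (cint a y) (EFin \o u) ->
  \int[mu]_(t in cint a y) u t - \int[mu]_(t in cint a x) u t =
  \int[mu]_(t in cint x y) u t.
Proof.
move=> ax xy i; rewrite /cint Rintegral_itvB //.
rewrite Rintegral_itv_obnd_cbnd //.
apply: integrableS i; [exact: measurable_itv|exact: measurable_itv|].
move=> t; rewrite /cint /= !in_itv /= => /andP[xt ->]; rewrite andbT.
by rewrite (le_trans ax) // ltW.
Qed.

Lemma cint_set1 a u : \int[mu]_(t in cint a a) u t = 0.
Proof. by rewrite /cint set_itv1 Rintegral_set1. Qed.

Definition AC l u u' := sqint (cint 0 l) u' /\
  forall x, 0 <= x -> x <= l -> u x = u 0 + \int[mu]_(t in cint 0 x) u' t.

Section Fixed.
Context {l : R} (l0 : 0 <= l).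
Local Notation D := (cint 0 l).
Local Notation mD := (measurable_cint 0 l).
Local Notation fD := (cint_finite 0 l).

Lemma AC_diff u u' x y : AC l u u' -> 0 <= x -> x <= y -> y <= l ->
  u y - u x = \int[mu]_(t in cint x y) u' t.
Proof.
move=> [su hu] x0 xy yl.
rewrite (hu y) ?(le_trans x0) // (hu x) ?(le_trans xy) //.
rewrite -(cint_chasles x0 xy); first by ring.
by apply: integrable_cintS (sqint_cint_integrable su).
Qed.

Lemma AC_holder_loc u u' x y : AC l u u' -> 0 <= x -> x <= y -> y <= l ->
  (u y - u x) ^+ 2 <= (y - x) * \int[mu]_(t in cint x y) (u' t ^+ 2).
Proof.
move=> hu x0 xy yl; rewrite (AC_diff hu) // -(cint_measure xy).
apply: (Rintegral_cs (measurable_cint x y) (cint_finite x y)).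
exact: sqint_cintS hu.1.
Qed.

Lemma Rintegral_sqr_sub u x y : sqint D u -> 0 <= x -> x <= y -> y <= l ->
  \int[mu]_(t in cint x y) (u t ^+ 2) <= \int[mu]_(t in D) (u t ^+ 2).
Proof.
move=> su x0 xy yl; have i := su.2.
have h1 := cint_chasles (le_trans x0 xy) yl i.
have i' : mu.-integrable (cint 0 y) (EFin \o (fun t => u t ^+ 2)) := integrable_cintS (lexx 0) yl i.
have h2 := cint_chasles x0 xy i'.
have p1 : 0 <= \int[mu]_(t in cint y l) (u t ^+ 2) by apply: Rintegral_ge0 => t _; exact: sqr_ge0.
have p2 : 0 <= \int[mu]_(t in cint 0 x) (u t ^+ 2) by apply: Rintegral_ge0 => t _; exact: sqr_ge0.
real_lra.
Qed.

Lemma AC_holder u u' x y : AC l u u' -> 0 <= x -> x <= l -> 0 <= y -> y <= l ->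
  (u y - u x) ^+ 2 <= l * \int[mu]_(t in D) (u' t ^+ 2).
Proof.
move=> hu; wlog xy : x y / x <= y.
  move=> H x0 xl y0 yl; have [xy|/ltW yx] := leP x y; first exact: H.
  by rewrite -sqrrN opprB; exact: H.
move=> x0 xl y0 yl; apply: le_trans (AC_holder_loc hu x0 xy yl) _.
apply: ler_pM; rewrite ?subr_ge0 //; [|real_lra|exact: Rintegral_sqr_sub hu.1 _ _ _].
by apply: Rintegral_ge0 => t _; exact: sqr_ge0.
Qed.

Lemma AC_lin (c : R) u u' v v' : AC l u u' -> AC l v v' ->
  AC l (fun x => c * u x + v x) (fun x => c * u' x + v' x).
Proof.
move=> [su hu] [sv hv]; split; first exact: (sqint_lin mD).
move=> x x0 xl; rewrite (hu x) // (hv x) //.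
have iu := integrable_cintS (lexx 0) xl (sqint_cint_integrable su).
have iv := integrable_cintS (lexx 0) xl (sqint_cint_integrable sv).
by rewrite (Rintegral_lin (measurable_cint 0 x) c iu iv); ring.
Qed.

Lemma AC_measurable u u' : AC l u u' -> measurable_fun D u.
Proof.
move=> [su hu].
have c := parameterized_integral_continuous l0 (sqint_cint_integrable su).
have m : measurable_fun D (fun x => u 0 + parameterized_integral mu 0 x u').
  apply: measurable_funD; first exact: measurable_cst.
  exact: (subspace_continuous_measurable_fun mD c).
apply: eq_measurable_fun m => x; rewrite inE /cint /= in_itv /= => /andP[x0 xl].
by rewrite [RHS](hu x x0 xl).
Qed.

Lemma AC_sqint u u' : AC l u u' -> sqint D u.
Proof.
move=> hu; have mu' := AC_measurable hu; split => //.
pose C := 2 * u 0 ^+ 2 + 2 * (l * \int[mu]_(t in D) (u' t ^+ 2)).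
apply: (le_integrable mD _ _ (integrable_cst_fin mD fD C)).
  by apply/measurable_EFinP; exact: measurable_funX.
move=> x; rewrite /cint /= in_itv /= => /andP[x0 xl].
have h := AC_holder hu (lexx 0) l0 x0 xl.
rewrite lee_fin ger0_norm ?sqr_ge0 //; apply: le_trans (ler_norm _).
by rewrite /C; have := sqr_ge0 (u x - 2 * u 0); real_lra.
Qed.

(* Summing over n equal intervals bounds [|E l - E 0|] by [C l (M l - M 0) / n]. *)
Lemma telescope_eq (E M : R -> R) (C : R) :
  (forall x y, 0 <= x -> x <= y -> y <= l ->
     `|E y - E x| <= C * (y - x) * (M y - M x)) -> E l = E 0.
Proof.
move=> h; apply/eqP; rewrite -subr_eq0 -normr_le0; apply/ler_addgt0Pr => e e0; rewrite add0r.
set K := C * l * (M l - M 0).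
have [N hN] : exists N : nat, `|K| < N.+1%:R * e.
  exists (Num.truncn (`|K| / e)); rewrite -ltr_pdivrMr //.
  by apply: truncnS_gt; rewrite divr_ge0 // ltW.
set n := N.+1 in hN; pose x (i : nat) : R := i%:R * (l / n%:R).
have n0 : 0 < n%:R :> R by rewrite ltr0n.
have s0 : 0 <= l / n%:R by rewrite divr_ge0 // ltW.
have xS i : x i.+1 - x i = l / n%:R by rewrite /x -natr1; ring.
have xn : x n = l by rewrite /x; field; rewrite gt_eqF.
have key m : (m <= n)%N -> `|E (x m) - E (x 0%N)| <= C * (l / n%:R) * (M (x m) - M (x 0%N)).
  elim: m => [|m IH] mn; first by rewrite !subrr normr0 mulr0.
  have := IH (ltnW mn).
  have x0 : 0 <= x m by rewrite mulr_ge0.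
  have xx : x m <= x m.+1 by have := xS m; real_lra.
  have xl : x m.+1 <= l by rewrite -xn /x ler_wpM2r // ler_nat.
  have := h _ _ x0 xx xl; rewrite xS => h1 h2.
  have -> : E (x m.+1) - E (x 0%N) = (E (x m.+1) - E (x m)) + (E (x m) - E (x 0%N)) by ring.
  by apply: le_trans (ler_normD _ _) _; real_lra.
have := key n (leqnn _); rewrite xn {1}/x mul0r {1}/x mul0r => h1.
apply: le_trans h1 _.
have -> : C * (l / n%:R) * (M l - M 0) = K / n%:R by rewrite /K; ring.
rewrite ler_pdivrMr // mulrC; apply: le_trans (ler_norm K) _.
exact: ltW.
Qed.

(** No derivative of [u ^+ 2] is taken. The increment of [E] over [x, y] is the integral of u'(t) (u
    y + u x - 2 u t), and the Hölder estimate bounds its absolute value by 5/2 (y - x) times the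
    integral of u'^2 over [x, y]: an increment of [M], as [telescope_eq] requires. *)
Lemma AC_sqr u u' : AC l u u' ->
  2 * \int[mu]_(t in D) (u' t * u t) = u l ^+ 2 - u 0 ^+ 2.
Proof.
move=> hu; have su := AC_sqint hu; have su' := hu.1.
have ip : mu.-integrable D (EFin \o (fun t => u' t * u t)) := sqintM mD su' su.
pose E x := u x ^+ 2 - 2 * \int[mu]_(t in cint 0 x) (u' t * u t).
pose M x := \int[mu]_(t in cint 0 x) (u' t ^+ 2).
have : E l = E 0.
  apply: (@telescope_eq E M (5 / 2)) => x y x0 xy yl.
  have xl := le_trans xy yl; have y0 := le_trans x0 xy.
  have i1 : mu.-integrable (cint 0 y) (EFin \o (fun t => u' t * u t)) :=
    integrable_cintS (lexx 0) yl ip.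
  have i2 : mu.-integrable (cint 0 y) (EFin \o (fun t => u' t ^+ 2)) :=
    integrable_cintS (lexx 0) yl su'.2.
  have c1 := cint_chasles x0 xy i1; have c2 := cint_chasles x0 xy i2.
  have j1 := integrable_cintS x0 (lexx y) i1; have j2 := integrable_cintS x0 (lexx y) i2.
  have ju := integrable_cintS x0 yl (sqint_cint_integrable su').
  have eE : E y - E x = \int[mu]_(t in cint x y) ((u y + u x) * u' t + -2 * (u' t * u t)).
    have mxy := measurable_cint x y.
    rewrite (@Rintegral_lin _ _ mxy (u y + u x) u' (fun t => -2 * (u' t * u t))) //; last first.
      by apply: eq_integrable_fin (integrableZl mxy (-2) j1).
    rewrite RintegralZl; [|exact: mxy|exact: j1].
    by rewrite -c1 -(AC_diff hu) // /E; ring.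
  rewrite /M c2 eE; set m := \int[mu]_(t in cint x y) (u' t ^+ 2).
  have m0 : 0 <= m by apply: Rintegral_ge0 => t _; exact: sqr_ge0.
  have [<-|xney] := eqVneq x y.
    by rewrite cint_set1 normr0 subrr mulr0 mul0r.
  have h0 : 0 < y - x by rewrite subr_gt0 lt_neqAle xney.
  set hh := y - x in h0 *.
  have mxy := measurable_cint x y.
  have bound t : cint x y t ->
      `|(u y + u x) * u' t + -2 * (u' t * u t)| <= hh / 2 * u' t ^+ 2 + 2 * m.
    rewrite /cint /= in_itv /= => /andP[xt ty].
    have b1 := AC_holder_loc hu (le_trans x0 xt) ty yl.
    have b2 := AC_holder_loc hu x0 xt (le_trans ty yl).
    have j3 : mu.-integrable (cint x y) (EFin \o (fun t => u' t ^+ 2)) by [].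
    have q1 := cint_chasles xt ty j3.
    have p1 : 0 <= \int[mu]_(t in cint t y) (u' t ^+ 2) by apply: Rintegral_ge0 => ? _; exact: sqr_ge0.
    have p2 : 0 <= \int[mu]_(t in cint x t) (u' t ^+ 2) by apply: Rintegral_ge0 => ? _; exact: sqr_ge0.
    have b1' : (u y - u t) ^+ 2 <= hh * m.
      apply: (le_trans b1); apply: ler_pM;
        [by rewrite subr_ge0 | exact: p1 | by rewrite /hh; real_lra | by rewrite /m; real_lra].
    have b2' : (u t - u x) ^+ 2 <= hh * m.
      apply: (le_trans b2); apply: ler_pM;
        [by rewrite subr_ge0 | exact: p2 | by rewrite /hh; real_lra | by rewrite /m; real_lra].
    set r := u y + u x - 2 * u t.
    have -> : (u y + u x) * u' t + -2 * (u' t * u t) = u' t * r by rewrite /r; ring.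
    have r2 : r ^+ 2 <= 4 * (hh * m).
      rewrite /r; have := sqr_ge0 ((u y - u t) + (u t - u x)); real_lra.
    rewrite ler_norml; apply/andP; split; rewrite -subr_ge0 -(pmulr_rge0 _ h0).
      by have := sqr_ge0 (hh * u' t + r); real_lra.
    by have := sqr_ge0 (hh * u' t - r); real_lra.
  have ir : mu.-integrable (cint x y) (EFin \o (fun t => (u y + u x) * u' t + -2 * (u' t * u t))).
    by apply: (integrable_lin mxy) => //; apply: eq_integrable_fin (integrableZl mxy (-2) j1).
  apply: le_trans (le_normr_Rintegral mxy ir) _.
  have ic : mu.-integrable (cint x y) (EFin \o (fun=> 2 * m)).
    exact: (integrable_cst_fin mxy (cint_finite x y)).
  apply: (@le_trans _ _ (\int[mu]_(t in cint x y) (hh / 2 * u' t ^+ 2 + 2 * m))).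
    apply: (le_Rintegral mxy) => //; first exact: (integrable_norm ir).
    exact: (integrable_lin mxy).
  rewrite (@Rintegral_lin _ _ mxy (hh / 2) (fun t => u' t ^+ 2) (fun=> 2 * m)) //.
  by rewrite Rintegral_cst // cint_measure // -/hh -/m; real_lra.
rewrite /E cint_set1 mulr0 subr0; real_lra.
Qed.

(** Polarization: [AC_sqr] for the sum, minus [AC_sqr] for each summand. *)
Lemma AC_parts u u' v v' : AC l u u' -> AC l v v' ->
  \int[mu]_(t in D) (u' t * v t) + \int[mu]_(t in D) (u t * v' t) =
  u l * v l - u 0 * v 0.
Proof.
move=> hu hv; have h := AC_sqr (AC_lin 1 hu hv).
have h1 := AC_sqr hu; have h2 := AC_sqr hv.
have su := AC_sqint hu; have sv := AC_sqint hv.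
have i1 := sqintM mD hu.1 su; have i2 := sqintM mD hu.1 sv.
have i3 := sqintM mD su hv.1; have i4 := sqintM mD hv.1 sv.
have e : \int[mu]_(t in D) ((1 * u' t + v' t) * (1 * u t + v t)) =
   \int[mu]_(t in D) (1 * (u' t * u t) + (1 * (u' t * v t) + (1 * (u t * v' t) + v' t * v t))).
  by apply: eq_Rintegral => t _; ring.
have j3 := integrable_lin mD 1 i3 i4; have j2 := integrable_lin mD 1 i2 j3.
move: h; rewrite e (Rintegral_lin mD 1 i1 j2) (Rintegral_lin mD 1 i2 j3).
rewrite (Rintegral_lin mD 1 i3 i4); real_lra.
Qed.

(** Extended by 0 outside the interval, [u'] has an identically vanishing primitive, and Lebesgue
    differentiation recovers the integrand almost everywhere. *)
Lemma AC_zero u u' : AC l u u' -> (forall x, 0 <= x -> x <= l -> u x = 0) ->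
  ae_eq mu D u' (fun=> 0).
Proof.
move=> [su hu] u0.
have iu := sqint_cint_integrable su.
pose f : R -> R := u' \_ D.
have intf : mu.-integrable setT (EFin \o f).
  by have := (integrable_mkcond (EFin \o u') mD).1 iu; rewrite restrict_EFin.
have loc : locally_integrable setT f by exact: (integrable_locally mD iu).
have inty y : mu.-integrable `]-oo, y] (EFin \o f).
  by apply: integrableS intf => //; exact: measurable_itv.
have := FTC1Ny inty loc; apply: ae_sub => x [_ hx] Dx.
have F0 : (fun x => \int[mu]_(t in `]-oo, x]%classic) f t) = (fun=> 0).
  apply/funext => y; rewrite -(Rintegral_mkcondr mu _ D u').
  have [y0|y0] := ltP y 0.
    rewrite (_ : _ `&` _ = set0) ?Rintegral_set0 //.
    rewrite -subset0 => t [] /=; rewrite /cint /= !in_itv /= => ty /andP[t0 _]; real_lra.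
  set z := Num.min y l.
  have -> : `]-oo, y]%classic `&` D = cint 0 z.
    apply/seteqP; split => t; rewrite /cint /= !in_itv /= /z le_min.
      by move=> [-> /andP[-> ->]].
    by move=> /andP[-> /andP[-> ->]].
  have z0 : 0 <= z by rewrite /z le_min y0.
  have zl : z <= l by rewrite /z ge_min lexx orbT.
  have := hu z z0 zl; rewrite (u0 z) // (u0 0) // add0r => /esym; exact.
have fx : f x = u' x by rewrite /f patchE mem_set.
by rewrite -fx -hx F0 derive1_cst.
Qed.

End Fixed.
End AbsolutelyContinuous.

Section Sobolev.
Context {R : realType}.
Local Notation mu := (@lebesgue_measure R).

(** The inequality u(z)^2 <= 2 u(t)^2 + 2 (u(z) - u(t))^2 is integrated over t in [x, y], with the
    last term bounded by Hölder. The subinterval is kept free so that it can shrink to a point in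
    [AC_ae0]. *)
Lemma AC_sobolev_loc (l : R) (u u' : measurableTypeR R -> R) (x z y : R) :
  0 <= l -> AC l u u' -> 0 <= x -> x <= z -> z <= y -> y <= l ->
  (y - x) * u z ^+ 2 <= 2 * (\int[mu]_(t in cint x y) (u t ^+ 2)) +
    2 * (y - x) ^+ 2 * \int[mu]_(t in cint x y) (u' t ^+ 2).
Proof.
move=> l0 hu x0 xz zy yl; have xy := le_trans xz zy.
have mxy := measurable_cint x y; have fxy := cint_finite x y.
have su := sqint_cintS x0 yl (AC_sqint l0 hu); have su' := sqint_cintS x0 yl hu.1.
set m := \int[mu]_(t in cint x y) (u' t ^+ 2).
have m0 : 0 <= m by apply: Rintegral_ge0 => t _; exact: sqr_ge0.
have near t : x <= t -> t <= y -> (u z - u t) ^+ 2 <= (y - x) * m.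
  have sub a b : x <= a -> a <= b -> b <= y ->
      (u b - u a) ^+ 2 <= (y - x) * m.
    move=> xa ab yb; apply: (le_trans (AC_holder_loc hu (le_trans x0 xa) ab (le_trans yb yl))).
    have i1 := integrable_cintS (lexx x) yb su'.2.
    have c1 := cint_chasles (le_trans xa ab) yb su'.2.
    have c2 := cint_chasles xa ab i1.
    have p1 : 0 <= \int[mu]_(t in cint b y) (u' t ^+ 2) by apply: Rintegral_ge0 => ? _; exact: sqr_ge0.
    have p2 : 0 <= \int[mu]_(t in cint x a) (u' t ^+ 2) by apply: Rintegral_ge0 => ? _; exact: sqr_ge0.
    apply: ler_pM; [by rewrite subr_ge0 | | clear -xa yb; lra | by rewrite /m; real_lra].
    by apply: Rintegral_ge0 => ? _; exact: sqr_ge0.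
  move=> xt ty; have [tz|/ltW zt] := leP t z; first exact: sub.
  by rewrite -sqrrN opprB; exact: sub.
have ic : mu.-integrable (cint x y) (EFin \o (fun=> u z ^+ 2 : R)) := integrable_cst_fin mxy fxy _.
have ic2 : mu.-integrable (cint x y) (EFin \o (fun=> 2 * ((y - x) * m))) := integrable_cst_fin mxy fxy _.
have ir := integrable_lin mxy 2 su.2 ic2.
have : \int[mu]_(t in cint x y) (u z ^+ 2) <=
       \int[mu]_(t in cint x y) (2 * u t ^+ 2 + 2 * ((y - x) * m)).
  apply: (le_Rintegral mxy ic ir) => t; rewrite /cint /= in_itv /= => /andP[xt ty].
  have := near t xt ty; have := sqr_ge0 (u z - 2 * u t); clear; lra.
rewrite (Rintegral_lin mxy 2 su.2 ic2) !Rintegral_cst // cint_measure //.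
set A := \int[mu]_(t in _) _; clear; lra.
Qed.

Lemma AC_sobolev (l : R) (u u' : measurableTypeR R -> R) (z : R) :
  0 < l -> AC l u u' -> 0 <= z -> z <= l ->
  u z ^+ 2 <= 2 / l * (\int[mu]_(t in cint 0 l) (u t ^+ 2)) +
    2 * l * \int[mu]_(t in cint 0 l) (u' t ^+ 2).
Proof.
move=> l0 hu z0 zl; have := AC_sobolev_loc (ltW l0) hu (lexx 0) z0 zl (lexx l).
rewrite subr0; set A := Rintegral _ _ _; set B := Rintegral _ _ _ => h.
rewrite -(ler_pM2l l0); apply: (le_trans h).
have -> : l * (2 / l * A + 2 * l * B) = 2 * A + 2 * l ^+ 2 * B by field; rewrite gt_eqF.
by [].
Qed.

Lemma AC_ae0 (l : R) (u u' : measurableTypeR R -> R) : 0 < l -> AC l u u' ->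
  ae_eq mu (cint 0 l) u (fun=> 0) -> forall z, 0 <= z -> z <= l -> u z = 0.
Proof.
move=> l0 hu hae z z0 zl.
apply/eqP; rewrite -sqrf_eq0 eq_le sqr_ge0 andbT; apply/ler_addgt0Pr => e e0; rewrite add0r.
set m := \int[mu]_(t in cint 0 l) (u' t ^+ 2).
have m0 : 0 <= m by apply: Rintegral_ge0 => t _; exact: sqr_ge0.
pose s : R := Num.min 1 (e / (2 * l * m + 1)).
have K0 : 0 <= 2 * l * m by rewrite !mulr_ge0 // ltW.
have s0 : 0 < s by rewrite lt_min ltr01 divr_gt0 //; lra.
have s1 : s <= 1 by rewrite ge_min lexx.
have se : s * (2 * l * m + 1) <= e by rewrite -ler_pdivlMr ?ge_min ?lexx ?orbT //; lra.
(* Shrinking [0, l] towards [z] by the ratio [s] gives an interval of length [l * s] around [z] that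
   stays inside [0, l], also when [z] is an end point. *)
pose x := z - z * s; pose y := z + (l - z) * s.
have zs : 0 <= z * s by rewrite mulr_ge0 // ltW.
have lzs : 0 <= (l - z) * s by rewrite mulr_ge0 ?subr_ge0 // ltW.
have x0 : 0 <= x by rewrite /x; have := mulr_ge0 z0 (_ : 0 <= 1 - s); rewrite subr_ge0 s1 => /(_ isT); lra.
have xz : x <= z by rewrite /x; lra.
have zy : z <= y by rewrite /y; lra.
have yl : y <= l.
  by rewrite /y; have := mulr_ge0 (_ : 0 <= l - z) (_ : 0 <= 1 - s); rewrite !subr_ge0 s1 zl => /(_ isT isT); lra.
have := AC_sobolev_loc (ltW l0) hu x0 xz zy yl.
have -> : y - x = l * s by rewrite /y /x; ring.
have i0 : \int[mu]_(t in cint x y) (u t ^+ 2) = 0.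
  have su := sqint_cintS x0 yl (AC_sqint (ltW l0) hu).
  rewrite /Rintegral (@ae_eq_integral _ _ _ mu _ (cst 0%E)) ?integral0 //.
  - exact: measurable_cint.
  - exact: measurable_int su.2.
  - apply: ae_sub hae => t ht Dt; rewrite /= ht ?expr0n //.
    exact: cint_sub x0 yl _ Dt.
rewrite i0 mulr0 add0r.
have h1 : \int[mu]_(t in cint x y) (u' t ^+ 2) <= m.
  exact: Rintegral_sqr_sub hu.1 x0 (le_trans xz zy) yl.
set M := Rintegral _ _ _ in h1 * => h2.
have ls : 0 < l * s by rewrite mulr_gt0.
have h3 : u z ^+ 2 <= 2 * (l * s) * M.
  by rewrite -(ler_pM2l ls); apply: (le_trans h2); clear; lra.
apply: (le_trans h3).
have h4 : 2 * (l * s) * M <= 2 * (l * s) * m by apply: ler_wpM2l => //; lra.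
by apply: (le_trans h4); apply: le_trans se; lra.
Qed.

End Sobolev.

(** * Integration by parts on the graph *)

Section H1Calculus.
Context {R : realType} {G : quantum_graph R}.
Local Notation mu := (@lebesgue_measure R).
Local Notation len := (@edge_len R G).
Implicit Types (f g u w : field G) (e : edge G) (p q : edge G * bool).

Lemma len_gt0 e : 0 < len e. Proof. exact: edge_len_gt0. Qed.
Lemma len_ge0 e : 0 <= len e. Proof. exact/ltW/len_gt0. Qed.

Lemma domE e x : dom e x <-> 0 <= x /\ x <= len e.
Proof. by rewrite /dom /= in_itv /=; split => [/andP[]|[-> ->]]. Qed.

Lemma H1P f f' : H1 f f' <-> forall e,
  AC (len e) (fun x => Rep (f e x)) (fun x => Rep (f' e x)) /\
  AC (len e) (fun x => Imp (f e x)) (fun x => Imp (f' e x)).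
Proof.
split=> [[/L2P h1 h2] e|h].
  split; split; [exact: (h1 e).1| |exact: (h1 e).2|]; move=> x x0 xl.
    by rewrite (h2 e x) ?domE // RepD.
  by rewrite (h2 e x) ?domE // ImpD.
split; first by apply/L2P => e; have [[h1 _] [h2 _]] := h e; split.
move=> e x /domE [x0 xl]; have [[_ h1] [_ h2]] := h e.
by apply: complex_ext; rewrite ?RepD ?ImpD; [exact: h1 | exact: h2].
Qed.

Lemma H1_lin c f f' g g' : H1 f f' -> H1 g g' -> H1 (c *: f + g) (c *: f' + g').
Proof.
move=> /H1P hf /H1P hg; apply/H1P => e; have [f1 f2] := hf e; have [g1 g2] := hg e.
split.
  have h := AC_lin (Rep c) f1 (AC_lin (- Imp c) f2 g1).
  rewrite (_ : (fun x => _) = (fun x => Rep c * Rep (f e x) + (- Imp c * Imp (f e x) + Rep (g e x)))).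
    rewrite [X in AC _ _ X](_ : _ = (fun x => Rep c * Rep (f' e x) + (- Imp c * Imp (f' e x) + Rep (g' e x)))) //.
    by apply/funext => x; rewrite RepD RepM; ring.
  by apply/funext => x; rewrite RepD RepM; ring.
have h := AC_lin (Rep c) f2 (AC_lin (Imp c) f1 g2).
rewrite (_ : (fun x => _) = (fun x => Rep c * Imp (f e x) + (Imp c * Rep (f e x) + Imp (g e x)))).
  rewrite [X in AC _ _ X](_ : _ = (fun x => Rep c * Imp (f' e x) + (Imp c * Rep (f' e x) + Imp (g' e x)))) //.
  by apply/funext => x; rewrite ImpD ImpM; ring.
by apply/funext => x; rewrite ImpD ImpM; ring.
Qed.

Lemma H1_L2 f f' : H1 f f' -> L2 f.
Proof.
move=> /H1P h; apply/L2P => e; have [h1 h2] := h e.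
by split; [exact: (AC_sqint (len_ge0 e) h1) | exact: (AC_sqint (len_ge0 e) h2)].
Qed.

Lemma H1_L2' f f' : H1 f f' -> L2 f'. Proof. by case. Qed.

Lemma H1_0 : H1 (0 : field G) 0.
Proof.
split; first exact: L2_0.
move=> e x _; rewrite -[RHS]/(0 + Cintegral `[0, x] (fun=> 0 : R[i])) add0r.
by rewrite (Cintegral0 (measurable_cint 0 x)).
Qed.

Lemma H1N f f' : H1 f f' -> H1 (- f) (- f').
Proof. by move=> h; have := H1_lin (-1) h H1_0; rewrite !scaleN1r !addr0. Qed.

Lemma H1_aeeq f f' f'' : aeeq f' f'' -> L2 f'' -> H1 f f' -> H1 f f''.
Proof.
move=> ae L2f'' [L2f' hf]; split=> // e x Dx; rewrite hf //; congr (_ + _).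
have [x0 xl] := (domE e x).1 Dx.
have h (k : field G) : L2 k -> cintegrable (cint 0 x) (k e).
  move=> /L2P /(_ e) [k1 k2]; split; apply: sqint_cint_integrable.
    exact: sqint_cintS (lexx 0) xl k1.
  exact: sqint_cintS (lexx 0) xl k2.
apply: (Cintegral_ae (measurable_cint 0 x) (h _ L2f') (h _ L2f'')).
apply: ae_sub (ae e) => t ht Dt; apply: ht; exact: (cint_sub (lexx 0) xl Dt).
Qed.

Lemma H1_primitive (c : edge G -> R[i]) w : L2 w ->
  H1 (fun e x => c e + Cintegral `[0, x] (w e)) w.
Proof.
move=> hw; split=> // e x _; congr (_ + _).
by rewrite /Cintegral !set_itv1 !Rintegral_set1 -[_ +i* _]/(0 : R[i]) addr0.
Qed.

Lemma Cintegral_cst (c : R[i]) (x : R) : 0 <= x ->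
  Cintegral `[0, x] (fun=> c) = x%:C * c.
Proof.
move=> x0; apply: complex_ext; rewrite /= ?(RepM, ImpM) /=;
  rewrite (Rintegral_cst mu (measurable_cint 0 x)) cint_measure //; ring.
Qed.

(** Affine interpolation on each edge. It supplies the test functions from which vertex conditions
    are read off. *)
Lemma H1_interpolation (a : edge G * bool -> R[i]) :
  exists f f', H1 f f' /\ forall p, end_val f p = a p.
Proof.
pose f' : field G := fun e _ => (len e)^-1%:C * (a (e, true) - a (e, false)).
have L2f' : L2 f'.
  apply/L2P => e; split; exact: (sqint_cst (measurable_mdom e) (mdom_finite e)).
exists (fun e x => a (e, false) + Cintegral `[0, x] (f' e)), f'; split.
  exact: H1_primitive.
case=> e [|]; rewrite /end_val /= Cintegral_cst ?len_ge0 // /f'.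
  rewrite mulrA -rmorphM /= divff ?gt_eqF ?len_gt0 // rmorph1 mul1r.
  by rewrite addrC subrK.
by rewrite mul0r addr0.
Qed.

Lemma H1_zero f f' : H1 f f' -> (forall e x, dom e x -> f e x = 0) -> null f'.
Proof.
move=> /H1P h f0 e; have [h1 h2] := h e.
have a1 := AC_zero (len_ge0 e) h1 (fun x x0 xl => congr1 (@complex.Re R) (f0 e x ((domE e x).2 (conj x0 xl)))).
have a2 := AC_zero (len_ge0 e) h2 (fun x x0 xl => congr1 (@complex.Im R) (f0 e x ((domE e x).2 (conj x0 xl)))).
apply: filterS2 a1 a2 => x hx1 hx2 Dx; apply: complex_ext; [exact: hx1 | exact: hx2].
Qed.

Lemma H1_null f f' : H1 f f' -> null f -> forall e x, dom e x -> f e x = 0.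
Proof.
move=> /H1P h f0 e x /domE [x0 xl]; have [h1 h2] := h e.
apply: complex_ext.
  apply: (AC_ae0 (len_gt0 e) h1) => //.
  by apply: ae_sub (f0 e) => t ht Dt; rewrite ht.
apply: (AC_ae0 (len_gt0 e) h2) => //.
by apply: ae_sub (f0 e) => t ht Dt; rewrite ht.
Qed.

Lemma sum_ends (F : edge G * bool -> R[i]) :
  \sum_p F p = \sum_e (F (e, true) + F (e, false)).
Proof.
transitivity (\sum_e \sum_(b : bool) F (e, b)).
  by rewrite pair_bigA; apply: eq_bigr => -[].
by apply: eq_bigr => e _; rewrite big_bool.
Qed.

(** On one edge the boundary term is the value at the far end minus the value at 0. [end_flux]
    changes the sign at the far end, whence the overall minus sign. *)
Lemma H1_parts f f' g g' : H1 f f' -> H1 g g' ->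
  inner f' g + inner f g' = - \sum_p end_val f p * conjc (end_flux g p).
Proof.
move=> hf hg; rewrite sum_ends -sumrN -big_split; apply: eq_bigr => e _ /=.
have [f1 f2] := (H1P f f').1 hf e; have [g1 g2] := (H1P g g').1 hg e.
have mD := measurable_cint 0 (len e); have l0 := len_ge0 e.
have sf1 := AC_sqint l0 f1; have sf2 := AC_sqint l0 f2.
have sg1 := AC_sqint l0 g1; have sg2 := AC_sqint l0 g2.
have p11 := AC_parts l0 f1 g1; have p22 := AC_parts l0 f2 g2.
have p21 := AC_parts l0 f2 g1; have p12 := AC_parts l0 f1 g2.
have sf1' := f1.1; have sf2' := f2.1; have sg1' := g1.1; have sg2' := g2.1.
have ReE (h k : measurableTypeR R -> R[i]) :
   sqint (cint 0 (len e)) (fun x => Rep (h x)) -> sqint (cint 0 (len e)) (fun x => Imp (h x)) ->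
   sqint (cint 0 (len e)) (fun x => Rep (k x)) -> sqint (cint 0 (len e)) (fun x => Imp (k x)) ->
   Rep (Cintegral (dom e) (fun x => h x * conjc (k x))) =
   \int[mu]_(x in cint 0 (len e)) (Rep (h x) * Rep (k x)) +
   \int[mu]_(x in cint 0 (len e)) (Imp (h x) * Imp (k x)).
  move=> h1 h2 k1 k2; rewrite -RintegralD //; [|exact: sqintM|exact: sqintM].
  by apply: eq_Rintegral => x _; rewrite RepM RepJ ImpJ; ring.
have ImE (h k : measurableTypeR R -> R[i]) :
   sqint (cint 0 (len e)) (fun x => Rep (h x)) -> sqint (cint 0 (len e)) (fun x => Imp (h x)) ->
   sqint (cint 0 (len e)) (fun x => Rep (k x)) -> sqint (cint 0 (len e)) (fun x => Imp (k x)) ->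
   Imp (Cintegral (dom e) (fun x => h x * conjc (k x))) =
   \int[mu]_(x in cint 0 (len e)) (Imp (h x) * Rep (k x)) -
   \int[mu]_(x in cint 0 (len e)) (Rep (h x) * Imp (k x)).
  move=> h1 h2 k1 k2; rewrite -RintegralB //; [|exact: sqintM|exact: sqintM].
  by apply: eq_Rintegral => x _; rewrite ImpM RepJ ImpJ; ring.
rewrite /end_val /end_flux /=; apply: complex_ext.
  rewrite RepD !ReE // !(RepD, RepN, RepM, ImpN, RepJ, ImpJ).
  move: p11 p22; clear; real_lra.
rewrite ImpD !ImE // !(ImpD, ImpN, ImpM, RepN, RepJ, ImpJ).
move: p12 p21; clear; real_lra.
Qed.

End H1Calculus.

(** * The exterior derivative and its adjoint *)

Section Adjointness.
Context {R : realType} {G : quantum_graph R}.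
Local Notation mu := (@lebesgue_measure R).
Local Notation len := (@edge_len R G).
Implicit Types (f g u w : field G) (e : edge G) (p q : edge G * bool).

Lemma L2N f : L2 f -> L2 (- f).
Proof. by move=> h; have := L2_lin (-1) h L2_0; rewrite scaleN1r addr0. Qed.

Lemma L2D f g : L2 f -> L2 g -> L2 (f + g).
Proof. by move=> hf hg; have := L2_lin 1 hf hg; rewrite scale1r. Qed.

Lemma innerNr f g : L2 f -> L2 g -> inner f (- g) = - inner f g.
Proof. by move=> hf hg; exact: (ipNr ipL2 (toL2 hg) (toL2 hf)). Qed.

Lemma innerDr f g h : L2 f -> L2 g -> L2 h -> inner h (f + g) = inner h f + inner h g.
Proof. by move=> hf hg hh; exact: (ipDr ipL2 (toL2 hf) (toL2 hg) (toL2 hh)). Qed.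

Lemma inner_aeeq_l f f' g : L2 f -> L2 f' -> L2 g -> aeeq f f' -> inner f g = inner f' g.
Proof.
move=> hf hf' hg h; apply: (@ip_eql _ _ ipL2 (toL2 hf) (toL2 hf') (toL2 hg)).
by apply/aeeq_sq.
Qed.

Lemma inner_aeeq_r f f' g : L2 f -> L2 f' -> L2 g -> aeeq f f' -> inner g f = inner g f'.
Proof.
move=> hf hf' hg h; apply: (@ip_eqr _ _ ipL2 (toL2 hf) (toL2 hf') (toL2 hg)).
by apply/aeeq_sq.
Qed.

Lemma aeeq_sym f g : aeeq f g -> aeeq g f.
Proof. by move=> h e; apply: ae_sub (h e) => x hx Dx; rewrite hx. Qed.

Lemma aeeqN f g : aeeq f g -> aeeq (- f) (- g).
Proof. by move=> h e; apply: ae_sub (h e) => x hx Dx; congr (- _); exact: hx. Qed.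

(** The ends are grouped by vertex; the common value of [a] leaves each group, and the sum of [b]
    left over is 0. *)
Lemma boundary_pairing (a b : edge G * bool -> R[i]) :
  equal_at_vertices a -> balanced_at_vertices b -> \sum_p a p * conjc (b p) = 0.
Proof.
move=> ha hb; rewrite (partition_big (@end_vertex _ G) xpredT) //= big1 // => v _.
have [p /eqP pv|none] := pickP (fun p => @end_vertex _ G p == v); last first.
  by rewrite big_pred0.
transitivity (a p * conjc (\sum_(q | end_vertex q == v) b q)).
  rewrite rmorph_sum mulr_sumr; apply: eq_bigr => q /eqP qv.
  by rewrite (ha q p) // qv pv.
by rewrite hb rmorph0 mulr0.
Qed.

Lemma green f f' g g' : H1 f f' -> H1 g g' ->
  equal_at_vertices (end_val f) -> balanced_at_vertices (end_flux g) ->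
  inner f' g + inner f g' = 0.
Proof. by move=> hf hg hv hfl; rewrite (H1_parts hf hg) boundary_pairing ?oppr0. Qed.

Lemma op_d_delta f v u w : op_d G f v -> op_delta G u w -> inner v u = inner f w.
Proof.
move=> [Lf Lv [f0 [ff0 hf0 ef0]]] [Lu Lw [u0 [uu0 hu0 bu0]]].
have Lf0 := H1_L2 hf0; have Lu0 := H1_L2 hu0.
rewrite (inner_aeeq_r Lu Lu0 Lv uu0) (inner_aeeq_l Lf Lf0 Lw ff0).
have := green hf0 hu0 ef0 bu0; rewrite (innerNr Lf0 Lw) => /eqP.
by rewrite subr_eq0 => /eqP.
Qed.

(* Du Bois-Reymond: test against the primitive of [z - C], with [z = u + int w] and [C]
   the mean value of [z] on each edge; this gives [z = C]. *)
Lemma weak_derivative u w : L2 u -> L2 w ->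
  (forall h h', H1 h h' -> (forall p, end_val h p = 0) -> inner h' u = inner h w) ->
  exists g, aeeq u g /\ H1 g (- w).
Proof.
move=> Lu Lw weak.
pose W : field G := fun e x => 0 + Cintegral `[0, x] (w e).
have hW : H1 W w by exact: (H1_primitive (fun=> 0) Lw).
have LW := H1_L2 hW.
pose z := u + W; have Lz : L2 z by exact: L2D.
pose c e := (len e)^-1%:C * Cintegral (dom e) (z e).
pose C : field G := fun e _ => c e.
have LC : L2 C by apply/L2P => e; split; exact: (sqint_cst (measurable_mdom e) (mdom_finite e)).
pose h' := z - C; have Lh' : L2 h' by apply: L2D => //; exact: L2N.
pose h : field G := fun e x => 0 + Cintegral `[0, x] (h' e).
have hh : H1 h h' by exact: (H1_primitive (fun=> 0) Lh').
have ci (k : field G) e : L2 k -> cintegrable (mdom e) (k e).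
  by move=> /L2P /(_ e); exact: (csqint_integrable (measurable_mdom e) (mdom_finite e)).
have int_h' e : Cintegral (dom e) (h' e) = 0.
  have := Cintegral_lin (measurable_mdom e) (-1) (ci C e LC) (ci z e Lz).
  have -> : Cintegral (mdom e) (fun x => -1 * C e x + z e x) = Cintegral (dom e) (h' e).
    by apply: eq_Cintegral => x _; rewrite mulN1r addrC.
  move=> ->; rewrite -[Cintegral (mdom e) (C e)]/(Cintegral `[0, len e] (fun=> c e)).
  rewrite Cintegral_cst ?len_ge0 //.
  have -> : (len e)%:C * c e = Cintegral (dom e) (z e).
    by rewrite /c mulrA -rmorphM /= divff ?gt_eqF ?len_gt0 // rmorph1 mul1r.
  by rewrite mulN1r addNr.
have h_end p : end_val h p = 0.
  case: p => e [|]; rewrite /end_val /h /= add0r; first exact: int_h'.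
  by rewrite /Cintegral set_itv1 !Rintegral_set1.
have flux0 : \sum_p end_val h p * conjc (end_flux W p) = 0.
  by apply: big1 => p _; rewrite h_end mul0r.
have := H1_parts hh hW; rewrite flux0 oppr0 -(weak _ _ hh h_end) addrC.
rewrite -innerDr // -/z => hz.
have hC : inner h' C = 0.
  rewrite /inner big1 // => e _.
  transitivity (Cintegral (mdom e) (fun x => conjc (c e) * h' e x)).
    by apply: eq_Cintegral => x _; rewrite mulrC.
  by rewrite (CintegralZ (measurable_mdom e) _ (ci _ e Lh')) int_h' mulr0.
have h'0 : null h'.
  apply/(null_sq (toL2 Lh')); rewrite /sq /= /L2inner /=.
  have -> : inner h' h' = inner h' z + inner h' (- C) by rewrite -innerDr //; exact: L2N.
  by rewrite innerNr // hC hz subr0.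
exists (fun e x => c e + Cintegral `[0, x] ((- w) e)); split; last first.
  by apply: H1_primitive; exact: L2N.
move=> e; apply: ae_sub (h'0 e) => x hx Dx.
have := hx Dx; rewrite /h' /z => /eqP; rewrite subr_eq0 => /eqP zx.
have [x0 xl] := (domE e x).1 Dx.
have iw : cintegrable (cint 0 x) (w e).
  move/L2P: Lw => /(_ e) [k1 k2]; split; apply: sqint_cint_integrable.
    exact: sqint_cintS (lexx 0) xl k1.
  exact: sqint_cintS (lexx 0) xl k2.
have -> : Cintegral `[0, x] ((- w) e) = - Cintegral `[0, x] (w e).
  rewrite -[RHS]mulN1r -[RHS](CintegralZ (measurable_cint 0 x) (-1) iw).
  by apply: eq_Cintegral => t _; rewrite mulN1r.
have zx' : u e x + (0 + Cintegral `[0, x] (w e)) = c e := zx.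
by rewrite -zx' add0r addrK.
Qed.

Lemma op_d_rep f f' : H1 f f' -> equal_at_vertices (end_val f) -> op_d G f f'.
Proof.
move=> h he; split; [exact: H1_L2 h | exact: H1_L2' h | exists f; split => //].
exact: aeeq_refl.
Qed.

Lemma op_delta_rep f f' : H1 f (- f') -> balanced_at_vertices (end_flux f) ->
  op_delta G f f'.
Proof.
move=> h he; split; [exact: H1_L2 h | | exists f; split => //].
  by rewrite -[f']opprK; apply: L2N; exact: H1_L2' h.
exact: aeeq_refl.
Qed.

(** Test functions vanishing at all ends give the weak derivative; one whose end values are 1 at [v]
    and 0 at the other vertices then isolates the balance condition at [v] in the boundary term. *)
Theorem delta_adjoint u w : L2 u -> L2 w ->
  (forall f g, op_d G f g -> inner g u = inner f w) -> op_delta G u w.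
Proof.
move=> Lu Lw adj.
have [|g [ug hg]] := weak_derivative Lu Lw.
  move=> h h' hh h0; apply: adj; apply: op_d_rep => // p q _.
  by rewrite !h0.
split => //; exists g; split => // v.
have [f [f' [hf ef]]] := H1_interpolation (fun p => (end_vertex p == v)%:R : R[i]).
have hfd : op_d G f f'.
  by apply: op_d_rep => // p q pq; rewrite !ef pq.
have Lf := H1_L2 hf; have Lg := H1_L2 hg; have Lf' := H1_L2' hf.
have := H1_parts hf hg; rewrite (innerNr Lf Lw) -(adj _ _ hfd).
rewrite (inner_aeeq_r Lu Lg Lf' ug) subrr => /esym/eqP; rewrite oppr_eq0 => /eqP h.
apply: (can_inj (@conjcK R)); rewrite rmorph0 rmorph_sum big_mkcond /= -[RHS]h.
by apply: eq_bigr => p _; rewrite ef; case: ifP; rewrite ?mul1r ?mul0r.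
Qed.

(** Here the boundary test is a 1-form with flux 1 at the end [p], -1 at the end [q] of the same
    vertex, and 0 elsewhere. It is balanced, and the boundary term equates the values at [p] and
    [q]. *)
Theorem d_adjoint u w : L2 u -> L2 w ->
  (forall f g, op_delta G f g -> inner g u = inner f w) -> op_d G u w.
Proof.
move=> Lu Lw adj.
have [|g [ug hg]] := weak_derivative Lu (L2N Lw).
  move=> h h' hh h0; have Lh := H1_L2 hh; have Lh' := H1_L2' hh.
  have hd : op_delta G h (- h').
    apply: op_delta_rep; first by rewrite opprK.
    move=> v; apply: big1 => -[e [|]] _; rewrite /end_flux /=.
      by have := h0 (e, true); rewrite /end_val /= => ->; rewrite oppr0.
    by have := h0 (e, false).
  have := adj _ _ hd.
  rewrite (innerNr Lh Lw) => <-.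
  by rewrite (inner_conj (L2N Lh') Lu) (innerNr Lu Lh') conjcN opprK -(inner_conj Lh' Lu).
rewrite opprK in hg.
split => //; exists g; split => // p q pq.
have [->//|npq] := eqVneq p q.
pose a r : R[i] := (r == p)%:R - (r == q)%:R.
(* The sign at the far ends undoes the one in [end_flux], so that the fluxes are exactly [a]. *)
have [f [f' [hf ef]]] := H1_interpolation (fun r => if r.2 then - a r else a r).
have ff r : end_flux f r = a r.
  have := ef r; case: r => e [|]; rewrite /end_val /end_flux /= => ->; rewrite ?opprK //.
have hd : op_delta G f (- f').
  apply: op_delta_rep; first by rewrite opprK.
  move=> v; under eq_bigr do rewrite ff; rewrite /a sumrB.
  have one r : \sum_(s | end_vertex s == v) (s == r)%:R = (end_vertex r == v)%:R :> R[i].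
    rewrite big_mkcond (bigD1 r) //= eqxx big1 ?addr0; first by case: ifP.
    by move=> s /negPf ->; case: ifP.
  by rewrite !one pq subrr.
have Lf := H1_L2 hf; have Lg := H1_L2 hg; have Lf' := H1_L2' hf.
have := H1_parts hg hf.
have := adj _ _ hd; rewrite (inner_aeeq_r Lu Lg (L2N Lf') ug).
rewrite (inner_conj (L2N Lf') Lg) (innerNr Lg Lf') (inner_conj Lf Lw).
move=> /(can_inj (@conjcK R)) <-; rewrite addNr => /esym/eqP; rewrite oppr_eq0 => /eqP.
under eq_bigr do rewrite ff /a conjcD conjcN !conjc_nat mulrBr.
rewrite sumrB.
have pick (r : edge G * bool) : \sum_s end_val g s * (s == r)%:R = end_val g r.
  rewrite (bigD1 r) //= eqxx mulr1 big1 ?addr0 // => s /negPf ->.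
  by rewrite mulr0.
by rewrite !pick => /eqP; rewrite subr_eq0 => /eqP.
Qed.

Lemma op_delta_L2 u w : op_delta G u w -> L2 u /\ L2 w. Proof. by case. Qed.
Lemma op_d_L2 u w : op_d G u w -> L2 u /\ L2 w. Proof. by case. Qed.

Lemma op_delta_adjoint : op_eq (op_delta G) (op_adjoint (op_d G)).
Proof.
move=> u w; split=> [h|[Lu Lw h]]; last exact: delta_adjoint.
by have [Lu Lw] := op_delta_L2 h; split=> // f g hfg; exact: op_d_delta hfg h.
Qed.

Lemma op_HK_comp : op_eq (op_HK G) (op_comp (op_delta G) (op_d G)).
Proof.
move=> u w; split=> [[Lu Lw [f [f' [uf hf hf' ef bf]]]]|[v [[Lu Lv [f [uf hf ef]]] [_ Lw [g [vg hg bg]]]]]].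
  exists f'; split; first by split; [|exact: H1_L2' hf|exists f].
  by split; [exact: H1_L2' hf| |exists f'; split=> //; exact: aeeq_refl].
split=> //; exists f, g; split=> //.
exact: (H1_aeeq vg (H1_L2 hg) hf).
Qed.

Lemma op_HA_comp : op_eq (op_HA G) (op_comp (op_d G) (op_delta G)).
Proof.
move=> u w; split=> [[Lu Lw [f [f' [uf hf hf' bf ef]]]]|[v [[Lu Lv [f [uf hf bf]]] [_ Lw [g [vg hg eg]]]]]].
  have Lf' := H1_L2' hf.
  exists (- f'); split.
    by split; [|exact: L2N|exists f; split=> //; rewrite opprK].
  split; [exact: L2N|done|exists (- f'); split]; first exact: aeeq_refl.
    by rewrite -[w]opprK; exact: H1N.
  move=> p q pq; have := ef p q pq; rewrite /end_val.
  by case: p.2; case: q.2 => h; congr (- _).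
split=> //; exists f, (- g); split=> //.
- apply: (H1_aeeq _ _ hf); first exact: aeeqN.
  exact/L2N/(H1_L2 hg).
- exact: H1N.
- move=> p q pq; have := eg p q pq; rewrite /end_val.
  by case: p.2; case: q.2 => h; congr (- _).
Qed.

Definition dL (u w : L2space (G := G)) : Prop := op_d G u w.
Definition deltaL (u w : L2space (G := G)) : Prop := op_delta G u w.

Lemma adjoint_d_delta : adjoint_of ipL2 dL deltaL.
Proof.
move=> u w; split=> [h f g hfg|h]; first exact: op_d_delta hfg h.
apply: delta_adjoint; [exact: L2spaceP|exact: L2spaceP|move=> f g hfg].
have [Lf Lg] := op_d_L2 hfg; exact: (h (toL2 Lf) (toL2 Lg)).
Qed.

Lemma adjoint_delta_d : adjoint_of ipL2 deltaL dL.
Proof.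
move=> u w; split=> [h f g hfg|h].
  rewrite ip_conj (ip_conj _ f); congr conjc; apply/esym; exact: op_d_delta h hfg.
apply: d_adjoint; [exact: L2spaceP|exact: L2spaceP|move=> f g hfg].
have [Lf Lg] := op_delta_L2 hfg; exact: (h (toL2 Lf) (toL2 Lg)).
Qed.

Lemma dL_inj (w : L2space) : dL 0 w -> sq ipL2 w = 0.
Proof.
move=> [_ _ [f [f0 hf _]]]; apply/null_sq; apply: (H1_zero hf); apply: (H1_null hf).
exact: aeeq_sym f0.
Qed.

Lemma deltaL_inj (w : L2space) : deltaL 0 w -> sq ipL2 w = 0.
Proof.
move=> [_ _ [f [f0 hf _]]]; rewrite -sqN; apply/null_sq; apply: (H1_zero hf).
by apply: (H1_null hf); exact: aeeq_sym f0.
Qed.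

End Adjointness.

(** * Compact embedding and trace bound for the exterior derivative *)

Lemma filter_forall_fin (T : Type) (I : finType) (U : set_system T) (E : I -> set T) :
  Filter U -> (forall i, U (E i)) -> U [set p | forall i, E i p].
Proof.
move=> FU h.
suff H (s : seq I) : U [set p | forall i, i \in s -> E i p].
  by apply: filterS (H (enum I)) => p hp i; apply: hp; rewrite mem_enum.
elim: s => [|i s IH]; first by apply: filterS filterT.
apply: filterS (filterI (h i) IH) => p [h1 h2] j; rewrite in_cons => /predU1P[->//|].
exact: h2.
Qed.

(** The limit of [phi] along [U] is the supremum of the [r] below [phi] on a set of [U]. Maximality
    of the ultrafilter turns the failure of a larger [r] into an upper bound for [phi] on a set of
    [U]. *)
Lemma ultra_bounded_cauchy (R : realType) (T : Type) (U : set_system T) (phi : T -> R)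
    (B : R) : UltraFilter U -> U [set p | `|phi p| <= B] -> forall e, 0 < e ->
  exists E, U E /\ forall p q, E p -> E q -> `|phi p - phi q| < e.
Proof.
move=> UU hB e e0; have FU := @ultra_proper _ _ UU.
pose S := [set r | U [set p | r <= phi p]].
have S0 : S (- B).
  by apply: filterS hB => p /=; rewrite ler_norml => /andP[].
have ubS : ubound S B.
  move=> r Sr; rewrite leNgt; apply/negP => Br.
  have [p [/= h1 h2]] := filter_ex (filterI hB Sr).
  by have := ler_norm (phi p); lra.
have hS : has_sup S by split; [exists (- B) | exists B].
have e4 : 0 < e / 4 by lra.
have [r Sr hr] := sup_adherent e4 hS.
have nS : ~ S (sup S + e / 4).
  by move=> /(ub_le_sup hS.2); lra.
have [//|U2] := in_ultra_setVsetC [set p | sup S + e / 4 <= phi p] UU.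
exists ([set p | r <= phi p] `&` ~` [set p | sup S + e / 4 <= phi p]).
split; first exact: filterI.
move=> p q [/= p1 /negP]; rewrite -ltNge => p2 [/= q1 /negP]; rewrite -ltNge => q2.
by rewrite ltr_norml; apply/andP; split; lra.
Qed.

Lemma sum_nat_recrC (V : nmodType) (F : nat -> V) n :
  \sum_(0 <= k < n.+1) F k = F n + \sum_(0 <= k < n) F k.
Proof. by rewrite big_nat_recr //= addrC. Qed.

Section Embedding.
Context {R : realType} {G : quantum_graph R}.
Local Notation mu := (@lebesgue_measure R).
Local Notation len := (@edge_len R G).
Local Notation sq := (sq (ipL2 (G := G))).
Implicit Types (f g : field G) (u w : L2space (G := G)) (e : edge G).

Lemma Rintegral_mdom_cst (c : R) e : \int[mu]_(x in mdom e) c = c * len e.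
Proof.
have -> : len e = fine (mu (mdom e)) by rewrite mdom_measure.
exact: (Rintegral_cst mu (measurable_mdom e) c).
Qed.

Definition nsq_edge f e := \int[mu]_(x in dom e) normsq (f e x).

Lemma nsq_edge_ge0 f e : 0 <= nsq_edge f e.
Proof. by apply: Rintegral_ge0 => x _; exact: normsq_ge0. Qed.

Lemma nsq_edge_le (u : L2space) e : nsq_edge (L2val u) e <= sq u.
Proof.
rewrite sq_ipL2 (bigD1 e) //= lerDl; apply: sumr_ge0 => e' _; exact: nsq_edge_ge0.
Qed.

Lemma nsq_edge_parts f e : L2 f -> nsq_edge f e =
  \int[mu]_(x in cint 0 (len e)) (Rep (f e x) ^+ 2) +
  \int[mu]_(x in cint 0 (len e)) (Imp (f e x) ^+ 2).
Proof.
move=> /L2P /(_ e) [h1 h2]; rewrite -RintegralD; [by []|exact: measurable_cint|exact: h1.2|exact: h2.2].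
Qed.

Lemma nsq_edge_ae f g e : L2 f -> L2 g -> aeeq f g -> nsq_edge f e = nsq_edge g e.
Proof.
move=> Lf Lg h; rewrite /nsq_edge /Rintegral; congr fine.
apply: (@ae_eq_integral _ _ _ mu (mdom e)).
- exact: measurable_mdom.
- exact: measurable_int (csqint_normsq (measurable_mdom e) ((L2P f).1 Lf e)).
- exact: measurable_int (csqint_normsq (measurable_mdom e) ((L2P g).1 Lg e)).
- by apply: ae_sub (h e) => x hx Dx; rewrite /= hx.
Qed.

(** A sum over the edges dominates both constants of the one-dimensional inequality on every
    edge. *)
Definition sobolev_const : R := \sum_e (2 / len e + 2 * len e).

Lemma sobolev_const_ge e : 2 / len e <= sobolev_const /\ 2 * len e <= sobolev_const.
Proof.
have p e' : 0 < 2 / len e' by rewrite divr_gt0 ?len_gt0.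
have q e' : 0 < 2 * len e' by rewrite mulr_gt0 ?len_gt0.
have s0 : 0 <= \sum_(e' | e' != e) (2 / len e' + 2 * len e').
  by apply: sumr_ge0 => e' _; have := p e'; have := q e'; lra.
rewrite /sobolev_const (bigD1 e) //=; have := p e; have := q e; split; lra.
Qed.

Lemma sobolev_const_ge0 : 0 <= sobolev_const.
Proof.
apply: sumr_ge0 => e _; rewrite addr_ge0 // ?divr_ge0 ?mulr_ge0 //; exact: len_ge0.
Qed.

Lemma sobolev_edge f f' e x : H1 f f' -> dom e x ->
  normsq (f e x) <= 2 / len e * nsq_edge f e + 2 * len e * nsq_edge f' e.
Proof.
move=> hf /domE [x0 xl]; have Lf := H1_L2 hf; have [h1 h2] := (H1P f f').1 hf e.
have s1 := AC_sobolev (len_gt0 e) h1 x0 xl; have s2 := AC_sobolev (len_gt0 e) h2 x0 xl.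
rewrite (nsq_edge_parts e Lf) (nsq_edge_parts e (H1_L2' hf)) /normsq.
move: s1 s2; clear; real_lra.
Qed.

Lemma sobolev (u w : L2space) f e x : aeeq u f -> H1 f w -> dom e x ->
  normsq (f e x) <= sobolev_const * (sq u + sq w).
Proof.
move=> uf hf Dx; apply: le_trans (sobolev_edge hf Dx) _.
have [c1 c2] := sobolev_const_ge e; have c0 := sobolev_const_ge0.
rewrite -(nsq_edge_ae e (L2spaceP u) (H1_L2 hf) uf) mulrDr; apply: lerD.
  apply: ler_pM => //; [by rewrite divr_ge0 ?len_ge0|exact: nsq_edge_ge0|exact: nsq_edge_le].
apply: ler_pM => //; [by rewrite mulr_ge0 ?len_ge0|exact: nsq_edge_ge0|exact: nsq_edge_le].
Qed.

Lemma dL_rep_unique (u w w' : L2space) f f' e x : aeeq u f -> aeeq u f' -> H1 f w -> H1 f' w' ->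
  dom e x -> f e x = f' e x.
Proof.
move=> uf uf' hf hf' Dx.
have := H1_null (H1_lin (-1) hf' hf); rewrite !scaleN1r => h.
have /h /(_ e x Dx) : null (- f' + f).
  move=> e'; apply: filterS2 (uf e') (uf' e') => y h1 h2 Dy.
  by apply/eqP; rewrite addrC subr_eq0 -h1 // -h2.
by rewrite addrC => /eqP; rewrite subr_eq0 => /eqP.
Qed.

Definition rep u : field G := xget 0 [set f | aeeq u f /\ exists w : L2space (G := G), H1 f w].

(** [rep] is chosen from [u] alone and may come with another derivative; two continuous
    representatives agree at every point of every edge, so it is a primitive of the given [w] as
    well. *)
Lemma repP u w : dL u w -> aeeq u (rep u) /\ H1 (rep u) w.
Proof.
move=> [Lu Lw [f [uf hf _]]].
have := xgetPex 0 (P := [set f | aeeq u f /\ exists w : L2space (G := G), H1 f w])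
  (ex_intro _ f (conj uf (ex_intro _ w hf))).
rewrite -/(rep u) => -[ur [w' hw']]; split => //.
split => //; move=> e x Dx.
have D0 : dom e 0 by apply/domE; split => //; exact: len_ge0.
rewrite -(dL_rep_unique uf ur hf hw' Dx) -(dL_rep_unique uf ur hf hw' D0).
exact: hf.2.
Qed.

(* The function [sum_k conj (u_k x) u_k / (1 + |d u_k|^2)] has at [x] the value [S x], and the
   square of its graph norm is at most [S x], so that the Sobolev inequality bounds [S x]. The
   integral of [S] is the trace. *)
Theorem d_trace_bound : resolvent_trace_bound ipL2 (dL (G := G)) (sobolev_const * \sum_e len e).
Proof.
move=> N u w huw ou ow u1.
set A := sobolev_const; have A0 : 0 <= A := sobolev_const_ge0.
have hr k := repP (huw k).
pose la k := 1 + sq (w k).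
have la0 k : 0 < la k by rewrite /la; have := sq_ge0 ipL2 (w k); lra.
have pyth (c : nat -> R[i]) (v : nat -> L2space) : (forall i j, i != j -> ipL2 (v i) (v j) = 0) ->
    sq (\sum_(0 <= k < N) c k *: v k) = \sum_(0 <= k < N) normsq (c k) * sq (v k).
  move=> ov; rewrite /sq ip_suml Rep_sum big_nat [RHS]big_nat; apply: eq_bigr => i hi.
  rewrite ip_sumr (bigD1_seq i) ?mem_index_iota ?iota_uniq // big1 ?addr0.
    by rewrite Monoid.mulm1; exact: (sqZ ipL2 (c i) (v i)).
  by move=> j /negPf ji; rewrite ipZl ipZr ov ?mulr0 // eq_sym ji.
pose S e x := \sum_(0 <= k < N) normsq (rep (u k) e x) / la k.
have S0 e x : 0 <= S e x.
  by apply: sumr_ge0 => k _; rewrite divr_ge0 ?normsq_ge0 // ltW.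
have SA e x : dom e x -> S e x <= A.
  move=> Dx; pose c k := (la k)^-1%:C * conjc (rep (u k) e x).
  pose g := \sum_(0 <= k < N) c k *: u k; pose v := \sum_(0 <= k < N) c k *: w k.
  have dgv : dL g v by exact: (adjoint_comb adjoint_delta_d).
  pose f : field G := \sum_(0 <= k < N) c k *: rep (u k).
  have [gf hf] : aeeq g f /\ H1 f v.
    rewrite /g /f /v; elim: (N) => [|n [IH1 IH2]].
      rewrite !big_geq //; split; [exact: aeeq_refl | exact: H1_0].
    rewrite !sum_nat_recrC.
    move: IH1 IH2; move: (\sum_(0 <= k < n) c k *: u k) (\sum_(0 <= k < n) c k *: w k)
      (\sum_(0 <= k < n) c k *: rep (u k)) => g' v' f' IH1 IH2.
    split.
      move=> e'; apply: filterS2 (IH1 e') ((hr n).1 e') => y h1 h2 Dy.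
      have -> : L2val (c n *: u n + g') e' y = c n * L2val (u n) e' y + L2val g' e' y by [].
      by rewrite h1 // h2.
    exact: H1_lin (hr n).2 IH2.
  have fS : f e x = (S e x)%:C.
    rewrite /f; have -> : (\sum_(0 <= k < N) c k *: rep (u k)) e x =
        \sum_(0 <= k < N) c k * rep (u k) e x.
      elim: (N) => [|n IH]; first by rewrite !big_geq.
      by rewrite !big_nat_recr //= -IH.
    rewrite /S rmorph_sum; apply: eq_bigr => k _ /=.
    by rewrite /c -mulrA [conjc _ * _]mulrC mulJ -rmorphM mulrC.
  have := sobolev gf hf Dx; rewrite fS normsqC !pyth // -/A -big_split /=.
  have cS : \sum_(0 <= k < N) (normsq (c k) * sq (u k) + normsq (c k) * sq (w k)) <= S e x.
    apply: ler_sum => k _; rewrite -mulrDr /c normsqM normsqC normsqJ.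
    apply: (@le_trans _ _ ((la k)^-1 ^+ 2 * normsq (rep (u k) e x) * la k)).
      apply: ler_wpM2l; first by rewrite mulr_ge0 ?sqr_ge0 ?normsq_ge0.
      by rewrite /la lerD2r.
    by rewrite expr2 [leRHS]mulrC mulrAC divfK ?gt_eqF // mulrC.
  move=> h; have h2 : S e x ^+ 2 <= A * S e x by apply: (le_trans h); apply: ler_wpM2l.
  have [->|Sn0] := eqVneq (S e x) 0; first exact: A0.
  have Sp : 0 < S e x by rewrite lt_neqAle eq_sym Sn0 S0.
  by rewrite expr2 ler_pM2r // in h2.
have sqE k : sq (u k) = \sum_e nsq_edge (rep (u k)) e.
  rewrite sq_ipL2; apply: eq_bigr => e _.
  exact: (nsq_edge_ae e (L2spaceP (u k)) (H1_L2 (hr k).2) (hr k).1).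
have -> : \sum_(0 <= k < N) sq (u k) / (1 + sq (w k)) =
    \sum_e \sum_(0 <= k < N) (la k)^-1 * nsq_edge (rep (u k)) e.
  rewrite exchange_big; apply: eq_bigr => k _ /=.
  by rewrite sqE mulr_suml; apply: eq_bigr => e _; rewrite mulrC.
rewrite mulr_sumr; apply: ler_sum => e _.
have mD := measurable_mdom e.
have ik k := csqint_normsq mD ((L2P _).1 (H1_L2 (hr k).2) e).
have [iS eS] : mu.-integrable (mdom e) (EFin \o S e) /\
    \int[mu]_(x in mdom e) S e x = \sum_(0 <= k < N) (la k)^-1 * nsq_edge (rep (u k)) e.
  rewrite /S; elim: (N) => [|n [IH1 IH2]].
    split; first by apply: eq_integrable_fin (integrable_cst_fin mD (mdom_finite e) 0) => // x _; rewrite big_geq.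
    rewrite big_geq //; under eq_Rintegral do rewrite big_geq //.
    by rewrite Rintegral_cst // mul0r.
  have E x : \sum_(0 <= k < n.+1) normsq (rep (u k) e x) / la k =
     (la n)^-1 * normsq (rep (u n) e x) + \sum_(0 <= k < n) normsq (rep (u k) e x) / la k.
    by rewrite big_nat_recr //= addrC mulrC.
  split.
    by apply: eq_integrable_fin (integrable_lin mD (la n)^-1 (ik n) IH1) => // x _; rewrite E.
  under eq_Rintegral do rewrite E.
  by rewrite (Rintegral_lin mD (la n)^-1 (ik n) IH1) IH2 big_nat_recr //= addrC.
rewrite -eS; have -> : A * len e = \int[mu]_(x in mdom e) A.
  exact: (esym (Rintegral_mdom_cst A e)).
apply: (le_Rintegral mD iS (integrable_cst_fin mD (mdom_finite e) A)).
exact: SA.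
Qed.

(* The ultrafilter makes the values at finitely many points converge; between these points
   [|f x - f y|^2 <= |x - y| int |f'|^2]. *)
Theorem d_compact : compact_embedding ipL2 (dL (G := G)).
Proof.
move=> U M UU hU e e0; have FU := @ultra_proper _ _ UU.
set L := \sum_e (len e)^+2.
have L0 : 0 <= L by apply: sumr_ge0 => ? _; exact: sqr_ge0.
have M0 : 0 <= M.
  have [p [_ h]] := filter_ex hU.
  by have := sq_ge0 ipL2 p.1; have := sq_ge0 ipL2 p.2; lra.
(* Each edge is cut into [N] cells. In the final estimate the variation inside the cells contributes
   [8 * L * M / N], which this choice makes smaller than [e / 2]. *)
pose N := (Num.truncn (16 * L * M / e)).+1.
have NL : 16 * L * M < N%:R * e.
  by rewrite -ltr_pdivrMr // truncnS_gt // divr_ge0 ?mulr_ge0 // ltW.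
have N0 : 0 < N%:R :> R by rewrite ltr0n.
pose pt (s : edge G * 'I_N) : R := s.2%:R * (len s.1 / N%:R).
have dpt s : dom s.1 (pt s).
  apply/domE; rewrite /pt; split.
    by rewrite mulr_ge0 // divr_ge0 // len_ge0.
  rewrite mulrA ler_pdivrMr // mulrC ler_wpM2l ?len_ge0 // ler_nat; exact: ltnW.
pose ev s (p : L2space (G := G) * L2space (G := G)) := rep p.1 s.1 (pt s).
(* The coefficient of [eta] in the final estimate; [eta] is then chosen so that the values at the
   grid points contribute at most [e / 4]. *)
pose K : R := \sum_(e : edge G) (4 * len e * N%:R).
have K0 : 0 <= K by apply: sumr_ge0 => ? _; rewrite !mulr_ge0 ?len_ge0.
pose eta := e / (4 * (K + 1)).
have eta0 : 0 < eta by rewrite divr_gt0 //; lra.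
have Bnd s : U [set p | normsq (ev s p) <= sobolev_const * M].
  apply: filterS hU => p [hd hM]; have [h1 h2] := repP hd.
  apply: (le_trans (sobolev h1 h2 (dpt s))).
  by apply: ler_wpM2l => //; exact: sobolev_const_ge0.
have part (pr : R[i] -> R) : (forall z, pr z ^+ 2 <= normsq z) -> forall s,
    exists E, U E /\ forall p q, E p -> E q -> (pr (ev s p) - pr (ev s q)) ^+ 2 < eta.
  move=> hpr s; pose B := sobolev_const * M + 1.
  have [|E [UE hE]] := @ultra_bounded_cauchy R _ U (fun p => pr (ev s p)) B UU _
      (Num.min 1 eta) ltac:(by rewrite lt_min ltr01).
    apply: filterS (Bnd s) => p /= h; have h1 := le_trans (hpr _) h.
    have B1 : 1 <= B by rewrite /B lerDr mulr_ge0 // sobolev_const_ge0.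
    have h3 : pr (ev s p) ^+ 2 <= B - 1 by rewrite /B; lra.
    rewrite leNgt; apply/negP => h4.
    have : B ^+ 2 < `|pr (ev s p)| ^+ 2 by rewrite ltr_pXn2r ?nnegrE //; lra.
    by rewrite real_normK ?num_real // => h5; nra.
  exists E; split => // p q Ep Eq; have := hE p q Ep Eq; rewrite lt_min => /andP[h1 h2].
  rewrite -real_normK ?num_real //; apply: le_lt_trans h2.
  by rewrite expr2 -[leRHS]mul1r; apply: ler_wpM2r => //; exact: ltW.
have h1 s := cid (part _ (@normsq_Rep R) s); have h2 s := cid (part _ (@normsq_Imp R) s).
exists ([set p | dL p.1 p.2 /\ sq p.1 + sq p.2 <= M] `&`
        ([set p | forall s, projT1 (h1 s) p] `&` [set p | forall s, projT1 (h2 s) p])).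
split.
  apply: filterI => //; apply: filterI; apply: filter_forall_fin => s;
    [exact: (projT2 (h1 s)).1 | exact: (projT2 (h2 s)).1].
move=> p q [[dp Mp] [p1 p2]] [[dq Mq] [q1 q2]].
have evb s : normsq (ev s p - ev s q) <= 2 * eta.
  have := (projT2 (h1 s)).2 p q (p1 s) (q1 s); have := (projT2 (h2 s)).2 p q (p2 s) (q2 s).
  by rewrite /normsq RepD ImpD RepN ImpN; lra.
have [rp hp] := repP dp; have [rq hq] := repP dq.
have hf : H1 (rep p.1 - rep q.1) (L2val (p.2 - q.2)).
  by have := H1_lin (-1) hq hp; rewrite !scaleN1r [- rep q.1 + _]addrC [- L2val q.2 + _]addrC.
set f := rep p.1 - rep q.1 in hf *.
have uf : aeeq (L2val (p.1 - q.1)) f.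
  move=> e'; apply: filterS2 (rp e') (rq e') => x a1 a2 Dx.
  have -> : L2val (p.1 - q.1) e' x = L2val p.1 e' x - L2val q.1 e' x by [].
  by rewrite a1 // a2.
have evf s : normsq (f s.1 (pt s)) <= 2 * eta := evb s.
clearbody f; clear evb.
have wM : sq (p.2 - q.2) <= 4 * M.
  have := sqB_le ipL2 p.2 q.2; have := sq_ge0 ipL2 p.1; have := sq_ge0 ipL2 q.1; lra.
have ptw e' x : dom e' x -> normsq (f e' x) <= 4 * N%:R * eta + 8 * (len e' / N%:R) * M.
  move=> Dx; have [x0 xl] := (domE e' x).1 Dx.
  have l0 := len_gt0 e'.
  have [i [ix xi]] : exists i : 'I_N, pt (e', i) <= x /\ x <= pt (e', i) + len e' / N%:R.
    have hN : 0 < len e' / N%:R by rewrite divr_gt0.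
    pose j := Num.truncn (x / (len e' / N%:R)).
    have j1 : j%:R * (len e' / N%:R) <= x.
      by rewrite -ler_pdivlMr // truncn_le // divr_ge0 // ltW.
    have j2 : x < j.+1%:R * (len e' / N%:R) by rewrite -ltr_pdivrMr // truncnS_gt.
    have [jN|Nj] := ltnP j N.
      by exists (Ordinal jN); rewrite /pt /=; split => //; apply/ltW; rewrite -natr1 in j2; lra.
    (* Here [N <= j], which happens only at the far end of the edge; this point is assigned to the
       last cell. *)
    exists ord_max; rewrite /pt /=.
    have e1 : (Num.truncn (16 * L * M / e))%:R * (len e' / N%:R) + len e' / N%:R = len e'.
      have -> : (Num.truncn (16 * L * M / e))%:R = N%:R - 1 :> R by rewrite /N -natr1; ring.
      by field; rewrite gt_eqF.
    have h3 : N%:R * (len e' / N%:R) <= j%:R * (len e' / N%:R).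
      by rewrite ler_pM2r // ler_nat.
    have e2 : N%:R * (len e' / N%:R) = len e' by field; rewrite gt_eqF.
    lra.
  have [c1 c2] := (H1P f (L2val (p.2 - q.2))).1 hf e'.
  have [y0 yl] := (domE e' _).1 (dpt (e', i)).
  have g1 := AC_holder_loc c1 y0 ix xl; have g2 := AC_holder_loc c2 y0 ix xl.
  have s1 := Rintegral_sqr_sub c1.1 y0 ix xl; have s2 := Rintegral_sqr_sub c2.1 y0 ix xl.
  have nw := nsq_edge_le (p.2 - q.2) e'.
  rewrite (nsq_edge_parts e' (L2spaceP _)) in nw.
  set y := pt (e', i) in ix xi y0 yl g1 g2 s1 s2 *.
  have fy : normsq (f e' y) <= 2 * eta := evf (e', i).
  have m1 : normsq (f e' x - f e' y) <= len e' / N%:R * (4 * M).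
    have -> : normsq (f e' x - f e' y) = (Rep (f e' x) - Rep (f e' y)) ^+ 2 +
        (Imp (f e' x) - Imp (f e' y)) ^+ 2 by rewrite /normsq RepD ImpD RepN ImpN.
    apply: (le_trans (lerD g1 g2)); rewrite -mulrDr.
    apply: ler_pM; first by rewrite subr_ge0.
    - by rewrite addr_ge0 //; apply: Rintegral_ge0 => ? _; exact: sqr_ge0.
    - by lra.
    - by apply: le_trans wM; apply: le_trans nw; apply: lerD.
  have -> : f e' x = (f e' x - f e' y) + f e' y by rewrite subrK.
  apply: (le_trans (normsqD_le _ _)).
  have N1 : 1 <= N%:R :> R by rewrite ler1n.
  have n1 : eta <= N%:R * eta by rewrite -[leLHS]mul1r; apply: ler_wpM2r => //; exact: ltW.
  lra.
rewrite sq_ipL2.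
apply: (@le_lt_trans _ _ (\sum_e' len e' * (4 * N%:R * eta + 8 * (len e' / N%:R) * M))).
  apply: ler_sum => e' _; rewrite -/(nsq_edge _ e') (nsq_edge_ae e' (L2spaceP _) (H1_L2 hf) uf).
  have mD := measurable_mdom e'.
  have -> : len e' * (4 * N%:R * eta + 8 * (len e' / N%:R) * M) =
      \int[mu]_(x in mdom e') (4 * N%:R * eta + 8 * (len e' / N%:R) * M).
    by rewrite mulrC; exact: (esym (Rintegral_mdom_cst _ e')).
  apply: (le_Rintegral mD _ (integrable_cst_fin mD (mdom_finite e') _) (ptw e')).
  exact: (csqint_normsq mD ((L2P _).1 (H1_L2 hf) e')).
have -> : \sum_e' len e' * (4 * N%:R * eta + 8 * (len e' / N%:R) * M) =
    K * eta + 8 * L * M / N%:R.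
  rewrite /K /L mulr_suml !mulr_sumr !mulr_suml -big_split; apply: eq_bigr => e' _ /=; ring.
have a1 : K * eta <= e / 4.
  by rewrite /eta mulrA ler_pdivrMr; [nra|lra].
have a2 : 8 * L * M / N%:R < e / 2 by rewrite ltr_pdivrMr //; lra.
lra.
Qed.

End Embedding.

(** * Kernels and the incidence matrix *)

Section KernelMatrix.
Context {R : realType} {V : lmodType R[i]} (ip : semiInner V).
Local Notation sq := (sq ip).

(** The map [L] identifies the left kernel of [M] with the kernel of [D] up to null vectors; a row
    basis of [kermx M] is transported and orthonormalized, and its size is given by rank-nullity. *)
Lemma kernel_basis_matrix (D A : V -> V -> Prop) N p (M : 'M[R[i]]_(N, p))
    (L : {linear 'rV[R[i]]_N -> V}) : adjoint_of ip A D ->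
  (forall x, x *m M = 0 -> D (L x) 0) ->
  (forall x, x *m M = 0 -> sq (L x) = 0 -> x = 0) ->
  (forall f, D f 0 -> exists x, x *m M = 0 /\ sq (f - L x) = 0) ->
  exists x, kernel_basis ip D (N - \rank M) x.
Proof.
move=> adjD kerL injL surjL; rewrite -mxrank_ker; set K := row_base (kermx M).
have KM : K *m M = 0 by apply/sub_kermxP; rewrite eq_row_base.
pose b k := L (if insub k is Some i then row i K else 0).
have sumb (c : nat -> R[i]) : \sum_(0 <= k < \rank (kermx M)) c k *: b k =
    L ((\row_i c i) *m K).
  rewrite big_mkord mulmx_sum_row linear_sum; apply: eq_bigr => i _.
  by rewrite linearZ mxE /b valK.
apply: (kernel_basis_exists (b := b) adjD).
- move=> i im; apply: kerL; rewrite insubT -row_mul KM; exact: row0.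
- move=> c; rewrite sumb => h; have /eqP : (\row_i c i) *m K = 0 by apply: injL h; rewrite -mulmxA KM mulmx0.
  rewrite mulmx_free_eq0 ?row_base_free // => /eqP c0 k km.
  by have := congr1 (fun x : 'rV_ _ => x 0 (Ordinal km)) c0; rewrite !mxE.
- move=> f /surjL [x [xM fx]].
  have /submxP [v xv] : (x <= K)%MS by rewrite eq_row_base; apply/sub_kermxP.
  exists (fun k => if insub k is Some i then v 0 i else 0); rewrite sumb.
  suff -> : \row_i (if insub (val i) is Some i0 then v 0 i0 else 0) = v by rewrite -xv.
  by apply/rowP => i; rewrite mxE valK.
Qed.

End KernelMatrix.

Section Kernels.
Context {R : realType} {G : quantum_graph R}.
Implicit Types (f g u w : field G) (e : edge G) (p q : edge G * bool).
Local Notation L2space := (L2space (G := G)).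
Local Notation nV := #|vertex G|.
Local Notation nE := #|edge G|.

Lemma H1_const f e x : H1 f 0 -> dom e x -> f e x = f e 0.
Proof.
move=> [_ h] Dx; rewrite h // -[RHS]addr0; congr (_ + _).
have [x0 _] := (domE e x).1 Dx.
by have := Cintegral_cst 0 x0; rewrite mulr0.
Qed.

Definition edgewise (a : edge G -> R[i]) : field G := fun e _ => a e.

Lemma H1_edgewise a : H1 (edgewise a) 0.
Proof.
split; first exact: L2_0.
move=> e x /domE [x0 _]; rewrite -[LHS]addr0; congr (_ + _); apply/esym.
by have := Cintegral_cst 0 x0; rewrite mulr0.
Qed.

Definition edgewiseL a : L2space := toL2 (H1_L2 (H1_edgewise a)).

Lemma edgewiseL_lin c a a' :
  edgewiseL (fun e => c * a e + a' e) = c *: edgewiseL a + edgewiseL a'.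
Proof. by apply: val_inj. Qed.

Lemma edgewiseL_inj a : sq ipL2 (edgewiseL a) = 0 -> forall e, a e = 0.
Proof.
move=> /null_sq h e.
exact: (H1_null (H1_edgewise a) h ((domE e 0).2 (conj (lexx 0) (len_ge0 e)))).
Qed.

(** For row vectors, multiplication by it is the coboundary (target minus source on each edge), and
    multiplication by its transpose is the divergence at the vertices. A loop gives a zero
    column. *)
Definition incidence : 'M[R[i]]_(nV, nE) := \matrix_(i, j)
  ((enum_val i == edge_tgt (enum_val j))%:R - (enum_val i == edge_src (enum_val j))%:R).

Lemma sum_enum_rank (T : finType) (F : 'I_#|T| -> R[i]) x :
  \sum_i F i * (enum_val i == x)%:R = F (enum_rank x).
Proof.
rewrite (bigD1 (enum_rank x)) //= enum_rankK eqxx mulr1 big1 ?addr0 // => i ni.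
case: eqP => [e|]; last by rewrite mulr0.
by rewrite -e enum_valK eqxx in ni.
Qed.

Lemma mul_incidence (a : 'rV_nV) e : (a *m incidence) 0 (enum_rank e) =
  a 0 (enum_rank (edge_tgt e)) - a 0 (enum_rank (edge_src e)).
Proof.
rewrite mxE -!(sum_enum_rank (a 0)) -sumrB; apply: eq_bigr => i _.
by rewrite mxE enum_rankK mulrBr.
Qed.

Lemma mul_incidence_tr (a : 'rV_nE) v : (a *m incidence^T) 0 (enum_rank v) =
  \sum_e a 0 (enum_rank e) * ((v == edge_tgt e)%:R - (v == edge_src e)%:R).
Proof.
rewrite mxE (reindex (@enum_rank (edge G))) /=; last first.
  by apply: onW_bij; exact: enum_rank_bij.
by apply: eq_bigr => e _; rewrite !mxE !enum_rankK.
Qed.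

Lemma balanced_incidence (a : 'rV_nE) f :
  (forall e, f e 0 = a 0 (enum_rank e) /\ f e (edge_len e) = a 0 (enum_rank e)) ->
  balanced_at_vertices (end_flux f) <-> a *m incidence^T = 0.
Proof.
move=> fa.
have sum_v v : \sum_(p | end_vertex p == v) end_flux f p = - (a *m incidence^T) 0 (enum_rank v).
  rewrite mul_incidence_tr -sumrN big_mkcond sum_ends; apply: eq_bigr => e _.
  rewrite /end_vertex /end_flux /= (fa e).1 (fa e).2 ![_ == v]eq_sym.
  by case: (v == _); case: (v == _) => /=; ring.
split=> h.
  apply/rowP => i; have := h (enum_val i); rewrite sum_v enum_valK => /eqP.
  by rewrite oppr_eq0 => /eqP ->; rewrite mxE.
by move=> v; rewrite sum_v h mxE oppr0.
Qed.

(** Reading the value at the source is a choice of convenience: on the left kernel of [incidence] it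
    agrees with the value at the target. *)
Definition vertex_field (a : 'rV[R[i]]_nV) : L2space :=
  edgewiseL (fun e => a 0 (enum_rank (edge_src e))).

Lemma vertex_field_lin : linear vertex_field.
Proof.
move=> c a a'; rewrite -edgewiseL_lin; congr edgewiseL.
by apply/funext => e; rewrite !mxE.
Qed.

HB.instance Definition _ :=
  GRing.isLinear.Build R[i] 'rV[R[i]]_nV L2space _ vertex_field vertex_field_lin.

Definition edge_field (a : 'rV[R[i]]_nE) : L2space :=
  edgewiseL (fun e => a 0 (enum_rank e)).

Lemma edge_field_lin : linear edge_field.
Proof.
move=> c a a'; rewrite -edgewiseL_lin; congr edgewiseL.
by apply/funext => e; rewrite !mxE.
Qed.

HB.instance Definition _ :=
  GRing.isLinear.Build R[i] 'rV[R[i]]_nE L2space _ edge_field edge_field_lin.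

Lemma edge_field_ker a : a *m incidence^T = 0 -> deltaL (edge_field a) 0.
Proof.
move=> h; apply: op_delta_rep; first by rewrite oppr0; exact: H1_edgewise.
by apply/(balanced_incidence (a := a)).
Qed.

(** An isolated vertex would be a zero row of [incidence], adding a dimension to its left kernel
    with no function on the edges behind it. The injectivity of [vertex_field] on that kernel rests
    on this lemma. *)
Lemma end_exists (v : vertex G) : exists p, end_vertex p = v.
Proof. by have [e [h|h]] := vertex_attached v; [exists (e, false)|exists (e, true)]. Qed.

Lemma vertex_field_end (a : 'rV_nV) : a *m incidence = 0 ->
  forall p, end_val (vertex_field a) p = a 0 (enum_rank (end_vertex p)).
Proof.
move=> h [e []] //=; rewrite /end_val /end_vertex /=; apply/esym/eqP.
by rewrite -subr_eq0 -mul_incidence h mxE.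
Qed.

Lemma ker_d_basis : exists x, kernel_basis ipL2 (dL (G := G)) (nV - \rank incidence) x.
Proof.
apply: (kernel_basis_matrix (L := vertex_field)) adjoint_delta_d _ _ _.
- move=> a h; apply: op_d_rep; first exact: H1_edgewise.
  by move=> p q pq; rewrite !vertex_field_end // pq.
- move=> a h /edgewiseL_inj a0; apply/rowP => i; rewrite mxE.
  have [p pv] := end_exists (enum_val i).
  rewrite -(enum_valK i) -pv -vertex_field_end // /end_val; case: ifP => _; exact: a0.
- move=> f [_ _ [f0 [ff0 hf0 ef0]]].
  have [p hp] := choice end_exists.
  pose a : 'rV_nV := \row_i end_val f0 (p (enum_val i)).
  have aE q : a 0 (enum_rank (end_vertex q)) = end_val f0 q.
    by rewrite mxE enum_rankK; apply: ef0.
  exists a; split.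
    apply/rowP => j; rewrite -[j]enum_valK mul_incidence [RHS]mxE.
    have := aE (enum_val j, true); have := aE (enum_val j, false).
    rewrite /end_vertex /end_val /= => -> ->; apply/eqP; rewrite subr_eq0; apply/eqP.
    by apply: (H1_const hf0); apply/domE; rewrite len_ge0.
  apply/aeeq_sq => e; apply: ae_sub (ff0 e) => x hx Dx; rewrite hx // (H1_const hf0) //.
  by have := aE (e, false); rewrite /end_vertex /end_val /= => <-.
Qed.

Lemma ker_delta_basis : exists x,
  kernel_basis ipL2 (deltaL (G := G)) (nE - \rank incidence) x.
Proof.
rewrite -mxrank_tr.
apply: (kernel_basis_matrix (L := edge_field)) adjoint_d_delta _ _ _.
- exact: edge_field_ker.
- move=> a h /edgewiseL_inj a0; apply/rowP => i; rewrite mxE -(enum_valK i); exact: a0.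
- move=> f [_ _ [f0 [ff0 hf0 bf0]]]; rewrite oppr0 in hf0.
  pose a : 'rV_nE := \row_i f0 (enum_val i) 0.
  exists a; split.
    apply/(balanced_incidence (f := f0)) => // e; rewrite mxE enum_rankK; split=> //.
    by apply: (H1_const hf0); apply/domE; rewrite len_ge0.
  apply/aeeq_sq => e; apply: ae_sub (ff0 e) => x hx Dx; rewrite hx // (H1_const hf0) //.
  by rewrite /edge_field /edgewiseL /= /edgewise mxE enum_rankK.
Qed.

(* The integrals of [w] over the edges are orthogonal to the kernel of the transposed
   incidence matrix, hence are the differences of a function on the vertices. *)
Lemma ran_d_orth (w : L2space) : (forall f : L2space, deltaL f 0 -> ipL2 w f = 0) ->
  exists u : L2space, dL u w.
Proof.
move=> worth.
pose W : 'rV[R[i]]_nE := \row_j Cintegral (dom (enum_val j)) (L2val w (enum_val j)).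
(* The inner product conjugates its second argument, so the relations satisfied by the row space of
   [incidence] are tested against conjugated cokernel vectors. These are again killed by the
   transpose because the entries are real. *)
have inc_conj : map_mx (@conjc R) incidence = incidence.
  by apply/matrixP => i j; rewrite !mxE conjcD conjcN !conjc_nat.
have /submxP [a Wa] : (W <= incidence)%MS.
  rewrite submxE; apply/eqP/rowP => j; rewrite [RHS]mxE.
  set c := row j (cokermx incidence)^T.
  have hc : map_mx (@conjc R) c *m incidence^T = 0.
    rewrite -inc_conj map_trmx -map_mxM -row_mul -trmx_mul mulmx_coker.
    by apply/matrixP => i k; rewrite !mxE rmorph0.
  have := worth _ (edge_field_ker hc); rewrite /= /L2inner /inner => h.
  rewrite -[RHS]h mxE (reindex (@enum_rank (edge G))) /=; last first.
    by apply: onW_bij; exact: enum_rank_bij.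
  apply: eq_bigr => e _; rewrite !mxE enum_rankK /edgewise.
  under [in RHS]eq_fun do rewrite !mxE conjcK mulrC.
  have [w1 w2] := (L2P _).1 (L2spaceP w) e.
  rewrite mulrC; apply/esym; apply: (CintegralZ (measurable_mdom e)).
  split; apply: (sqint_integrable (measurable_mdom e) (mdom_finite e)) => //.
have hu := H1_primitive (fun e => a 0 (enum_rank (edge_src e))) (L2spaceP w).
exists (toL2 (H1_L2 hu)); apply: op_d_rep => //.
have end_a p : end_val (fun e x => a 0 (enum_rank (edge_src e)) + Cintegral `[0, x] (L2val w e)) p
    = a 0 (enum_rank (end_vertex p)).
  case: p => e b; rewrite /end_val /end_vertex /=; case: b.
    have := mul_incidence a e; rewrite -Wa mxE enum_rankK => ->.
    by rewrite addrC subrK.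
  by rewrite /Cintegral !set_itv1 !Rintegral_set1 -[_ +i* _]/(0 : R[i]) addr0.
by move=> p q pq; rewrite !end_a pq.
Qed.

Lemma betti_difference :
  (nV - \rank incidence)%:Z - (nE - \rank incidence)%:Z = nV%:Z - nE%:Z :> int.
Proof. by rewrite -!subzn ?rank_leq_row ?rank_leq_col //; ring. Qed.

End Kernels.

Section Dimensions.
Context {R : realType} {G : quantum_graph R}.
Local Notation L2space := (L2space (G := G)).
Local Notation sq := (sq ipL2).
Implicit Types (f g : field G) (u w : L2space).

Lemma L2_val f : L2 f -> exists u : L2space, f = L2val u.
Proof. by move=> h; exists (toL2 h). Qed.

Lemma L2val_sum (I : Type) (s : seq I) (P : pred I) (c : I -> R[i]) (x : I -> L2space) :
  L2val (\sum_(i <- s | P i) c i *: x i) = \sum_(i <- s | P i) c i *: L2val (x i).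
Proof. by elim/big_rec2: _ => // i y z _ <-. Qed.

Lemma L2val_comb n (c : 'I_n -> R[i]) (x : nat -> L2space) : \sum_i c i *: L2val (x i) =
  L2val (\sum_(0 <= k < n) (if insub k is Some i then c i else 0) *: x k).
Proof. by rewrite big_mkord L2val_sum; apply: eq_bigr => i _; rewrite valK. Qed.

Lemma has_dim_ker (D : operator G) (A : L2space -> L2space -> Prop) n x :
  (forall f, op_ker D f -> L2 f) -> adjoint_of ipL2 A (fun u w => D u w) ->
  kernel_basis ipL2 (fun u w => D u w) n x -> has_dim (op_ker D) n.
Proof.
move=> DL2 adjD kx; have [kerx ox tx] := kx; exists (fun i : 'I_n => L2val (x i)); split.
- by move=> i; exact: kerx.
- move=> c; rewrite L2val_comb => /null_sq h i.
  have := orthonormal_coef (fun k => if insub k is Some i then c i else 0) ox (ltn_ord i).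
  by rewrite ip_null_l // valK => <-.
- move=> f Df; have [u fu] := L2_val (DL2 _ Df); rewrite fu in Df *.
  exists (fun i => ipL2 u (x i)); rewrite L2val_comb.
  apply/(null_sq (u - _)); rewrite -[RHS](kernel_basis_expand adjD kx Df).
  congr (sq (u - _)); rewrite big_nat [RHS]big_nat.
  by apply: eq_bigr => k /andP[_ kn]; rewrite insubT.
Qed.

(** Elements of the range are orthogonal to ker delta, which gives independence modulo the range;
    after projection off ker delta any vector lies in the range by [ran_d_orth], so no closure of
    the range is taken. *)
Lemma has_codim_ran_d n x : kernel_basis ipL2 (deltaL (G := G)) n x ->
  has_codim (op_ran (op_d G)) n.
Proof.
move=> kx; have [kerx ox tx] := kx; exists (fun i : 'I_n => L2val (x i)); split.
- by move=> i; exact: L2spaceP.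
- move=> c; rewrite L2val_comb => -[u hu] i.
  have := orthonormal_coef (fun k => if insub k is Some i then c i else 0) ox (ltn_ord i).
  rewrite valK => <-; have [Lu _] := op_d_L2 hu.
  rewrite [LHS](op_d_delta hu (kerx i (ltn_ord i))).
  exact: (ip0r ipL2 (toL2 Lu)).
- move=> f /L2_val [u ->]; exists (fun i => ipL2 u (x i)); rewrite L2val_comb.
  have [g hg] := ran_d_orth (fun h hh => kernel_basis_orth adjoint_d_delta kx
    (orthonormal_remainder u ox) hh).
  exists g; congr (op_d G _ _): hg; rewrite -[RHS]/(L2val (u - _)); congr (L2val (u - _)).
  rewrite big_nat [RHS]big_nat.
  by apply: eq_bigr => k /andP[_ kn]; rewrite insubT.
Qed.

End Dimensions.

(** * Heat semigroups and traces on the graph *)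

Section Limits.
Context {R : realType}.

Lemma filter_lim_sqrt (T : Type) (U : set_system T) (F a : T -> R) : Filter U ->
  (\forall s \near U, F s = Num.sqrt (a s)) ->
  (F @ U --> (0 : R)) <-> forall e, 0 < e -> \forall s \near U, a s < e.
Proof.
move=> FU hF; split=> [/cvgrPdist_lt h e e0|h].
  have r0 : 0 < Num.sqrt e by rewrite sqrtr_gt0.
  apply: filterS2 hF (h _ r0) => s -> /=.
  by rewrite sub0r normrN ger0_norm ?sqrtr_ge0 // ltr_sqrt.
apply/cvgrPdist_lt => e e0; apply: filterS2 hF (h _ (exprn_gt0 2 e0)) => s -> ae /=.
rewrite sub0r normrN ger0_norm ?sqrtr_ge0 // -(ger0_norm (ltW e0)) -sqrtr_sqr.
by rewrite ltr_sqrt ?exprn_gt0.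
Qed.

Lemma lim_sqrt (F a : R -> R) (D : set R) t : (forall s, D s -> F s = Num.sqrt (a s)) ->
  (F @ within D (nbhs t) --> (0 : R)) <->
  (forall e, 0 < e -> exists d, 0 < d /\ forall s, D s -> `|s - t| < d -> a s < e).
Proof.
move=> hF; apply: iff_trans (filter_lim_sqrt (a := a) _ _) _.
  by apply: (@filterE _ (nbhs t)) => s; exact: hF.
split=> h e e0.
  have /nbhs_ballP [d /= d0 hd] := h _ e0.
  by exists d; split=> // s Ds sd; apply: hd => //; rewrite /ball /= distrC.
have [d [d0 hd]] := h e e0; apply/nbhs_ballP; exists d => //= s.
by rewrite /ball /= distrC => sd Ds; exact: hd.
Qed.

Lemma lim_sqrt_right (F a : R -> R) : (forall t, 0 < t -> F t = Num.sqrt (a t)) ->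
  (F @ 0^'+ --> (0 : R)) <->
  (forall e, 0 < e -> exists d, 0 < d /\ forall t, 0 < t -> t < d -> a t < e).
Proof.
move=> hF; apply: iff_trans (lim_sqrt 0 hF) _.
split=> h e e0; have [d [d0 hd]] := h e e0; exists d; split=> // t t0.
  by move=> td; apply: hd => //; rewrite subr0 gtr0_norm.
by rewrite subr0 gtr0_norm //; exact: hd.
Qed.

Lemma lim_sqrt_seq (a : nat -> R) :
  ((fun n => Num.sqrt (a n)) @ \oo --> (0 : R)) <->
  (forall e, 0 < e -> exists N, forall n, (N <= n)%N -> a n < e).
Proof.
apply: iff_trans (filter_lim_sqrt _ (nearW _ _)) _ => //.
by split=> h e e0; have [N] := h e e0; exists N.
Qed.

End Limits.

Section HeatSemigroups.
Context {R : realType} {G : quantum_graph R}.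
Local Notation L2space := (L2space (G := G)).
Local Notation sq := (sq ipL2).
Implicit Types (f g : field G) (u w : L2space) (t s : R).

(** Total, with default 0 off L^2, so that semigroups acting on all fields and on [L2space] can be
    converted without carrying proofs. *)
Definition toL2d f : L2space := insubd (0 : L2space) f.

Lemma toL2dK f : L2 f -> L2val (toL2d f) = f.
Proof. by move=> h; apply: insubdK; apply/asboolP. Qed.

Lemma L2valK u : toL2d (L2val u) = u.
Proof. exact: valKd. Qed.

Context {A : operator G}.

Lemma heat_semigroupL T : heat_semigroup A T ->
  semigroup_of ipL2 (fun u w => A u w) (fun t u => toL2d (T t (L2val u))).
Proof.
move=> [TL2 Tlin Tbd T0 TD Tcont Tgen].
have TE t u : 0 <= t -> L2val (toL2d (T t (L2val u))) = T t (L2val u).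
  by move=> t0; apply: toL2dK; apply: TL2 => //; exact: L2spaceP.
split.
- move=> t c f g t0; apply/aeeq_sq.
  have h := Tlin t c _ _ t0 (L2spaceP f) (L2spaceP g).
  by rewrite -(TE t f t0) -(TE t g t0) -(TE t (c *: f + g) t0) in h.
- move=> t t0; have [M hM] := Tbd t t0; exists (M ^+ 2) => f.
  have h := hM _ (L2spaceP f); rewrite -TE // !L2norm_sq in h.
  rewrite -(sqr_sqrtr (sq_ge0 _ (toL2d _))) -(sqr_sqrtr (sq_ge0 ipL2 f)) -exprMn !expr2.
  by apply: ler_pM => //; exact: sqrtr_ge0.
- by move=> f; apply/aeeq_sq; rewrite TE //; exact: T0 (L2spaceP f).
- move=> s t f s0 t0; apply/aeeq_sq; rewrite !TE ?addr_ge0 //.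
  exact: TD (L2spaceP f).
- move=> t f e t0; move: e; apply: (lim_sqrt _ _).1 (Tcont t _ t0 (L2spaceP f)) => s s0.
  rewrite -L2norm_sq.
  exact: esym (congr1 (@L2norm R G) (f_equal2 (fun x y => x - y) (TE s f s0) (TE t f t0))).
- move=> f g; apply: iff_trans (Tgen _ _ (L2spaceP f) (L2spaceP g)) _.
  apply: lim_sqrt_right => t /ltW t0; rewrite -L2norm_sq.
  exact: esym (congr1 (fun x => L2norm (t^-1%:C *: (L2val f - x) - L2val g)) (TE t f t0)).
Qed.

Lemma heat_semigroup_of T : semigroup_of ipL2 (fun u w => A u w) T ->
  heat_semigroup A (fun t f => L2val (T t (toL2d f))).
Proof.
move=> [Tlin Tbd T0 TD Tcont Tgen]; split.
- by move=> t f _ _; exact: L2spaceP.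
- move=> t c f g t0 /L2_val [u ->] /L2_val [w ->].
  rewrite -[c *: _ + _]/(L2val (c *: u + w)) !L2valK.
  exact: (aeeq_sq _ (c *: T t u + T t w)).2 (Tlin t c u w t0).
(* The bound [M] concerns squares and carries no sign condition, hence the root of its absolute
   value. *)
- move=> t t0; have [M hM] := Tbd t t0; exists (Num.sqrt `|M|) => f /L2_val [u ->].
  rewrite L2valK !L2norm_sq -sqrtrM // ler_wsqrtr // (le_trans (hM u)) //.
  by rewrite ler_wpM2r ?sq_ge0 // ler_norm.
- by move=> f /L2_val [u ->]; rewrite L2valK; apply/aeeq_sq; exact: T0.
- by move=> s t f s0 t0 /L2_val [u ->]; rewrite !L2valK; apply/aeeq_sq; exact: TD.
- move=> t f t0 /L2_val [u ->]; apply/(lim_sqrt (a := fun s => sq (T s u - T t u))).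
    by move=> s _; rewrite L2valK -L2norm_sq.
  by move=> e e0; exact: Tcont.
- move=> f g /L2_val [u ->] /L2_val [w ->]; apply: iff_trans (Tgen u w) _.
  by apply: iff_sym; apply: lim_sqrt_right => t _; rewrite L2valK -L2norm_sq.
Qed.

Lemma L2val_fourier (b : nat -> L2space) N u : L2val (fourier_sum ipL2 b N u) =
  \sum_(n < N) inner (L2val u) (L2val (b n)) *: L2val (b n).
Proof.
transitivity (\sum_(0 <= n < N) inner (L2val u) (L2val (b n)) *: L2val (b n)).
  exact: L2val_sum.
by rewrite big_mkord.
Qed.

Lemma orthonormal_basis_of (b : nat -> L2space) J : orthonormal_family ipL2 b J -> spanning ipL2 b ->
  orthonormal_basis J (fun n => L2val (b n)).
Proof.
move=> ob hb; split.
- by move=> n _; exact: L2spaceP.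
- by move=> m n _ Jn; have := ob m n; rewrite Jn andbT.
- move=> f /L2_val [u ->].
  suff E N : L2norm (L2val u - \sum_(n < N | J n) inner (L2val u) (L2val (b n)) *: L2val (b n)) =
      Num.sqrt (sq (fourier_sum ipL2 b N u - u)).
    under eq_fun do rewrite E.
    by apply/lim_sqrt_seq => e e0; have [N hN] := hb u e e0; exists N.
  have -> : \sum_(n < N | J n) inner (L2val u) (L2val (b n)) *: L2val (b n) =
      L2val (fourier_sum ipL2 b N u).
    rewrite L2val_fourier big_mkcond; apply: eq_bigr => n _; case: ifPn => // nJ.
    have h := coef_notJ ob u nJ; rewrite /= /L2inner in h.
    by rewrite h scale0r.
  by rewrite sqBC -L2norm_sq.
Qed.

(** Nothing is known of [c n] off [J], so these vectors are replaced by 0, as the convention of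
    [orthonormal_family] demands. *)
Lemma family_of_orthonormal_basis J (c : nat -> field G) : orthonormal_basis J c ->
  exists b : nat -> L2space, [/\ orthonormal_family ipL2 b J, spanning ipL2 b &
    forall n, L2val (b n) = if J n then c n else 0].
Proof.
move=> [cL2 oc hc]; pose b n : L2space := toL2d (if J n then c n else 0).
have bE n : L2val (b n) = if J n then c n else 0.
  by apply: toL2dK; case: ifP => [/cL2 //|_]; exact: L2_0.
have b0 n : ~~ J n -> b n = 0.
  by move=> /negPf nJ; apply: val_inj; rewrite /= bE nJ.
exists b; split => //.
- move=> m n; have [Jn|nJ] := boolP (J n); last by rewrite andbF (b0 n nJ) ip0r.
  have [Jm|nJ] := boolP (J m); last first.
    by rewrite (b0 m nJ) ip0l; case: eqP => // e; rewrite e Jn in nJ.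
  by rewrite /= /L2inner !bE Jm Jn andbT; exact: oc.
- move=> u; apply/lim_sqrt_seq.
  suff -> : (fun N => Num.sqrt (sq (fourier_sum ipL2 b N u - u))) = (fun N =>
      L2norm (L2val u - \sum_(n < N | J n) inner (L2val u) (c n) *: c n)).
    exact: hc (L2spaceP u).
  apply/funext => N; rewrite sqBC -L2norm_sq.
  have -> : \sum_(n < N | J n) inner (L2val u) (c n) *: c n =
      L2val (fourier_sum ipL2 b N u).
    rewrite L2val_fourier big_mkcond; apply: eq_bigr => n _; rewrite bE.
    by case: ifP => // _; rewrite scaler0.
  by [].
Qed.

Lemma heat_trace (b : nat -> L2space) J (l : nat -> R) T t tau : heat_semigroup A T ->
  orthonormal_family ipL2 b J -> spanning ipL2 b -> (forall k, 0 <= l k) ->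
  (forall k, A (L2val (b k)) (L2val ((l k)%:C *: b k))) -> 0 <= t ->
  (forall N, \sum_(0 <= k < N) (J k)%:R * expR (- (t * l k)) <= tau) ->
  (forall e, 0 < e -> exists N, tau < \sum_(0 <= k < N) (J k)%:R * expR (- (t * l k)) + e) ->
  has_trace (T t) tau%:C.
Proof.
move=> hT ob hb l0 Hb t0 ub lub; split.
  by exists J, (fun n => L2val (b n)); exact: orthonormal_basis_of.
move=> J' c /family_of_orthonormal_basis [c' [oc hc' c'E]].
have sg := heat_semigroupL hT.
have E N : \sum_(n < N | J' n) inner (T t (c n)) (c n) =
    \sum_(0 <= n < N) ipL2 (toL2d (T t (L2val (c' n)))) (c' n).
  rewrite big_mkord [LHS]big_mkcond; apply: eq_bigr => n _.
  have := c'E n; case: ifP => [Jn <-|_ c0].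
    rewrite /= /L2inner toL2dK //; apply: (heat_L2 hT t0); exact: L2spaceP.
  by rewrite (_ : c' n = 0) ?ip0r //; apply: val_inj.
have EIm N : Imp (\sum_(n < N | J' n) inner (T t (c n)) (c n)) = 0.
  rewrite E Imp_sum big1 // => n _.
  exact: (semigroup_diag_Im sg hb l0 Hb t0).
split; last by under eq_fun do rewrite EIm; exact: cvg_cst.
under eq_fun do rewrite E Rep_sum; apply/cvgrPdist_lt => e e0.
have [N hN] := semigroup_trace sg ob hb l0 Hb t0 ub lub oc hc' e0.
by exists N => // n Nn; rewrite /= distrC; exact: hN.
Qed.

End HeatSemigroups.

Section SpectralSum.
Context {R : realType} {V : lmodType R[i]} {ip : semiInner V}.
Context {D A : V -> V -> Prop} (adjA : adjoint_of ip D A).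
Context {b : nat -> V} {J : pred nat} {v : nat -> V} {C : R}.
Hypothesis eb : eigenbasis ip (D := D) (A := A) b J v.
Hypothesis traceD : resolvent_trace_bound ip D C.

(** Term by term, [exp_resolvent_bound] compares the sum with [1 + t^-1] times the resolvent trace,
    which [C] bounds. *)
Lemma positive_heat_sum (t : R) : 0 < t -> exists tau,
  (forall N, \sum_(0 <= k < N)
     (@positive_part _ _ ip J v k)%:R * expR (- (t * sq ip (v k))) <= tau) /\
  (forall e, 0 < e -> exists N, tau < \sum_(0 <= k < N)
     (@positive_part _ _ ip J v k)%:R * expR (- (t * sq ip (v k))) + e).
Proof.
move=> t0; have [ob Db Av hb] := eb.
apply: (nonneg_sum_exists (B := (1 + t^-1) * C)) => [n|N].
  by rewrite mulr_ge0 ?expR_ge0.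
have t1 : 0 <= 1 + t^-1 by rewrite addr_ge0 // invr_ge0 ltW.
have h : \sum_(0 <= k < N) sq ip (b k) / (1 + sq ip (v k)) <= C.
  apply: traceD => //.
  - by move=> i j /negPf ij; rewrite ob ij.
  - by move=> i j /negPf ij; rewrite (eigen_orthogonal adjA ob Db Av (Db i)) ob ij mulr0.
  - by move=> k; rewrite (orthonormal_sq _ ob); case: (J k).
apply: le_trans (ler_wpM2l t1 h); rewrite mulr_sumr; apply: ler_sum => k _.
rewrite (orthonormal_sq _ ob) /positive_part; have s0 := sq_ge0 ip (v k).
case: (J k) => /=; last by rewrite !mul0r mulr0.
have e0 := exp_resolvent_bound t0 s0; rewrite mul1r.
by apply: le_trans e0; rewrite ler_piMl ?expR_ge0 // lern1; case: (_ == _).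
Qed.

End SpectralSum.

(** * Assembly for the two Laplacians *)

Section MainProof.
Context {R : realType} {G : quantum_graph R}.
Local Notation L2space := (L2space (G := G)).

Lemma op_HK_L2 (u w : L2space) : op_HK G u w <-> exists x : L2space, dL u x /\ deltaL x w.
Proof.
apply: iff_trans (op_HK_comp _ _) _; split=> [[x [dx hx]]|[x [dx hx]]].
  have [_ /L2_val [y xy]] := op_d_L2 dx.
  by exists y; rewrite /dL /deltaL -xy.
by exists x.
Qed.

Lemma op_HA_L2 (u w : L2space) : op_HA G u w <-> exists x : L2space, deltaL u x /\ dL x w.
Proof.
apply: iff_trans (op_HA_comp _ _) _; split=> [[x [dx hx]]|[x [dx hx]]].
  have [_ /L2_val [y xy]] := op_delta_L2 dx.
  by exists y; rewrite /dL /deltaL -xy.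
by exists x.
Qed.

Lemma heat_semigroup_exists (H : operator G) (D A : L2space -> L2space -> Prop) b J v l :
  adjoint_of ipL2 D A -> adjoint_of ipL2 A D ->
  (forall u w : L2space, H u w <-> exists x, D u x /\ A x w) ->
  eigensystem ipL2 (D := D) (A := A) b J v l -> exists T, heat_semigroup H T.
Proof.
move=> adjA adjD HE es; have [ob _ _ l0 hb] := es.
have [|T hT] := semigroup_exists (H := fun u w : L2space => H u w) L2_complete ob hb l0.
  by move=> f g; apply: iff_trans (HE f g) _; exact: (eigen_domain adjA adjD L2_complete es).
by eexists; exact: heat_semigroup_of hT.
Qed.

Lemma heat_trace_eigensystem (H : operator G) (D A : L2space -> L2space -> Prop) b J v l T t tau :
  (forall u w : L2space, H u w <-> exists x, D u x /\ A x w) ->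
  eigensystem ipL2 (D := D) (A := A) b J v l -> heat_semigroup H T -> 0 <= t ->
  (forall N, \sum_(0 <= k < N) (J k)%:R * expR (- (t * l k)) <= tau) /\
  (forall e, 0 < e -> exists N, tau < \sum_(0 <= k < N) (J k)%:R * expR (- (t * l k)) + e) ->
  has_trace (T t) tau%:C.
Proof.
move=> HE [ob Db Av l0 hb] hT t0 [ub lub].
apply: (heat_trace hT ob hb l0 _ t0 ub lub) => k.
by apply/HE; exists (v k).
Qed.

End MainProof.

Theorem theorem20 (R : realType) (G : quantum_graph R) :
  (* the setting: delta = d^*, H_K = delta d, H_A = d delta, and the heat
     operators exist *)
  [/\ op_eq (op_delta G) (op_adjoint (op_d G)),
      op_eq (op_HK G) (op_comp (op_delta G) (op_d G)),
      op_eq (op_HA G) (op_comp (op_d G) (op_delta G)),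
      (exists T, heat_semigroup (op_HK G) T) &
      (exists T, heat_semigroup (op_HA G) T)]
  /\
  (* index d = V - E, and codim ran d = dim ker delta *)
  [/\ fredholm_index (op_d G) (#|vertex G|%:Z - #|edge G|%:Z) &
      (exists n, has_codim (op_ran (op_d G)) n /\
                 has_dim (op_ker (op_delta G)) n)]
  /\
  (* Tr e^{-t H_K} - Tr e^{-t H_A} = V - E for every t > 0 *)
  (forall TK TA : R -> field G -> field G,
     heat_semigroup (op_HK G) TK -> heat_semigroup (op_HA G) TA ->
     forall t : R, 0 < t ->
     exists tauK tauA : complex R,
       [/\ has_trace (TK t) tauK, has_trace (TA t) tauA &
           tauK - tauA = #|vertex G|%:R - #|edge G|%:R]).
Proof.
have adjA := @adjoint_d_delta R G; have adjD := @adjoint_delta_d R G.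
have [x kx] := @ker_d_basis R G; have [y ky] := @ker_delta_basis R G.
have [b [J [v eb]]] := eigenbasis_exists adjA adjD L2_complete (@d_compact R G)
  (@deltaL_inj R G) (@d_trace_bound R G).
have esK := eigensystem_ker adjA adjD L2_complete eb kx.
have esA := eigensystem_ran adjA adjD L2_complete (@dL_inj R G)
  (@ran_d_orth R G) eb ky.
split; first split.
- exact: op_delta_adjoint.
- exact: op_HK_comp.
- exact: op_HA_comp.
- exact: heat_semigroup_exists adjA adjD op_HK_L2 esK.
- exact: heat_semigroup_exists adjD adjA op_HA_L2 esA.
have codim := has_codim_ran_d ky.
split; first split.
- exists (#|vertex G| - \rank (incidence (G := G)))%N, (#|edge G| - \rank (incidence (G := G)))%N.
  split => //; last by rewrite betti_difference.
  by apply: (has_dim_ker _ adjD kx) => f [].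
- exists (#|edge G| - \rank (incidence (G := G)))%N; split=> //.
  by apply: (has_dim_ker _ adjA ky) => f [].
move=> TK TA hK hA t t0.
(* Both traces contain the same sum [S] over the positive eigenvalues; only the kernel dimensions in
   front differ, and in their difference the rank cancels. *)
have [S [ub lub]] := positive_heat_sum adjA eb (@d_trace_bound R G) t0.
exists ((#|vertex G| - \rank (incidence (G := G)))%:R + S)%:C.
exists ((#|edge G| - \rank (incidence (G := G)))%:R + S)%:C; split.
- exact: heat_trace_eigensystem op_HK_L2 esK hK (ltW t0) (catfam_sum _ ub lub).
- exact: heat_trace_eigensystem op_HA_L2 esA hA (ltW t0) (catfam_sum _ ub lub).
- rewrite !rmorphD /= !rmorph_nat !natrB ?rank_leq_row ?rank_leq_col //; ring.
Qed.
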